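(* Let $d=1$ and $N\geq 1$, and let $H^{(N)}$ be the $N$-particle Anderson Hamiltonian described in the context. For every localization length $m>0$ and decay parameter $p>0$ there exist explicit constants $C(m,N,p)$ and $C(m,N,p,\|\rho\|_\infty,L_0)$ (also allowed to depend on the fixed quantities $d,\beta,\gamma,\tau$ and the density $\rho$) such that the following holds: if the initial length scale $L_0\geq 1$ and the disorder parameter $\lambda>0$ satisfy $$L_0\geq C(m,N,p)\qquad\text{and}\qquad \lambda\geq C(m,N,p,\|\rho\|_\infty,L_0),$$ then for all $L\geq L_0$, $$\inf_{\mathbf a\in\mathbb Z^{Nd}}\mathbb P\big(\Lambda_L^{(N)}(\mathbf a)\text{ is } m\text{-localizing for } H^{(N)}\big)\geq 1-L^{-p}.$$
   Context: Fix parameters $\beta,\tau\in(0,1)$ and $\gamma>1$ with $\beta<\gamma^{-1}<1<\gamma<2$ and $\max(\gamma\beta,\gamma^{-1})<\tau<1$. Points of $\mathbb Z^{Nd}$ are written $\mathbf x=(x_1,\dots,x_N)$ with $x_j\in\mathbb Z^d$; the symmetric group $S_N$ acts by $\pi\mathbf x=(x_{\pi(1)},\dots,x_{\pi(N)})$. The symmetrized distance is $d_S(\mathbf x,\mathbf y)=\min_{\pi\in S_N}\|\mathbf x-\pi\mathbf y\|_\infty$. For $\mathbf a\in\mathbb Z^{Nd}$ and real $L>0$, $\Lambda_L^{(N)}(\mathbf a)=\{\mathbf x\in\mathbb Z^{Nd}: d_S(\mathbf x,\mathbf a)\leq L\}$. Random potential: $\mathcal V=\{\mathcal V(u)\}_{u\in\mathbb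 Z^d}$ are i.i.d. random variables with density $\rho$ such that (i) $\operatorname{supp}\rho\subseteq[0,v_{\max}]$ for some $v_{\max}>0$; (ii) there are $\rho_{\min},\rho_{\max}>0$ with $\rho_{\min}\le\rho(v)\le\rho_{\max}$ for all $v\in[0,v_{\max}]$; (iii) $\rho$ is continuously differentiable on $(0,v_{\max})$ with $\rho'$ bounded there. The interaction $\mathcal U:\mathbb Z^d\to\mathbb R$ has finite support, and $\lambda>0$. The $N$-particle Hamiltonian on $\ell^2(\mathbb Z^{Nd})$ is $H^{(N)}=-\Delta^{(N)}+\lambda V+U$, where $(\Delta^{(N)}\varphi)(\mathbf x)=\sum_{\mathbf y:\|\mathbf y-\mathbf x\|_1=1}\varphi(\mathbf y)$, $V(\mathbf x)=\sum_{j=1}^N\mathcal V(x_j)$, $U(\mathbf x)=\sum_{1\le i<j\le N}\mathcal U(x_i-x_j)$. For $\Theta\subseteq\mathbb Z^{Nd}$, $H_\Theta=1_\Theta H1_\Theta$ acting on $\ell^2(\Theta)$. Localization: for $\Lambda_L=\Lambda_L^{(N)}(\mathbf a)$, $\mathbf x\in\Lambda_L$ and $m>0$, $\varphi\in\ell^2(\Lambda_L)$ is $(\mathbf x,m)$-localizing if $\|\varphi\|_{\ell^2}=1$ and $|\varphi(\mathbf y)|\le e^{-m\,d_S(\mathbf y,\mathbf x)}$ for all $\mathbf y\in\Lambda_L$ with $d_S(\mathbf y,\mathbf x)\ge L^\tau$; it is $m$-localizing if it is $(\mathbf x,m)$-localizing for some $\mathbf x\in\Lambda_L$. The cube $\Lambda_L$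 is $m$-localizing for $H$ if $H_{\Lambda_L}$ has an orthonormal eigenbasis (eigenvalues repeated according to multiplicity) all of whose elements are $m$-localizing. *)

(* Defs.v *)
From HB Require Import structures.
From mathcomp Require Import all_boot all_order all_algebra all_fingroup.
From mathcomp Require Import all_classical all_reals all_analysis.
Set Implicit Arguments. Unset Strict Implicit. Unset Printing Implicit Defensive.
Import Order.TTheory GRing.Theory Num.Theory numFieldNormedType.Exports.
Local Open Scope classical_set_scope.
Local Open Scope ring_scope.

(* d = 1 : a configuration of N particles is a point of Z^N. *)
Definition pt (N : nat) := {ffun 'I_N -> int}.

Definition supdist N (x y : pt N) : nat := (\max_(j < N) `|x j - y j|)%N.

Definition permpt N (s : {perm 'I_N}) (y : pt N) : pt N := [ffun j => y (s j)].

(* symmetrized distance d_S(x,y) = min_{pi in S_N} ||x - pi y||_oo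
   (identity permutation used as initial value; it is among the s anyway) *)
Definition dS N (x y : pt N) : nat :=
  (\big[minn/supdist x y]_(s : {perm 'I_N}) supdist x (permpt s y))%N.

Definition in_cube {R : realType} N (a : pt N) (L : R) (x : pt N) : bool :=
  ((dS x a)%:R <= L).

(* An explicit finite, duplicate-free enumeration of Lambda_L^{(N)}(a):
   points of a large enough box, filtered by membership. *)
Definition box_bound {R : realType} N (a : pt N) (L : R) : nat :=
  ((\max_(j < N) `|a j|) + `|Num.floor L| + 1)%N.

Definition cube_seq {R : realType} N (a : pt N) (L : R) : seq (pt N) :=
  let M := box_bound a L in
  [seq x <- [seq ([ffun j => (nat_of_ord (f j))%:Z - M%:Z] : pt N)
        | f : {ffun 'I_N -> 'I_(M + M).+1} <- enum {ffun 'I_N -> 'I_(M + M).+1}]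
     | in_cube a L x].

Definition shift N (x : pt N) (j : 'I_N) (k : int) : pt N :=
  [ffun i => if i == j then x i + k else x i].

(* A complex-valued function on Z^N is represented by its real and imaginary
   parts.  An element of l^2(Lambda) is such a function vanishing off Lambda. *)
Definition cfun {R : realType} N := ((pt N -> R) * (pt N -> R))%type.

(* Action of H_Lambda = 1_Lambda (-Delta + lambda V + U) 1_Lambda on a real
   function f supported in Lambda, at a point x of Lambda; here
   (Delta f)(x) = sum over ||y - x||_1 = 1 of f(y), V(x) = sum_j Vc(x_j),
   U(x) = sum_{i<j} Uc(x_i - x_j). *)
Definition Hact {R : realType} N (lam : R) (Vc : int -> R) (Uc : int -> R)
  (f : pt N -> R) (x : pt N) : R :=
  - (\sum_(j < N) (f (shift x j 1) + f (shift x j (-1))))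
  + (lam * (\sum_(j < N) Vc (x j))
     + \sum_(i < N) \sum_(j < N | (i < j)%N) Uc (x i - x j)) * f x.

Definition is_eigvec {R : realType} N (lam : R) (Vc Uc : int -> R)
  (a : pt N) (L : R) (phi : cfun N) (E : R) : Prop :=
  (forall x, ~~ in_cube a L x -> phi.1 x = 0 /\ phi.2 x = 0) /\
  (forall x, in_cube a L x ->
     Hact lam Vc Uc phi.1 x = E * phi.1 x /\ Hact lam Vc Uc phi.2 x = E * phi.2 x).

(* complex inner product <phi, psi> = sum_x conj(phi x) psi x, split into
   real and imaginary parts *)
Definition ip_re {R : realType} N (a : pt N) (L : R) (phi psi : cfun N) : R :=
  \sum_(x <- cube_seq a L) (phi.1 x * psi.1 x + phi.2 x * psi.2 x).
Definition ip_im {R : realType} N (a : pt N) (L : R) (phi psi : cfun N) : R :=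
  \sum_(x <- cube_seq a L) (phi.1 x * psi.2 x - phi.2 x * psi.1 x).

Definition cabs {R : realType} N (phi : cfun N) (y : pt N) : R :=
  Num.sqrt (phi.1 y ^+ 2 + phi.2 y ^+ 2).

Definition localizing_at {R : realType} N (tau : R) (a : pt N) (L : R)
  (phi : cfun N) (x0 : pt N) (m : R) : Prop :=
  ip_re a L phi phi = 1 /\
  forall y, in_cube a L y -> L `^ tau <= (dS y x0)%:R ->
    cabs phi y <= expR (- m * (dS y x0)%:R).

Definition localizing {R : realType} N (tau : R) (a : pt N) (L : R)
  (phi : cfun N) (m : R) : Prop :=
  exists2 x0, in_cube a L x0 & localizing_at tau a L phi x0 m.

(* Lambda_L(a) is m-localizing for H: H_Lambda has an orthonormal eigenbasis
   (a list of #Lambda orthonormal eigenvectors, eigenvalues repeated according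
   to multiplicity) all of whose elements are m-localizing. *)
Definition cube_localizing {R : realType} N (tau : R) (lam : R) (Vc Uc : int -> R)
  (a : pt N) (L : R) (m : R) : Prop :=
  exists (phis : seq (cfun N)) (Es : seq R),
    size phis = size (cube_seq a L) /\ size Es = size phis /\
    (forall k, (k < size phis)%N ->
        is_eigvec lam Vc Uc a L (nth (fun _ => 0, fun _ => 0) phis k) (nth 0 Es k)) /\
    (forall k l, (k < size phis)%N -> (l < size phis)%N ->
        ip_re a L (nth (fun _ => 0, fun _ => 0) phis k) (nth (fun _ => 0, fun _ => 0) phis l)
          = (k == l)%:R /\
        ip_im a L (nth (fun _ => 0, fun _ => 0) phis k) (nth (fun _ => 0, fun _ => 0) phis l)
          = 0) /\
    (forall k, (k < size phis)%N ->
        localizing tau a L (nth (fun _ => 0, fun _ => 0) phis k) m).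

Definition admissible_density {R : realType} (rho : R -> R) (vmax : R) : Prop :=
  0 < vmax /\
  (forall v, v < 0 \/ vmax < v -> rho v = 0) /\
  (exists rmin rmax, 0 < rmin /\ 0 < rmax /\
     forall v, 0 <= v <= vmax -> rmin <= rho v <= rmax) /\
  (forall v : R, 0 < v < vmax -> derivable rho v 1 /\ (derive1 rho x @[x --> v] --> derive1 rho v)) /\
  (exists B, forall v, 0 < v < vmax -> `|(derive1 rho) v| <= B).

Definition iid_potential {R : realType} (d : measure_display)
  (Omega : measurableType d) (P : probability Omega R)
  (Vr : int -> Omega -> R) (rho : R -> R) : Prop :=
  (forall u, measurable_fun setT (Vr u)) /\
  (forall u (A : set R), measurable A ->
     P (Vr u @^-1` A) = (\int[lebesgue_measure]_(v in A) (rho v)%:E)%E) /\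
  (forall (s : seq int) (A : int -> set R), uniq s -> (forall u, measurable (A u)) ->
     P (\bigcap_(u in [set` s]) (Vr u @^-1` A u)) = (\prod_(u <- s) P (Vr u @^-1` A u))%E).

(* Main.v *)
Require Import Defs.
From HB Require Import structures.
From mathcomp Require Import all_boot all_order all_algebra all_fingroup.
From mathcomp Require Import all_classical all_reals all_analysis.
From mathcomp Require Import measurable_realfun zify ring lra.
From mathcomp Require complex.
Set Implicit Arguments. Unset Strict Implicit. Unset Printing Implicit Defensive.
Import Order.TTheory GRing.Theory Num.Theory numFieldNormedType.Exports.
Local Open Scope classical_set_scope.
Local Open Scope ring_scope.

(**
In dimension one [d_S] is the distance of the counting functions
[u |-> #{j : u <= x_j}], so two balls that are [d_S]-far apart are separated by
a cut: for some site [u] every configuration of one ball has more particles to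
the right of [u] than every configuration of the other.  Raising the potential by
[t] to the right of [u] therefore moves the spectra of the two balls relative to
each other at speed at least [lam].  Since the law of the potential changes by
[O(t)] under such a shift, this gives a Wegner estimate for pairs of balls,
without any overlap restriction.

Multiscale analysis then runs by induction on the number of particles.  A ball
whose center splits into two clusters that do not interact has eigenfunctions
which are tensor products, localized by the induction hypothesis.  Balls with a
clustered center depend on few sites, so far apart ones are independent and with
high probability all bad ones lie in a single region.  No resonance occurs between
far apart balls, so an eigenfunction on the large ball is
controlled by applying the maximum principle to [|phi|] times an exponential
weight.  The first scales are localized by large disorder: the pair estimate for
singletons makes all diagonal entries of [H] far apart.
*)

(** * Counting functions and the symmetrized distance *)

(** Three exponents are tied together. A localized eigenfunction on a small ball says nothing within
    [l ^ tau] of its unknown centre, which is negligible against the radius [l] since [tau < 1]. The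
    uncontrolled region of the large ball has width of order [N * l], negligible against the
    threshold [L ^ tau = l ^ (gamma * tau)] since [gamma * tau > 1]. Two independent bad balls have
    probability [l ^ (- 2 p)], which must beat the [L ^ (2 N)] pairs of centres and still leave
    [L ^ (- p)]: this uses [gamma < 2] and forces [p] to be raised first. Some rate is lost at every
    scale, so scale [L] carries [m * (1 + L ^ (- kappa))], which lies between [m] and [2 m]; smaller
    clusters are supplied at rate [2 m] with a larger decay exponent. The pair estimate yields only
    the square root of the energy window, and polynomially small windows make up for it. The
    potential is moved to the canonical space of functions on the integers, so that the constants
    precede the choice of a probability space. Measurability of the localization event is never
    claimed: each estimate bounds a measurable set that contains all failures. *)

Section Counting.
Variables (N : nat) (A : {set 'I_N}).
Implicit Types (x y z a b : pt N) (u : int) (r s : nat).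

Definition cnt u x : nat := #|[set j in A | u <= x j]|.

Lemma cnt_anti u u' x : u <= u' -> (cnt u' x <= cnt u x)%N.
Proof.
move=> uu'; apply/subset_leq_card/fintype.subsetP => j; rewrite !inE => /andP[-> /=].
exact: le_trans.
Qed.

Lemma cnt_max u x : (cnt u x <= #|A|)%N.
Proof. by apply/subset_leq_card/fintype.subsetP => j; rewrite inE => /andP[]. Qed.

Lemma cnt_full u x : (forall j, j \in A -> u <= x j) -> cnt u x = #|A|.
Proof.
by move=> h; apply: eq_card => j; rewrite inE; case: (boolP (j \in A)) => //= /h ->.
Qed.

Lemma cnt_none u x : (forall j, j \in A -> x j < u) -> cnt u x = 0%N.
Proof.
move=> h; apply/eqP; rewrite cards_eq0; apply/eqP/setP => j.
by rewrite !inE; apply/negbTE/negP => /andP[/h]; rewrite ltNge => /negbTE ->.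
Qed.

Lemma cnt_shift_sub u x y r : (forall j, j \in A -> x j <= y j + r%:Z) ->
  (cnt u x <= cnt (u - r%:Z) y)%N.
Proof.
move=> h; apply/subset_leq_card/fintype.subsetP => j; rewrite !inE => /andP[jA] /=.
by rewrite jA /= => ux; have := h _ jA; lia.
Qed.

(** A Lévy-type comparison of counting functions. On the line it is the criterion for matching the
    particles of [x] and [y] with every displacement at most [r], but it mentions no permutation and
    therefore splits well along label sets. *)
Definition dle r x y : Prop :=
  forall u, (cnt u x <= cnt (u - r%:Z) y)%N /\ (cnt u y <= cnt (u - r%:Z) x)%N.

Lemma dle_pointwise r x y : (forall j, j \in A -> (`|x j - y j| <= r)%N) -> dle r x y.
Proof. by move=> h u; split; apply: cnt_shift_sub => j /h; lia. Qed.

Lemma dle_exists x y : exists r, `[< dle r x y >].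
Proof.
exists (\max_(j < N) `|x j - y j|)%N; apply/asboolP/dle_pointwise => j _.
exact: (leq_bigmax j).
Qed.

Definition dst x y : nat := ex_minn (dle_exists x y).

Lemma dle_mono r s x y : (r <= s)%N -> dle r x y -> dle s x y.
Proof.
move=> rs h u; have [h1 h2] := h u.
by split; [apply: leq_trans h1 _|apply: leq_trans h2 _]; apply: cnt_anti; lia.
Qed.

Lemma dstP r x y : (dst x y <= r)%N <-> dle r x y.
Proof.
rewrite /dst; case: ex_minnP => n /asboolP hn hmin; split=> [nr|hr].
  exact: dle_mono hn.
by apply: hmin; apply/asboolP.
Qed.

Lemma dst_dle x y : dle (dst x y) x y. Proof. exact/dstP. Qed.

Lemma dstxx x : dst x x = 0%N.
Proof. by apply/eqP; rewrite -leqn0; apply/dstP/dle_pointwise => j _; rewrite subrr. Qed.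

Lemma dst_sym x y : dst x y = dst y x.
Proof.
by apply/eqP; rewrite eqn_leq; apply/andP; split; apply/dstP => u;
  have [] := dst_dle x y u; have [] := dst_dle y x u.
Qed.

Lemma dst_tri y x z : (dst x z <= dst x y + dst y z)%N.
Proof.
apply/dstP => u; set r := dst x y; set s := dst y z.
have e : u - (r + s)%N%:Z = u - r%:Z - s%:Z by lia.
have e' : u - (r + s)%N%:Z = u - s%:Z - r%:Z by lia.
split.
  by rewrite e; apply: leq_trans (proj1 (dst_dle x y u)) (proj1 (dst_dle y z _)).
by rewrite e'; apply: leq_trans (proj2 (dst_dle y z u)) (proj2 (dst_dle x y _)).
Qed.

Lemma dst_pointwise r x y : (forall j, j \in A -> (`|x j - y j| <= r)%N) -> (dst x y <= r)%N.
Proof. by move=> h; apply/dstP/dle_pointwise. Qed.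

Lemma dst_shift x j k : (dst (Defs.shift x j k) x <= `|k|)%N.
Proof.
apply: dst_pointwise => i _; rewrite /Defs.shift ffunE; case: eqP => _; lia.
Qed.

(* In dimension one, separated balls lie on different sides of a cut: the
   number of particles to the right of the cut distinguishes them. *)
Lemma dst_cut a b r s : (r + s < dst a b)%N ->
  exists u, (forall x y, (dst x a <= r)%N -> (dst y b <= s)%N -> (cnt u y < cnt u x)%N)
         \/ (forall x y, (dst x a <= r)%N -> (dst y b <= s)%N -> (cnt u x < cnt u y)%N).
Proof.
move=> hab; have : ~ dle (r + s) a b by move/dstP; rewrite leqNgt hab.
move/asboolP; rewrite asbool_neg; move/existsp_asboolPn => [u hu].
have [h|h] : (cnt (u - (r + s)%N%:Z) b < cnt u a)%N \/ (cnt (u - (r + s)%N%:Z) a < cnt u b)%N.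
  rewrite !ltnNge; case: (boolP (cnt u a <= _)%N) => h1; last by left.
  by case: (boolP (cnt u b <= _)%N) => h2; [case: hu|right].
- exists (u - r%:Z); left => x y /dstP hx /dstP hy.
  have := proj2 (hx u); have := proj1 (hy (u - r%:Z)).
  have -> : u - r%:Z - s%:Z = u - (r + s)%N%:Z by lia.
  by move=> h1 h2; apply: leq_ltn_trans h1 (leq_trans h h2).
exists (u - s%:Z); right => x y /dstP hx /dstP hy.
have := proj2 (hy u); have := proj1 (hx (u - s%:Z)).
have -> : u - s%:Z - r%:Z = u - (r + s)%N%:Z by lia.
by move=> h1 h2; apply: leq_ltn_trans h1 (leq_trans h h2).
Qed.

(** If no particle of [a] were within [r] of [x j], the count of [a] would be the same at both ends
    of that window; the comparison would then squeeze the count of [x] at [x j] below its count at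
    [x j + 1], although particle [j] is lost in between. *)
Lemma dst_near x a r j : (dst x a <= r)%N -> j \in A ->
  exists2 i, i \in A & (`|x j - a i| <= r)%N.
Proof.
move=> /dstP h jA; apply: contrapT => hno.
have hno' i : i \in A -> (r < `|x j - a i|)%N.
  by move=> iA; rewrite ltnNge; apply/negP => hi; apply: hno; exists i.
have e : cnt (x j - r%:Z) a = cnt (x j + 1 + r%:Z) a.
  apply: eq_card => i; rewrite !inE; case: (boolP (i \in A)) => //= iA.
  by have := hno' _ iA; lia.
have h1 := proj1 (h (x j)); have h2 := proj2 (h (x j + 1 + r%:Z)).
have e2 : x j + 1 + r%:Z - r%:Z = x j + 1 by lia.
rewrite e2 in h2; have h3 : (cnt (x j) x <= cnt (x j + 1) x)%N by rewrite (leq_trans h1) // e.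
move: h3; apply/negP; rewrite -ltnNge; apply/proper_card/fintype.properP; split.
  by apply/fintype.subsetP => i; rewrite !inE => /andP[-> /=]; lia.
by exists j; rewrite !inE jA //=; lia.
Qed.

(* The induction on the number of particles keeps the ambient type [pt N]: a
   configuration of the particles in [A] is a point that vanishes off [A]. *)
Definition res x : pt N := [ffun j => if j \in A then x j else 0].
Definition supported x := res x == x.

Lemma resE x j : res x j = if j \in A then x j else 0. Proof. by rewrite ffunE. Qed.

Lemma supportedP x : reflect (forall j, j \notin A -> x j = 0) (supported x).
Proof.
apply: (iffP eqP) => [<- j /negbTE|h]; first by rewrite resE => ->.
by apply/ffunP => j; rewrite resE; case: (boolP (j \in A)) => // /h ->.
Qed.

Lemma res_supported x : supported (res x).
Proof. by apply/supportedP => j /negbTE; rewrite resE => ->. Qed.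

Lemma cnt_res u x : cnt u (res x) = cnt u x.
Proof.
by apply: eq_card => j; rewrite !inE resE; case: (j \in A).
Qed.

Lemma eq_cnt_dst x x' y : (forall u, cnt u x = cnt u x') -> dst x y = dst x' y.
Proof.
by move=> e; apply/eqP; rewrite eqn_leq; apply/andP; split; apply/dstP => u;
  rewrite ?e -?e; [have := dst_dle x' y u|have := dst_dle x y u]; rewrite ?e.
Qed.

Lemma dst_resl x y : dst (res x) y = dst x y.
Proof. by apply: eq_cnt_dst => u; rewrite cnt_res. Qed.

Lemma supported_shift x j k : j \in A -> supported x -> supported (Defs.shift x j k).
Proof.
move=> jA /supportedP h; apply/supportedP => i iA; rewrite /Defs.shift ffunE.
by case: eqP => [e|_]; [rewrite -e (negbTE iA) in jA|exact: h].
Qed.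

(** The order statistics can be read off a non-increasing step function: the label of rank [k] is
    placed at the last site where [g] exceeds [k]. *)
Lemma point_of_counts (g : int -> nat) (M : nat) :
  (forall u u', u <= u' -> (g u' <= g u)%N) ->
  (forall u, u <= - M%:Z -> g u = #|A|) -> (forall u, M%:Z < u -> g u = 0%N) ->
  exists2 b, supported b & forall u, cnt u b = g u.
Proof.
move=> gm glo ghi.
have bnd k : (k < #|A|)%N -> exists c : int, forall u, (u <= c) = (k < g u)%N.
  move=> kA; have ex : exists n : nat, (k < g (- M%:Z + n%:Z)%R)%N.
    by exists 0%N; rewrite glo //; lia.
  have ub (n : nat) : (k < g (- M%:Z + n%:Z)%R)%N -> (n <= M + M)%N.
    by rewrite leqNgt => hk; apply/negP => hn; rewrite ghi in hk => //; lia.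
  case: (ex_maxnP ex ub) => n hn hmax; exists (- M%:Z + n%:Z) => u.
  apply/idP/idP => [hu|hk]; first exact: leq_trans hn (gm _ _ hu).
  case: (leP u (- M%:Z)) => hu; first by lia.
  have e : u = - M%:Z + (`|(u + M%:Z)%R|%N)%:Z by lia.
  by rewrite e in hk; have := hmax _ hk; lia.
have [c hc] : {c : nat -> int & forall k, (k < #|A|)%N -> forall u, (u <= c k) = (k < g u)%N}.
  apply: (@choice _ _ (fun k c => (k < #|A|)%N -> forall u, (u <= c) = (k < g u)%N)) => k.
  by case: (ltnP k #|A|) => [/bnd[d hd]|_]; [exists d|exists 0].
have hidx j : j \in A -> (index j (enum A) < #|A|)%N by rewrite cardE index_mem mem_enum.
pose b : pt N := [ffun j => if j \in A then c (index j (enum A)) else 0].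
exists b => [|u]; first by apply/supportedP => j /negbTE; rewrite ffunE => ->.
have gA : (g u <= #|A|)%N.
  case: (leP u (- M%:Z)) => hu; first by rewrite glo.
  by rewrite -(glo (- M%:Z)) // gm //; lia.
rewrite /cnt -[RHS](size_takel (s := enum A)) -?cardE //.
have utk : uniq (take (g u) (enum A)) by rewrite take_uniq // enum_uniq.
rewrite -(card_uniqP utk); apply: eq_card => j; rewrite inE ffunE.
apply/andP/idP => [[jA]|jt].
  rewrite jA hc ?hidx // => hj.
  have jE : j \in enum A by rewrite mem_enum.
  have := mem_nth j (s := take (g u) (enum A)) (n := index j (enum A)).
  by rewrite nth_take // nth_index //; apply; rewrite size_takel // -cardE.
have jA : j \in A by rewrite -mem_enum; exact: mem_take jt.
split=> //; rewrite jA hc ?hidx //.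
by rewrite -[X in index j X](cat_take_drop (g u)) index_cat jt
  (leq_trans (n := size (take (g u) (enum A)))) ?index_mem // size_takel // -cardE.
Qed.

(* [b] is [y] with its counting function clamped to within [R - r] of that of [a]:
   the ball of radius [r] about [b] stays in the large ball and covers the
   [r]-neighbourhood of [y] there. *)
Lemma clamp_exists (a y : pt N) (R r : nat) : (r <= R)%N -> (dst y a <= R)%N ->
  exists b, [/\ supported b, (dst b a <= R - r)%N, (dst b y <= r)%N &
    forall z, (dst z a <= R)%N -> (r < dst z b)%N -> (r < dst z y)%N].
Proof.
move=> rR ya; pose s := (R - r)%N.
pose M := ((\max_(j < N) `|a j|) + (\max_(j < N) `|y j|) + R)%N.
have aM j : (`|a j| + (\max_(j < N) `|y j|) + R <= M)%N.
  by rewrite leq_add2r leq_add2r; exact: (leq_bigmax j).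
have yM j : (`|y j| + R <= M)%N.
  by rewrite leq_add2r; apply: leq_trans (leq_addl _ _); exact: (leq_bigmax j).
pose g u := maxn (minn (cnt u y) (cnt (u - s%:Z) a)) (cnt (u + s%:Z) a).
have [|||b bs hb] := @point_of_counts g M.
- move=> u u' uu'; rewrite /g geq_max !leq_max leq_min !geq_min.
  rewrite (cnt_anti y uu') (@cnt_anti (u + s%:Z) (u' + s%:Z)) ?lerD2r //.
  by rewrite (@cnt_anti (u - s%:Z) (u' - s%:Z)) ?lerD2r // !orbT.
- move=> u hu; rewrite /g [cnt u y]cnt_full ?[cnt (u - _) a]cnt_full ?[cnt (u + s%:Z) a]cnt_full ?minnn ?maxnn //.
  + by move=> j _; have := aM j; have := yM j; lia.
  + by move=> j _; have := aM j; have := yM j; lia.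
  by move=> j _; have := aM j; have := yM j; lia.
- move=> u hu; rewrite /g [cnt u y]cnt_none ?[cnt (u + s%:Z) a]cnt_none ?min0n //.
    by move=> j _; have := aM j; have := yM j; lia.
  by move=> j _; have := aM j; have := yM j; lia.
have ba : (dst b a <= s)%N.
  apply/dstP => u; rewrite !hb /g; split.
    by rewrite geq_max geq_minr /= cnt_anti //; lia.
  by rewrite leq_max subrK leqnn orbT.
have key z : (dst z a <= R)%N -> (dst z y <= r)%N -> (dst z b <= r)%N.
  move=> /dstP za /dstP zy; apply/dstP => u; rewrite !hb /g; split.
    rewrite leq_max leq_min (proj1 (zy u)).
    have -> : u - r%:Z - s%:Z = u - R%:Z by lia.
    by rewrite (proj1 (za u)).
  rewrite geq_max geq_min (proj2 (zy u)) /=.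
  have -> : u - r%:Z = u + s%:Z - R%:Z by lia.
  exact: (proj2 (za _)).
exists b; split=> //; first by rewrite dst_sym key // dstxx.
by move=> z za; rewrite !ltnNge; apply: contra; exact: key.
Qed.

(** By [dst_near] every coordinate of a ball point is within [r] of some coordinate of the centre.
    This superset of the ball has a size independent of the centre, which gives the volume bound
    behind all later union bounds. *)
Definition candidates (a : pt N) r : seq (pt N) :=
  [seq [ffun j => if j \in A then a (g j).1 + (nat_of_ord (g j).2)%:Z - r%:Z else 0]
    | g : {ffun 'I_N -> 'I_N * 'I_(r + r).+1} <- enum {ffun 'I_N -> 'I_N * 'I_(r + r).+1}].

Definition cube (a : pt N) r : seq (pt N) :=
  [seq x <- undup (candidates a r) | supported x && (dst x a <= r)%N].

Lemma cube_uniq a r : uniq (cube a r). Proof. by rewrite filter_uniq // undup_uniq. Qed.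

Lemma mem_cube a r x : (x \in cube a r) = supported x && (dst x a <= r)%N.
Proof.
rewrite mem_filter mem_undup; case: (boolP (supported x && _)) => //= /andP[sx xa].
have hex j : exists p : 'I_N * 'I_(r + r).+1, j \in A -> x j = a p.1 + (nat_of_ord p.2)%:Z - r%:Z.
  case: (boolP (j \in A)) => jA; last by exists (j, ord0).
  have [i iA hi] := dst_near xa jA.
  have lt : (`|(x j - a i + r%:Z)%R| < (r + r).+1)%N by lia.
  by exists (i, Ordinal lt) => _ /=; lia.
have [g hg] := choice hex.
apply/mapP; exists [ffun j => g j]; first by rewrite mem_enum.
apply/ffunP => j; rewrite !ffunE; case: (boolP (j \in A)) => [/hg //|jA].
exact: (supportedP _ sx).
Qed.

Lemma size_cube a r : (size (cube a r) <= (N * (r + r).+1) ^ N)%N.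
Proof.
rewrite (leq_trans (size_subseq (filter_subseq _ _))) // (leq_trans (size_undup _)) //.
by rewrite size_map -cardE card_ffun card_prod !card_ord.
Qed.

End Counting.

(** * Symmetric matrices *)

Section Spectral.
Import complex.
Variable R : rcfType.

Lemma symmetric_eigenvalue_real n (S : 'M[R]_n) (c : R[i]) (y : 'rV[R[i]]_n) :
  S^T = S -> y != 0 -> y *m map_mx (real_complex R) S = c *: y -> c \is Num.real.
Proof.
move=> symS y0 ey.
set SC := map_mx _ S in ey.
have normy : (y *m (map_mx Num.conj y)^T) 0 0 != 0.
  rewrite mxE; apply/negP => /eqP h; move/negP: y0; apply; apply/eqP/rowP => j.
  have := psumr_eq0P _ h => /(_ _ j isT); rewrite !mxE => hj.
  have /eqP : y 0 j * Num.conj (y 0 j) = 0 by apply: hj => i _; rewrite !mxE mul_conjC_ge0.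
  by rewrite mul_conjC_eq0 => /eqP.
have q1 : (y *m SC *m (map_mx Num.conj y)^T) 0 0 = c * (y *m (map_mx Num.conj y)^T) 0 0.
  by rewrite ey -scalemxAl mxE.
have SCreal : map_mx Num.conj SC = SC.
  by apply/matrixP => i j; rewrite !mxE; apply/eqP; rewrite eq_complex /= oppr0 !eqxx.
have SCsym : SC^T = SC by rewrite /SC map_trmx symS.
have q2 : (y *m SC *m (map_mx Num.conj y)^T) 0 0 = Num.conj c * (y *m (map_mx Num.conj y)^T) 0 0.
  have -> : y *m SC *m (map_mx Num.conj y)^T = y *m (map_mx Num.conj (y *m SC))^T.
    by rewrite map_mxM /= SCreal trmx_mul SCsym mulmxA.
  by rewrite ey map_mxZ linearZ /= -scalemxAr mxE.
have /mulIf : (y *m (map_mx Num.conj y)^T) 0 0 != 0 by [].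
move/(_ c (Num.conj c)); rewrite -q1 -q2 => /(_ erefl) e.
by apply/CrealP.
Qed.

(** The orthogonal complement of the eigenvectors already found is invariant under [S]. The matrix
    [B] of the restriction has an eigenvalue over the complex closure, which is real because [S] is
    symmetric. *)
Lemma symmetric_partial_eigenbasis n (S : 'M[R]_n) k : S^T = S -> (k <= n)%N ->
  exists (V : 'M[R]_(k, n)) (d : 'rV[R]_k), V *m V^T = 1%:M /\ V *m S = diag_mx d *m V.
Proof.
move=> symS; elim: k => [|k IH] kn.
  by exists 0, 0; split; apply/matrixP => -[].
have [V [d [VV VS]]] := IH (ltnW kn).
pose W := row_base (kermx V^T).
have WV : W *m V^T = 0 by apply/sub_kermxP; rewrite eq_row_base.
have rV : \rank V = k.
  by apply/eqP; rewrite eqn_leq rank_leq_row -{1}(mxrank1 R k) -VV mxrankM_maxl.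
have rW : \rank (kermx V^T) = (n - k)%N by rewrite mxrank_ker mxrank_tr rV.
have rpos : (0 < \rank (kermx V^T))%N by rewrite rW subn_gt0.
have Wfree : row_free W by apply: row_base_free.
have WS : (W *m S <= W)%MS.
  rewrite eq_row_base; apply/sub_kermxP.
  have -> : W *m S *m V^T = W *m (V *m S)^T by rewrite trmx_mul symS mulmxA.
  by rewrite VS trmx_mul mulmxA WV mul0mx.
pose B := W *m S *m pinvmx W.
have BW : B *m W = W *m S by rewrite mulmxKpV.
have [c /eigenvalueP[z zB z0]] := eigenvalue_closed (map_mx (real_complex R) B) rpos.
have creal : c \is Num.real.
  apply: (@symmetric_eigenvalue_real _ S c (z *m map_mx (real_complex R) W) symS).
    by rewrite mulmx_free_eq0 ?row_free_map.
  by rewrite -mulmxA -map_mxM -BW map_mxM mulmxA zB -scalemxAl.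
have cE : c = real_complex R (complex.Re c).
  by case: (c) creal => cr ci; rewrite complex_real => /eqP ->.
(* The eigenvector [z] is only complex; a real one is recovered from the real characteristic
   polynomial, of which the real number [c] is a root. *)
have /eigenvalueP[v0 v0B v00] : eigenvalue B (complex.Re c).
  rewrite eigenvalue_root_char -(fmorph_root (real_complex R)).
  rewrite map_char_poly [X in root _ X](_ : _ = c); last exact/esym.
  by rewrite -eigenvalue_root_char; apply/eigenvalueP; exists z.
pose v := v0 *m W.
have v_neq0 : v != 0 by rewrite mulmx_free_eq0.
have vS : v *m S = complex.Re c *: v by rewrite /v -mulmxA -BW mulmxA v0B -scalemxAl.
have vV : v *m V^T = 0 by rewrite /v -mulmxA WV mulmx0.
clearbody v.
pose q := (v *m v^T) 0 0.
have qE : q = \sum_j v 0 j ^+ 2 by rewrite /q mxE; apply: eq_bigr => j _; rewrite mxE expr2.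
have qpos : 0 < q.
  rewrite lt_neqAle qE sumr_ge0 ?andbT; last by move=> j _; exact: sqr_ge0.
  apply/negP => /eqP h; move/negP: v_neq0; apply; apply/eqP/rowP => j.
  have := psumr_eq0P (fun i _ => sqr_ge0 (v 0 i)) (esym h) => /(_ j isT) /eqP.
  by rewrite sqrf_eq0 mxE => /eqP.
pose t := (Num.sqrt q)^-1.
have tt1 : t * t * q = 1.
  by rewrite /t -invfM -expr2 sqr_sqrtr ?ltW // mulVf // gt_eqF.
have vv1 : (t *: v) *m (t *: v)^T = 1%:M.
  apply/matrixP => i j; rewrite !ord1 linearZ /= -scalemxAl -scalemxAr !mxE.
  by rewrite mulrA -[X in _ * X = _]/((\sum_j v 0 j * v^T j 0)) -[RHS]tt1 /q mxE.
have vV' : (t *: v) *m V^T = 0 by rewrite -scalemxAl vV scaler0.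
rewrite -addn1.
exists (col_mx V (t *: v)), (row_mx d (complex.Re c)%:M); split.
  rewrite tr_col_mx mul_col_row VV vv1 vV'.
  have -> : V *m (t *: v)^T = 0 by rewrite -[LHS]trmxK trmx_mul trmxK vV' trmx0.
  by rewrite -scalar_mx_block.
rewrite mul_col_mx VS -scalemxAl vS diag_mx_row mul_block_col !mul0mx addr0 add0r.
congr col_mx; apply/matrixP => i j; rewrite !ord1 !mxE big_ord1 !mxE eqxx !mulr1n.
by rewrite mulrCA.
Qed.

Lemma symmetric_spectral n (S : 'M[R]_n) : S^T = S ->
  exists (V : 'M[R]_n) (d : 'rV[R]_n),
    [/\ V *m V^T = 1%:M, V^T *m V = 1%:M & V *m S = diag_mx d *m V].
Proof.
move=> /symmetric_partial_eigenbasis /(_ (leqnn n)) [V [d [h1 h2]]].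
by exists V, d; split=> //; exact: mulmx1C.
Qed.

Lemma spectral_finType (T : finType) (K : T -> T -> R) : (forall x y, K x y = K y x) ->
  exists (e : T -> T -> R) (nu : T -> R),
    [/\ forall k l, \sum_x e k x * e l x = (k == l)%:R,
        forall x y, \sum_k e k x * e k y = (x == y)%:R &
        forall k x, \sum_y K x y * e k y = nu k * e k x].
Proof.
move=> symK; pose S := \matrix_(i < #|T|, j < #|T|) K (enum_val i) (enum_val j).
have symS : S^T = S by apply/matrixP => i j; rewrite !mxE symK.
have [V [d [h1 h2 h3]]] := symmetric_spectral symS.
have reidx (F : T -> R) : \sum_x F x = \sum_(i < #|T|) F (enum_val i).
  by rewrite (reindex (@enum_val T T)) //=; apply: onW_bij; exact: enum_val_bij.
have rkE (x y : T) : (enum_rank x == enum_rank y) = (x == y) by rewrite (inj_eq enum_rank_inj).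
exists (fun k x => V (enum_rank k) (enum_rank x)), (fun k => d 0 (enum_rank k)); split.
- move=> k l; have /matrixP/(_ (enum_rank k) (enum_rank l)) := h1; rewrite !mxE rkE => <-.
  by rewrite reidx; apply: eq_bigr => i _; rewrite enum_valK mxE.
- move=> x y; have /matrixP/(_ (enum_rank x) (enum_rank y)) := h2; rewrite !mxE rkE => <-.
  by rewrite reidx; apply: eq_bigr => i _; rewrite enum_valK mxE.
- move=> k x; have /matrixP/(_ (enum_rank k) (enum_rank x)) := h3.
  rewrite mul_diag_mx !mxE => <-.
  by rewrite reidx; apply: eq_bigr => i _; rewrite enum_valK mxE enum_rankK mulrC symK.
Qed.

End Spectral.

(** * The Hamiltonian on a finite domain *)

Lemma sum_seq_pick (T : eqType) (R : nzRingType) (D : seq T) (F : T -> R) z :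
  uniq D -> \sum_(y <- D) (y == z)%:R * F y = if z \in D then F z else 0.
Proof.
move=> uD; case: ifP => zD.
  rewrite (bigD1_seq z) //= eqxx mul1r big1 ?addr0 // => y /negbTE ->.
  by rewrite mul0r.
rewrite big_seq big1 // => y yD; case: eqP => [e|_]; last by rewrite mul0r.
by rewrite -e yD in zD.
Qed.

Lemma sum_const_seq (T : Type) (R : nmodType) (s : seq T) (c : R) :
  \sum_(x <- s) c = c *+ size s.
Proof. by rewrite big_const_seq count_predT iter_addr_0. Qed.

Lemma big_subseq_split (T : eqType) (R : nzRingType) (D E : seq T) (F : T -> R) :
  uniq D -> uniq E -> {subset D <= E} ->
  \sum_(y <- E) F y = \sum_(y <- D) F y + \sum_(y <- E | y \notin D) F y.
Proof.
move=> uD uE DE; rewrite (bigID (mem D)) /=; congr (_ + _).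
rewrite -big_filter; apply: perm_big; apply: uniq_perm => //; first exact: filter_uniq.
by move=> y; rewrite mem_filter; case: (boolP (y \in D)) => // /DE ->.
Qed.

Lemma seq_argmax (T : eqType) (R : realDomainType) (D : seq T) (F : T -> R) :
  (exists x, x \in D) -> exists2 x, x \in D & forall y, y \in D -> F y <= F x.
Proof.
elim: D => [[x] //|z D IH _].
have [->|D0] := eqVneq D [::].
  by exists z; rewrite ?mem_head // => y; rewrite inE => /eqP ->.
have [x xD hx] : exists2 x, x \in D & forall y, y \in D -> F y <= F x.
  by apply: IH; case: D D0 => // w D' _; exists w; rewrite mem_head.
have [le|lt] := leP (F z) (F x).
  by exists x; [rewrite inE xD orbT|move=> y; rewrite inE => /predU1P[->|/hx]].
exists z; first by rewrite mem_head.
by move=> y; rewrite inE => /predU1P[->//|/hx h]; exact: le_trans h (ltW lt).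
Qed.

Section Hamiltonian.
Variables (R : realType) (N : nat) (A : {set 'I_N}) (lam : R) (v Uc : int -> R).
Implicit Types (x y z a b : pt N) (f g : pt N -> R) (D : seq (pt N)).

Definition hop f x : R := \sum_(j in A) (f (Defs.shift x j 1) + f (Defs.shift x j (-1))).
Definition pot x : R := lam * (\sum_(j in A) v (x j))
  + \sum_(i in A) \sum_(j in A | (i < j)%N) Uc (x i - x j).
Definition Ham f x : R := - hop f x + pot x * f x.

(** Written as a sum over single-particle moves, so that exchanging sums turns [hop] into a matrix
    action with row sums at most [2 * N]. *)
Definition adj x y : nat :=
  (\sum_(j in A) ((y == Defs.shift x j 1) + (y == Defs.shift x j (-1))))%N.

Lemma shiftK x j (k : int) : Defs.shift (Defs.shift x j k) j (- k) = x.
Proof. by apply/ffunP => i; rewrite !ffunE; case: eqP => // _; rewrite addrK. Qed.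

Lemma shift_eqC x y j : (y == Defs.shift x j (-1)) = (x == Defs.shift y j 1).
Proof.
apply/eqP/eqP => ->; first exact: esym (shiftK x j (-1)).
exact: esym (shiftK y j 1).
Qed.

Lemma adj_sym x y : adj x y = adj y x.
Proof.
by apply: eq_bigr => j _; rewrite addnC !shift_eqC.
Qed.

Lemma adj_neq0 x y : adj x y != 0%N ->
  exists2 j, j \in A & (y = Defs.shift x j 1 \/ y = Defs.shift x j (-1)).
Proof.
move=> h; apply: contrapT => hno; move/negP: h; apply.
rewrite /adj big1 // => j jA.
case: eqP => [e|_]; first by case: hno; exists j => //; left.
by case: eqP => [e|_] //; case: hno; exists j => //; right.
Qed.

Lemma adj_dst x y : adj x y != 0%N -> (dst A x y <= 1)%N.
Proof. by case/adj_neq0 => j jA [|] ->; rewrite dst_sym; exact: dst_shift. Qed.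

Lemma adj_row_le D x : uniq D -> \sum_(y <- D) (adj x y)%:R <= (2 * N)%:R :> R.
Proof.
move=> uD; under eq_bigr do rewrite natr_sum.
rewrite exchange_big /= (le_trans (y := \sum_(j in A) (2%:R : R))) //.
  apply: ler_sum => j _; under eq_bigr do rewrite natrD -[_%:R]mulr1 -[X in _ + X]mulr1.
  rewrite big_split /= !sum_seq_pick //.
  by rewrite (natrD R 1 1) lerD //; case: ifP.
rewrite sumr_const -mulrnA ler_nat leq_mul2l /= (leq_trans (max_card _)) //.
by rewrite card_ord.
Qed.

Lemma hopE D f x : uniq D -> (forall y, y \notin D -> f y = 0) ->
  hop f x = \sum_(y <- D) (adj x y)%:R * f y.
Proof.
move=> uD f0; under eq_bigr do rewrite natr_sum mulr_suml.
rewrite exchange_big /=; apply: eq_bigr => j _.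
under eq_bigr do rewrite natrD mulrDl.
rewrite big_split /= !sum_seq_pick //.
by congr (_ + _); case: ifP => // /negbT /f0.
Qed.

Definition Hker x y : R := - (adj x y)%:R + (y == x)%:R * pot x.

Lemma Hker_sym x y : Hker x y = Hker y x.
Proof.
by rewrite /Hker adj_sym eq_sym; case: eqP => [->//|_]; rewrite !mul0r.
Qed.

Lemma HamE D f x : uniq D -> (forall y, y \notin D -> f y = 0) ->
  Ham f x = \sum_(y <- D) Hker x y * f y.
Proof.
move=> uD f0; rewrite /Ham (hopE _ uD f0).
under [RHS]eq_bigr do rewrite mulrDl mulNr -mulrA.
rewrite big_split /= sumrN; congr (_ + _); rewrite sum_seq_pick //.
by case: ifP => // /negbT /f0 ->; rewrite mulr0.
Qed.

(** The zero function is allowed, with any [E]. Tensor products can thus be listed without checking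
    that they survive; [nonzero_on] is required only where an eigenvalue is claimed. *)
Definition eigpair D f (E : R) : Prop :=
  (forall x, x \notin D -> f x = 0) /\ (forall x, x \in D -> Ham f x = E * f x).

Definition nonzero_on D f : Prop := exists2 x, x \in D & f x != 0.

Lemma spectral_domain D : uniq D ->
  exists (f : 'I_(size D) -> pt N -> R) (nu : 'I_(size D) -> R),
    [/\ forall k, eigpair D (f k) (nu k),
        forall k l, \sum_(x <- D) f k x * f l x = (k == l)%:R &
        forall x y, x \in D -> y \in D -> \sum_k f k x * f k y = (x == y)%:R].
Proof.
move=> uD; pose t := tnth (in_tuple D).
have tinj : injective t by apply/tuple_uniqP.
have sumD (F : pt N -> R) : \sum_(x <- D) F x = \sum_i F (t i) by rewrite big_tnth.
have [e [nu [h1 h2 h3]]] := spectral_finType (fun i j => Hker_sym (t i) (t j)).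
pose f k x : R := \sum_i (t i == x)%:R * e k i.
have ft k i : f k (t i) = e k i.
  rewrite /f (bigD1 i) //= eqxx mul1r big1 ?addr0 // => j /negbTE.
  by rewrite (inj_eq tinj) => ->; rewrite mul0r.
have f0 k x : x \notin D -> f k x = 0.
  move=> xD; rewrite /f big1 // => i _; case: eqP => [ex|_]; last by rewrite mul0r.
  by rewrite -ex mem_tnth in xD.
have tP x : x \in D -> exists i, x = t i by move/(@tnthP _ _ (in_tuple D)).
exists f, nu; split.
- move=> k; split; first exact: f0.
  move=> x /tP[i ->]; rewrite (HamE _ uD (f0 k)) sumD ft -h3.
  by apply: eq_bigr => j _; rewrite ft.
- by move=> k l; rewrite sumD -h1; apply: eq_bigr => i _; rewrite !ft.
- move=> _ _ /tP[i ->] /tP[j ->]; rewrite (inj_eq tinj) -h2.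
  by apply: eq_bigr => k _; rewrite !ft.
Qed.

(** A resolution of the identity, that is a Parseval frame: neither orthogonality nor the correct
    cardinality is demanded. This is the property that expansions use and that passes to sums of
    tensor products. *)
Definition complete D (B : seq ((pt N -> R) * R)) : Prop :=
  forall x y, x \in D -> y \in D -> \sum_(p <- B) p.1 x * p.1 y = (x == y)%:R.

Lemma complete_le1 D B p y : complete D B -> List.In p B -> y \in D -> `|p.1 y| <= 1.
Proof.
move=> cB pB yD; have := cB y y yD yD; rewrite eqxx => h.
have : p.1 y ^+ 2 <= 1.
  rewrite expr2 -[leRHS]/(1%:R) -h; elim: B pB {cB h} => //= q B IH [->|/IH le]; rewrite big_cons.
    by rewrite lerDl sumr_ge0 // => i _; rewrite -expr2 sqr_ge0.
  by rewrite (le_trans le) // lerDr -expr2 sqr_ge0.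
by rewrite -{1}[p.1 y ^+ 2]real_normK ?num_real // -[leRHS](expr1n _ 2) ler_pXn2r ?nnegrE.
Qed.

(* Geometric resolvent identity in eigenfunction form: off resonance, an
   eigenfunction on E is controlled inside D by its values just outside D. *)
Lemma boundary_expansion D E (B : seq ((pt N -> R) * R)) (phi : pt N -> R) (e del Q : R) y0 :
  uniq D -> uniq E -> {subset D <= E} -> complete D B ->
  (forall p, List.In p B -> eigpair D p.1 p.2) ->
  eigpair E phi e -> 0 < del -> 0 <= Q ->
  (forall p, List.In p B -> nonzero_on D p.1 -> del <= `|p.2 - e|) ->
  y0 \in D ->
  (forall p x y, List.In p B -> x \in D -> y \in E -> y \notin D -> adj x y != 0%N ->
     `|p.1 y0 * p.1 x| * `|phi y| <= Q) ->
  `|phi y0| <= (size B * size D * (2 * N))%:R / del * Q.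
Proof.
move=> uD uE DE cB eB [phi0 ephi] del0 Q0 far yD hQ.
have expand : phi y0 = \sum_(p <- B) p.1 y0 * \sum_(x <- D) p.1 x * phi x.
  under eq_bigr do rewrite mulr_sumr.
  rewrite exchange_big /= [RHS]big_seq.
  under eq_bigr => x xD do
    (under eq_bigr do rewrite mulrA; rewrite -mulr_suml (cB _ _ yD xD) eq_sym).
  by rewrite -big_seq sum_seq_pick // yD.
(* Green's formula: by symmetry of [Hker], the two actions of the Hamiltonian cancel inside [D] and
   only hops across its boundary remain. *)
have key p : List.In p B ->
    (p.2 - e) * \sum_(x <- D) p.1 x * phi x =
    \sum_(x <- D) \sum_(y <- E | y \notin D) p.1 x * (adj x y)%:R * phi y.
  move=> pB; have [p0 ep] := eB p pB.
  have s1 : e * (\sum_(x <- D) p.1 x * phi x) = \sum_(x <- D) p.1 x * Ham phi x.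
    rewrite mulr_sumr big_seq [RHS]big_seq; apply: eq_bigr => x xD.
    by rewrite (ephi _ (DE _ xD)) mulrCA.
  have s2 : p.2 * (\sum_(x <- D) p.1 x * phi x) =
      \sum_(x <- D) p.1 x * \sum_(y <- D) Hker x y * phi y.
    transitivity (\sum_(y <- D) \sum_(x <- D) Hker y x * p.1 x * phi y).
      rewrite mulr_sumr big_seq [RHS]big_seq; apply: eq_bigr => y yD'.
      by rewrite mulrA -(ep _ yD') (HamE _ uD p0) mulr_suml.
    rewrite exchange_big /=; apply: eq_bigr => x _; rewrite mulr_sumr.
    by apply: eq_bigr => y _; rewrite Hker_sym; ring.
  rewrite mulrBl s1 s2 -sumrB big_seq [RHS]big_seq; apply: eq_bigr => x xD.
  rewrite (HamE x uE phi0) (big_subseq_split _ uD uE DE) mulrDr opprD addNKr mulr_sumr.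
  rewrite -sumrN; apply: eq_bigr => y yD'.
  rewrite /Hker; case: eqP => [ey|_]; first by rewrite ey xD in yD'.
  by rewrite mul0r addr0; ring.
have bound p : List.In p B ->
    `|p.1 y0 * \sum_(x <- D) p.1 x * phi x| <= (size D * (2 * N))%:R / del * Q.
  move=> pB; have rhs0 : 0 <= (size D * (2 * N))%:R / del * Q.
    by rewrite mulr_ge0 ?divr_ge0 ?ler0n ?(ltW del0).
  (* A frame member that vanishes on [D] carries a meaningless energy label, but it contributes
     nothing to the expansion. *)
  have [nz|z] := pselect (nonzero_on D p.1); last first.
    rewrite [p.1 y0](_ : _ = 0) ?mul0r ?normr0 //.
    by apply/eqP; apply: contrapT => /negP h; apply: z; exists y0.
  have fp := far p pB nz; have fp0 : 0 < `|p.2 - e| by exact: lt_le_trans fp.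
  rewrite mulrAC ler_pdivlMr // mulrC (le_trans (ler_wpM2r (normr_ge0 _) fp)) //.
  rewrite -normrM mulrCA (key p pB) mulr_sumr (le_trans (ler_norm_sum _ _ _)) //.
  rewrite natrM -mulrA mulr_natl -sum_const_seq big_seq [leRHS]big_seq.
  apply: ler_sum => x xD; rewrite mulr_sumr (le_trans (ler_norm_sum _ _ _)) //.
  apply: (@le_trans _ _ (\sum_(y <- E | y \notin D) (adj x y)%:R * Q)).
    rewrite big_seq_cond [leRHS]big_seq_cond; apply: ler_sum => y /andP[yE yD'].
    case: (eqVneq (adj x y) 0%N) => [->|nz']; first by rewrite !(mulr0, mul0r) normr0.
    rewrite [X in `|X|](_ : _ = (adj x y)%:R * ((p.1 y0 * p.1 x) * phi y)); last by ring.
    by rewrite normrM normr_nat ler_wpM2l // normrM hQ.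
  rewrite -mulr_suml ler_wpM2r // (le_trans _ (adj_row_le x uE)) //.
  by rewrite [leRHS](bigID (mem D)) /= lerDr sumr_ge0.
rewrite expand (le_trans (ler_norm_sum _ _ _)) //.
have -> : (size B * size D * (2 * N))%:R / del * Q = \sum_(p <- B) (size D * (2 * N))%:R / del * Q.
  by rewrite sum_const_seq -[RHS]mulr_natl -mulnA natrM; ring.
elim: B bound {expand cB eB far hQ key} => [|p B IH] bd; first by rewrite !big_nil.
by rewrite !big_cons lerD ?bd ?IH //=; [left|move=> q qB; apply: bd; right].
Qed.

End Hamiltonian.

(** * The deterministic multiscale step *)

Ltac natlia :=
  repeat match goal with H : is_true (leq _ _) |- _ => revert H end; clear; lia.

Section Localization.
Variables (R : realType) (N : nat) (A : {set 'I_N}) (lam : R) (v Uc : int -> R).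
Implicit Types (x y z a b : pt N) (f g : pt N -> R) (D : seq (pt N)).
Let d := dst A.
Let eig := eigpair A lam v Uc.

Definition loc_at D (th m : R) f x0 : Prop :=
  forall y, y \in D -> th <= (d y x0)%:R -> `|f y| <= expR (- m * (d y x0)%:R).

(** Some localized frame, against every normalized eigenfunction in [strong_loc]. For
    non-interacting clusters only the weak form is available: sums of cluster energies may coincide,
    and eigenfunctions may then mix tensor products. The maximum principle needs the weak form on
    small balls and returns the strong form on the large one. *)
Definition weak_loc a r (th m : R) (nb : nat) : Prop :=
  exists B : seq ((pt N -> R) * R),
    [/\ (size B <= nb)%N,
        forall p, List.In p B -> eig (cube A a r) p.1 p.2,
        complete (cube A a r) B &
        forall p, List.In p B -> exists x0, loc_at (cube A a r) th m p.1 x0].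

Definition strong_loc a r (th m : R) : Prop :=
  forall f E, eig (cube A a r) f E -> \sum_(x <- cube A a r) f x ^+ 2 = 1 ->
    exists2 x0, x0 \in cube A a r & loc_at (cube A a r) th m f x0.

Definition nonresonant D1 D2 (eta : R) : Prop :=
  forall f1 E1 f2 E2, eig D1 f1 E1 -> nonzero_on D1 f1 -> eig D2 f2 E2 ->
    nonzero_on D2 f2 -> eta <= `|E1 - E2|.

Definition resonates D (E del : R) : Prop :=
  exists f E', [/\ eig D f E', nonzero_on D f & `|E' - E| < del].

Lemma resonates_excl D1 D2 E del : nonresonant D1 D2 (2 * del) ->
  resonates D1 E del -> resonates D2 E del -> False.
Proof.
move=> nr [f1 [E1 [e1 n1 l1]]] [f2 [E2 [e2 n2 l2]]].
have := nr _ _ _ _ e1 n1 e2 n2; have := ler_distD E E1 E2.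
by rewrite (distrC E E2); lra.
Qed.

Lemma strong_weak_loc a r th m : strong_loc a r th m ->
  weak_loc a r th m (size (cube A a r)).
Proof.
move=> sl; have [f [nu [h1 h2 h3]]] := spectral_domain A lam v Uc (cube_uniq A a r).
exists [seq (f k, nu k) | k <- enum 'I_(size (cube A a r))]; split.
- by rewrite size_map -cardE card_ord.
- by move=> p /List.in_map_iff[k [<- _]]; exact: h1.
- by move=> x y xD yD; rewrite big_map big_enum /= -h3.
- move=> p /List.in_map_iff[k [<- _]] /=.
  have [|x0 _ hx0] := sl _ _ (h1 k); last by exists x0.
  by under eq_bigr do rewrite expr2; rewrite h2 eqxx.
Qed.

(** The triangle inequality through the unknown centre [x0] removes it from the bound. Each factor
    loses at most [th], since closer to [x0] than [th] only the bound by one is available. *)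
Lemma loc_at_prod D th m f x0 x y : 0 <= m -> 0 <= th ->
  loc_at D th m f x0 -> (forall y, y \in D -> `|f y| <= 1) -> x \in D -> y \in D ->
  `|f y * f x| <= expR (- m * ((d y x)%:R - 2 * th)).
Proof.
move=> m0 th0 lf f1 xD yD.
have h z : z \in D -> `|f z| <= expR (- m * ((d z x0)%:R - th)).
  move=> zD; have [le|lt] := leP th (d z x0)%:R.
    by rewrite (le_trans (lf _ zD le)) // ler_expR !mulNr lerN2 ler_wpM2l // gerBl.
  by rewrite (le_trans (f1 _ zD)) // -[leLHS]expR0 ler_expR mulNr oppr_ge0 mulr_ge0_le0 // subr_le0 (ltW lt).
rewrite normrM (le_trans (ler_pM _ _ (h _ yD) (h _ xD))) // -expRD ler_expR.
have : (d y x)%:R <= (d y x0)%:R + (d x x0)%:R :> R.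
  by rewrite -natrD ler_nat [d x x0]dst_sym dst_tri.
by move=> tri; rewrite -mulrDr !mulNr lerN2 ler_wpM2l //; lra.
Qed.

(** * Maximum principle on one large ball with a single bad region *)

Section Step.
Variables (a b0 : pt N) (Rr r r0 nb : nat) (th m m'' del C : R).
Hypotheses (r_gt0 : (0 < r)%N) (rR : (r <= Rr)%N) (th0 : 0 <= th) (m''0 : 0 <= m'')
  (m''m : m'' <= m) (del0 : 0 < del).
Let Lam := cube A a Rr.
(** The bad region is thickened by [r], so that a point outside [Ups] has its clamped centre farther
    than [r0] from [b0], where [good] applies. *)
Let Ups := [seq x <- Lam | (d x b0 <= r0 + r)%N].
Hypothesis good : forall b, supported A b -> (d b a <= Rr - r)%N -> (r0 < d b b0)%N ->
  weak_loc b r th m nb.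
Hypothesis nr_cubes : forall b b', supported A b -> (d b a <= Rr - r)%N ->
  supported A b' -> (d b' a <= Rr - r)%N -> (2 * r < d b b')%N ->
  nonresonant (cube A b r) (cube A b' r) (2 * del).
Hypothesis nr_ups : forall b, supported A b -> (d b a <= Rr - r)%N ->
  (r0 + r + r < d b b0)%N -> nonresonant Ups (cube A b r) (2 * del).
Hypothesis C_ge1 : 1 <= C.
Hypothesis C_nb : (maxn nb (size Lam) * size Lam * (2 * N))%:R / del <= C.
(** Gain of one passage out of a good ball: decay at rate [m] over at least [r.+1] sites, reduced by
    the weight at rate [m''], with [2 * th] lost to the unknown centre and one site to the boundary
    hop. In [q_small] the second [C] and [expR m''] pay for a further passage through [Ups]. *)
Let q := expR (m * (1 + 2 * th) - (m - m'') * r.+1%:R).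
Hypothesis q_small : C * C * expR m'' * q < 1.

Variables (phi : pt N -> R) (E : R).
Hypothesis ephi : eig Lam phi E.
Hypothesis phi1 : \sum_(x <- Lam) phi x ^+ 2 = 1.

Let m0 : 0 <= m. Proof. exact: le_trans m''m. Qed.
Let C0 : 0 <= C. Proof. exact: le_trans C_ge1. Qed.

Let phi_le1 x : `|phi x| <= 1.
Proof.
have [xL|xL] := boolP (x \in Lam); last by rewrite (proj1 ephi _ xL) normr0.
have : `|phi x| ^+ 2 <= 1.
  rewrite real_normK ?num_real // -phi1 (bigD1_seq x) ?cube_uniq //= lerDl.
  by apply: sumr_ge0 => i _; exact: sqr_ge0.
by rewrite -[leRHS](expr1n _ 2) ler_pXn2r ?nnegrE.
Qed.

Let dS x y : d x y = d y x. Proof. exact: dst_sym. Qed.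
Let dT y x z : (d x z <= d x y + d y z)%N. Proof. exact: dst_tri. Qed.

Let clamped y b := [/\ supported A b, (d b a <= Rr - r)%N, (d b y <= r)%N &
    forall z, (d z a <= Rr)%N -> (r < d z b)%N -> (r < d z y)%N].

Let clampE y : y \in Lam -> exists b, clamped y b.
Proof. by rewrite mem_cube => /andP[_ ya]; exact: clamp_exists. Qed.

Let sub_cube b : (d b a <= Rr - r)%N -> {subset cube A b r <= Lam}.
Proof.
move=> ba x; rewrite !mem_cube => /andP[-> /= xb].
by rewrite (leq_trans (dst_tri A b x a)) // -(subnKC rR) leq_add.
Qed.

Let C_step n1 n2 : (n1 <= maxn nb (size Lam))%N -> (n2 <= size Lam)%N ->
  (n1 * n2 * (2 * N))%:R / del <= C.
Proof.
move=> h1 h2; apply: le_trans C_nb; rewrite ler_wpM2r ?invr_ge0 ?(ltW del0) //.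
by rewrite ler_nat leq_mul // leq_mul.
Qed.

(** At a good non-resonant point the boundary expansion contracts the maximum of [|phi|] times the
    weight, for any weight that is Lipschitz for [d]. The clamped ball, not one centred at [y], is
    used because it must stay inside [Lam]. *)
Let good_step y b (f : pt N -> nat) (Mx : R) : y \in Lam -> clamped y b -> (r0 + r < d y b0)%N ->
  ~ resonates (cube A b r) E del -> (forall x z, (f x <= f z + d x z)%N) ->
  (forall x, x \in Lam -> `|phi x| * expR (m'' * (f x)%:R) <= Mx) ->
  `|phi y| * expR (m'' * (f y)%:R) <= C * q * Mx.
Proof.
move=> yL [sb ba byr clp] yfar nres lip hMx.
have Mx0 : 0 <= Mx by apply: le_trans (hMx y yL); rewrite mulr_ge0 ?expR_ge0.
have [|B [sB eB cB lB]] := good sb ba.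
  by have := dT b y b0; rewrite (dS y b); natlia.
pose Q := expR (- (m'' * (f y)%:R)) * (q * Mx).
have yD : y \in cube A b r.
  by move: yL; rewrite !mem_cube => /andP[-> _] /=; rewrite dst_sym.
have le1 p : List.In p B -> forall z, z \in cube A b r -> `|p.1 z| <= 1.
  by move=> pB z zD; exact: complete_le1 cB pB zD.
have main : `|phi y| <= (size B * size (cube A b r) * (2 * N))%:R / del * Q.
  apply: (@boundary_expansion R N A lam v Uc (cube A b r) Lam B phi E) => //.
  - exact: cube_uniq.
  - exact: cube_uniq.
  - exact: sub_cube.
  - by rewrite /Q !mulr_ge0 ?expR_ge0.
  - move=> p pB nz; rewrite leNgt; apply/negP => lt; apply: nres.
    by exists p.1, p.2; split=> //; exact: eB.
  move=> p x z pB xD zL zD xz; have [x0 lx0] := lB _ pB.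
  apply: le_trans (ler_wpM2r (normr_ge0 _) (loc_at_prod m0 th0 lx0 (le1 _ pB) xD yD)) _.
  have hz : `|phi z| <= Mx * expR (- (m'' * (f z)%:R)).
    by rewrite expRN ler_pdivlMr ?expR_gt0 // hMx.
  apply: le_trans (ler_wpM2l (expR_ge0 _) hz) _.
  rewrite /Q /q [leLHS](_ : _ = Mx * (expR (- m * ((d y x)%:R - 2 * th)) * expR (- (m'' * (f z)%:R)))); last by ring.
  rewrite [leRHS](_ : _ = Mx * (expR (- (m'' * (f y)%:R)) * expR (m * (1 + 2 * th) - (m - m'') * r.+1%:R))); last by ring.
  rewrite ler_wpM2l // -!expRD ler_expR.
  have rz : (r < d z y)%N.
    apply: clp; first by move: zL; rewrite mem_cube => /andP[].
    by move: zL zD; rewrite !mem_cube => /andP[-> _] /=; rewrite -ltnNge.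
  have hx1 := adj_dst xz.
  have t1 : (d z y)%:R <= (d y x)%:R + 1 :> R.
    have h : (d z y <= d y x + 1)%N by rewrite (dS z y) (leq_trans (dT x y z)) // leq_add2l.
    by move: h; rewrite -(ler_nat R) natrD.
  have t2 : r.+1%:R <= (d z y)%:R :> R by rewrite ler_nat.
  have t3 : (f y)%:R <= (f z)%:R + (d z y)%:R :> R.
    by rewrite -natrD ler_nat /d dst_sym.
  have p1 : m * (d z y)%:R <= m * ((d y x)%:R + 1) by rewrite ler_wpM2l.
  have p2 : (m - m'') * r.+1%:R <= (m - m'') * (d z y)%:R by rewrite ler_wpM2l // subr_ge0.
  have p3 : m'' * (f y)%:R <= m'' * ((f z)%:R + (d z y)%:R) by rewrite ler_wpM2l.
  move: p1 p2 p3; rewrite !mulrBl !mulrDr mulr1; lra.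
have main2 : `|phi y| <= C * Q.
  apply: le_trans main _; rewrite ler_wpM2r //; first by rewrite /Q !mulr_ge0 ?expR_ge0.
  apply: C_step; first by rewrite (leq_trans sB) // leq_maxl.
  by apply: uniq_leq_size; [exact: cube_uniq|exact: sub_cube].
apply: le_trans (ler_wpM2r (expR_ge0 _) main2) _.
rewrite /Q [leLHS](_ : _ = C * q * Mx * (expR (- (m'' * (f y)%:R)) * expR (m'' * (f y)%:R))); last by ring.
by rewrite -expRD addNr expR0 mulr1.
Qed.

(** Nothing is known about localization in [Ups], so its eigenfunctions are only bounded by one. The
    price is a factor [C] without decay; the boundary values lie in the next shell, where
    [good_step] is available. *)
Let ups_step y (Q : R) : y \in Ups -> ~ resonates Ups E del -> 0 <= Q ->
  (forall x, x \in Lam -> (r0 + r < d x b0)%N -> (d x b0 <= (r0 + r).+1)%N -> `|phi x| <= Q) ->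
  `|phi y| <= C * Q.
Proof.
move=> yU nres Q0 hQ; have uU : uniq Ups by rewrite filter_uniq // cube_uniq.
have sU : (size Ups <= size Lam)%N by rewrite size_filter count_size.
have [f [nu [h1 h2 h3]]] := spectral_domain A lam v Uc uU.
pose B := [seq (f k, nu k) | k <- enum 'I_(size Ups)].
have eB p : List.In p B -> eig Ups p.1 p.2 by move=> /List.in_map_iff[k [<- _]]; exact: h1.
have cB : complete Ups B by move=> x z xD zD; rewrite big_map big_enum /= -h3.
have main : `|phi y| <= (size B * size Ups * (2 * N))%:R / del * Q.
  apply: (@boundary_expansion R N A lam v Uc Ups Lam B phi E) => //.
  - exact: cube_uniq.
  - by move=> x; rewrite mem_filter => /andP[].
  - move=> p pB nz; rewrite leNgt; apply/negP => lt; apply: nres.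
    by exists p.1, p.2; split=> //; exact: eB.
  move=> p x z pB xU zL zU xz.
  have zfar : (r0 + r < d z b0)%N by move: zU; rewrite mem_filter zL andbT -ltnNge.
  have znear : (d z b0 <= (r0 + r).+1)%N.
    move: xU; rewrite mem_filter => /andP[xU _].
    by rewrite -add1n (leq_trans (dT x z b0)) // leq_add // (dS z x); exact: adj_dst xz.
  rewrite -[Q]mul1r ler_pM //; last exact: hQ.
  by rewrite normrM mulr_ile1 // (complete_le1 cB).
apply: le_trans main _; rewrite ler_wpM2r // C_step //.
by rewrite size_map -cardE card_ord (leq_trans sU) // leq_maxr.
Qed.

Let q0 : 0 < q. Proof. exact: expR_gt0. Qed.

Let Cq_lt1 : C * q < 1.
Proof.
apply: le_lt_trans q_small; rewrite ler_wpM2r ?(ltW q0) // -mulrA ler_peMr //.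
by rewrite -[1]mulr1 ler_pM // -expR0 ler_expR.
Qed.

Let CCq_lt1 : C * (C * q) < 1.
Proof.
apply: le_lt_trans q_small; rewrite mulrA ler_wpM2r ?(ltW q0) // ler_peMr ?mulr_ge0 //.
by rewrite -expR0 ler_expR.
Qed.

(** The centre [x0] maximizes [|phi|]. Wherever a contraction applies at [x0] it would force
    [|phi x0| < |phi x0|], so something around [x0] resonates with [E]; pairwise non-resonance then
    clears everything far from it. *)
Lemma step_decay : exists2 x0, x0 \in Lam &
  forall y, y \in Lam -> `|phi y| <= expR (- m'' * ((d y x0)%:R - (2 * r0 + 17 * r)%:R)).
Proof.
have Lex : exists x, x \in Lam.
  case eL : Lam => [|x s]; last by exists x; rewrite mem_head.
  by move: phi1; rewrite eL big_nil => /eqP; rewrite eq_sym oner_eq0.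
have [x0 x0L x0max] := seq_argmax (fun x => `|phi x|) Lex.
have px0 : 0 < `|phi x0|.
  rewrite lt_neqAle normr_ge0 andbT eq_sym; apply/eqP => e0.
  move: phi1; rewrite big_seq big1 => [/eqP|x xL]; first by rewrite eq_sym oner_eq0.
  by have := x0max _ xL; rewrite e0 normr_le0 => /eqP ->; rewrite expr0n.
have flat : forall x, x \in Lam -> `|phi x| * expR (m'' * (0%N)%:R) <= `|phi x0|.
  by move=> x xL; rewrite mulr0 expR0 mulr1 x0max.
have flat_step y b : y \in Lam -> clamped y b -> (r0 + r < d y b0)%N ->
    ~ resonates (cube A b r) E del -> `|phi y| <= C * q * `|phi x0|.
  move=> yL cl yf nr.
  by have := good_step (f := fun=> 0%N) yL cl yf nr (fun _ _ => leq0n _) flat; rewrite mulr0 expR0 mulr1.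
(* If the weighted maximum is contracted wherever [f] is positive, it is attained where [f] vanishes
   and is therefore at most one. [F] measures how far [f] falls short of the distance to [x0]. *)
have argmax_decay (f : pt N -> nat) (F : nat) :
    (forall y, y \in Lam -> (0 < f y)%N -> forall Mx, 0 < Mx ->
      (forall x, x \in Lam -> `|phi x| * expR (m'' * (f x)%:R) <= Mx) ->
      `|phi y| * expR (m'' * (f y)%:R) < Mx) ->
    (forall y, (d y x0 <= f y + F)%N) ->
    forall y, y \in Lam -> `|phi y| <= expR (- m'' * ((d y x0)%:R - F%:R)).
  move=> hdec hF; have [ys ysL ysmax] := seq_argmax (fun x => `|phi x| * expR (m'' * (f x)%:R)) Lex.
  have fys : f ys = 0%N.
    apply/eqP; apply: contraT; rewrite -lt0n => fpos.
    have Mpos : 0 < `|phi ys| * expR (m'' * (f ys)%:R).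
      by apply: lt_le_trans (ysmax _ x0L); rewrite mulr_gt0 // expR_gt0.
    by have := hdec _ ysL fpos _ Mpos ysmax; rewrite ltxx.
  move=> y yL; have := ysmax _ yL; rewrite fys mulr0 expR0 mulr1 => h.
  have h1 : `|phi y| * expR (m'' * (f y)%:R) <= 1 by exact: le_trans h (phi_le1 _).
  have : `|phi y| <= expR (- (m'' * (f y)%:R)) by rewrite expRN -[leRHS]mul1r ler_pdivlMr // expR_gt0.
  move=> /le_trans; apply; rewrite ler_expR mulNr lerN2 ler_wpM2l // lerBlDr.
  by rewrite -natrD ler_nat.
exists x0 => //.
(* The thresholds [6 * r] here and [11 * r] below leave at least [5 * r] between points, so that
   their clamped centres, each displaced by at most [r], remain more than [2 * r] apart. *)
have [near|far] := leqP (d x0 b0) (r0 + 6 * r).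
(* A resonant ball this far out would make [Ups] and all balls close to it non-resonant, and [x0]
   would then be contracted. *)
- have nres y b : y \in Lam -> clamped y b -> (r0 + 11 * r < d y b0)%N ->
      ~ resonates (cube A b r) E del.
    move=> yL [sb ba byr _] yfar rb.
    have nrU : ~ resonates Ups E del.
      move=> rU; apply: resonates_excl rU rb; apply: nr_ups => //.
      by have := dT b y b0; rewrite (dS y b); natlia.
    have nr' z b' : clamped z b' -> (d z b0 <= (r0 + 6 * r).+1)%N -> ~ resonates (cube A b' r) E del.
      move=> [sb' ba' bz _] znear rz; apply: resonates_excl rz rb; apply: nr_cubes => //.
      have := dT b' z b; have := dT b z y; have := dT z y b0.
      by rewrite (dS z b') (dS y z); natlia.
    have bd z : z \in Lam -> (r0 + r < d z b0)%N -> (d z b0 <= (r0 + 6 * r).+1)%N ->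
        `|phi z| <= C * q * `|phi x0|.
      by move=> zL zf zn; have [b' cl] := clampE zL; apply: flat_step cl zf (nr' _ _ cl zn).
    have [inU|outU] := leqP (d x0 b0) (r0 + r).
      have : `|phi x0| <= C * (C * q * `|phi x0|).
        apply: ups_step => //; first by rewrite mem_filter inU.
          by rewrite !mulr_ge0 ?(ltW q0).
        by move=> z zL zf zn; apply: bd => //; natlia.
      by rewrite leNgt; apply/negP; rewrite negbK mulrA gtr_pMl.
    have := bd _ x0L outU (leqW near).
    by rewrite leNgt; apply/negP; rewrite negbK gtr_pMl.
  (* The shortfall is [r0 + 11 * r] from the truncation plus [r0 + 6 * r] from [x0] to [b0]: this is
     the constant of the statement. *)
  apply: (argmax_decay (fun y => d y b0 - (r0 + 11 * r))%N); last first.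
    by move=> y; have := dT b0 y x0; rewrite (dS b0 x0); natlia.
  move=> y yL fy Mx Mx0 hMx; have [b cl] := clampE yL.
  have yfar : (r0 + 11 * r < d y b0)%N by natlia.
  apply: le_lt_trans (good_step yL cl _ (nres _ _ yL cl yfar) _ hMx) _; first by natlia.
    by move=> x z; have := dT z x b0; natlia.
  by rewrite gtr_pMl.
have [b1 cl1] := clampE x0L; have [sb1 ba1 bx1 _] := cl1.
have res1 : resonates (cube A b1 r) E del.
  apply: contrapT => nr; have := flat_step _ _ x0L cl1 _ nr.
  have h : (r0 + r < d x0 b0)%N by natlia.
  by move=> /(_ h); rewrite leNgt; apply/negP; rewrite negbK gtr_pMl.
have nrU : ~ resonates Ups E del.
  move=> rU; apply: resonates_excl rU res1; apply: nr_ups => //.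
  by have := dT b1 x0 b0; rewrite (dS x0 b1); natlia.
have nr' y b : clamped y b -> (4 * r < d y x0)%N -> ~ resonates (cube A b r) E del.
  move=> [sb ba by' _] yf rb; apply: resonates_excl rb res1; apply: nr_cubes => //.
  by have := dT b y b1; have := dT b1 y x0; rewrite (dS y b); natlia.
(* Distance to [x0] in a geometry where [Ups] is collapsed to a point: paths through [Ups] are free,
   so [ups_step], which brings no decay, loses no weight. The [4 * r] excludes the balls that may
   resonate together with the one at [x0]. *)
pose f y := (minn (d y x0) ((d y b0 - (r0 + r)) + (d x0 b0 - (r0 + r))) - 4 * r)%N.
have lip x z : (f x <= f z + d x z)%N.
  by rewrite /f; have := dT z x x0; have := dT z x b0; natlia.
apply: (argmax_decay f); last by move=> y; rewrite /f; have := dT b0 y x0; rewrite (dS b0 x0); natlia.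
move=> y yL fy Mx Mx0 hMx.
have [inU|outU] := leqP (d y b0) (r0 + r); last first.
  have [b cl] := clampE yL; have yf : (4 * r < d y x0)%N by move: fy; rewrite /f; natlia.
  apply: le_lt_trans (good_step yL cl outU (nr' _ _ cl yf) lip hMx) _.
  by rewrite gtr_pMl.
(* Between a point of [Ups] and the shell around it [f] drops by at most one, whence the single
   extra [m'']. *)
pose Q := expR (m'' - m'' * (f y)%:R) * (C * q * Mx).
have Q0 : 0 <= Q by rewrite /Q !mulr_ge0 ?expR_ge0 ?(ltW q0) ?(ltW Mx0).
have hup : `|phi y| <= C * Q.
  apply: ups_step => //; first by rewrite mem_filter inU.
  move=> z zL zf zn; have [b cl] := clampE zL.
  have zx : (4 * r < d z x0)%N by have := dT z x0 b0; rewrite (dS x0 z); natlia.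
  have := good_step zL cl zf (nr' _ _ cl zx) lip hMx.
  rewrite -ler_pdivlMr ?expR_gt0 // -expRN => /le_trans; apply.
  rewrite /Q mulrC ler_wpM2r ?mulr_ge0 ?(ltW q0) ?(ltW Mx0) // ler_expR.
  have : (f y <= f z + 1)%N.
    rewrite /f; have := dT z x0 b0; have := dT y x0 b0; rewrite (dS x0 z) (dS x0 y); natlia.
  rewrite -(ler_nat R) natrD => hf.
  have : m'' * (f y)%:R <= m'' * ((f z)%:R + 1) by rewrite ler_wpM2l.
  by rewrite mulrDr mulr1; lra.
apply: le_lt_trans (ler_wpM2r (expR_ge0 _) hup) _; rewrite /Q.
rewrite [ltLHS](_ : _ = C * C * q * Mx * (expR (m'' - m'' * (f y)%:R) * expR (m'' * (f y)%:R))); last by ring.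
rewrite -expRD subrK [ltLHS](_ : _ = C * C * expR m'' * q * Mx); last by ring.
by rewrite gtr_pMl.
Qed.

End Step.
End Localization.

(** * Large disorder *)

Section LargeDisorder.
Variables (R : realType) (N : nat) (A : {set 'I_N}) (lam : R) (v Uc : int -> R).
Implicit Types (x y z a b : pt N).
Let d := dst A.

Lemma shift_neq x j (k : int) : k != 0 -> Defs.shift x j k != x.
Proof.
move=> k0; apply/eqP => /ffunP/(_ j); rewrite ffunE eqxx => /eqP.
by rewrite -subr_eq0 addrAC subrr add0r (negbTE k0).
Qed.

Lemma adjxx x : adj A x x = 0%N.
Proof.
rewrite /adj big1 // => j _; rewrite !(eq_sym x).
by rewrite !(negbTE (shift_neq _ _ _)).
Qed.

Lemma eigpair_singleton x :
  eigpair A lam v Uc [:: x] (fun y => (y == x)%:R) (pot A lam v Uc x).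
Proof.
have z y : y \notin [:: x] -> (y == x)%:R = 0 :> R by rewrite inE => /negbTE ->.
split=> // y; rewrite inE => /eqP ->.
by rewrite (@HamE R N A lam v Uc [:: x]) // big_seq1 /Hker adjxx eqxx oppr0 add0r mul1r.
Qed.

Lemma nonresonant_singletons x y eta : nonresonant A lam v Uc [:: x] [:: y] eta ->
  eta <= `|pot A lam v Uc x - pot A lam v Uc y|.
Proof.
move/(_ _ _ _ _ (eigpair_singleton x) _ (eigpair_singleton y)); apply.
  by exists x; rewrite ?mem_head // eqxx oner_eq0.
by exists y; rewrite ?mem_head // eqxx oner_eq0.
Qed.

Lemma hop_le D (f : pt N -> R) x Q : uniq D -> (forall y, y \notin D -> f y = 0) -> 0 <= Q ->
  (forall y, y \in D -> adj A x y != 0%N -> `|f y| <= Q) -> `|hop A f x| <= (2 * N)%:R * Q.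
Proof.
move=> uD f0 Q0 hQ; rewrite (hopE _ _ uD f0) (le_trans (ler_norm_sum _ _ _)) //.
apply: (@le_trans _ _ (\sum_(y <- D) (adj A x y)%:R * Q)); last first.
  by rewrite -mulr_suml ler_wpM2r // adj_row_le.
rewrite big_seq [leRHS]big_seq; apply: ler_sum => y yD.
case: (eqVneq (adj A x y) 0%N) => [->|nz]; first by rewrite !mul0r normr0.
by rewrite normrM normr_nat ler_wpM2l // hQ.
Qed.

(** At the maximum of [|phi|] the eigenvalue equation puts [E] within [2 * N] of the diagonal entry,
    hence farther than [2 * N * expR m] from all others, and the weighted maximum cannot sit
    elsewhere. Permutations of [x0] share its entry and are at distance zero. The decay obtained
    needs no threshold, so [th] is arbitrary. *)
Lemma large_disorder_loc a r (th m eta : R) : 0 <= m ->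
  (forall x y, x \in cube A a r -> y \in cube A a r -> (0 < d x y)%N ->
     eta <= `|pot A lam v Uc x - pot A lam v Uc y|) ->
  (2 * N)%:R * (1 + expR m) < eta -> strong_loc A lam v Uc a r th m.
Proof.
move=> m0 sep big phi E ephi phi1; set Lam := cube A a r.
have uL : uniq Lam by exact: cube_uniq.
have [phi0 hphi] := ephi.
have Lex : exists x, x \in Lam.
  case eL : Lam => [|x s]; last by exists x; rewrite mem_head.
  by move: phi1; rewrite -/Lam eL big_nil => /eqP; rewrite eq_sym oner_eq0.
have [x0 x0L x0max] := seq_argmax (fun x => `|phi x|) Lex.
have px0 : 0 < `|phi x0|.
  rewrite lt_neqAle normr_ge0 andbT eq_sym; apply/eqP => e0.
  move: phi1; rewrite big_seq big1 => [/eqP|x xL]; first by rewrite eq_sym oner_eq0.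
  by have := x0max _ xL; rewrite e0 normr_le0 => /eqP ->; rewrite expr0n.
have px01 : `|phi x0| <= 1.
  have : `|phi x0| ^+ 2 <= 1.
    rewrite real_normK ?num_real // -phi1 (bigD1_seq x0) //= lerDl.
    by apply: sumr_ge0 => i _; exact: sqr_ge0.
  by rewrite -[leRHS](expr1n _ 2) ler_pXn2r ?nnegrE.
have ham y : y \in Lam -> (pot A lam v Uc y - E) * phi y = hop A phi y.
  by move=> yL; have := hphi _ yL; rewrite /Ham => h; rewrite mulrBl -h; ring.
have e0 : `|pot A lam v Uc x0 - E| <= (2 * N)%:R.
  rewrite -(ler_pM2r px0) -normrM ham // (@hop_le Lam) //.
  by move=> y yL _; exact: x0max.
have far y : y \in Lam -> (0 < d y x0)%N -> (2 * N)%:R * expR m < `|pot A lam v Uc y - E|.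
  move=> yL dy; have := sep _ _ yL x0L dy; have := ler_distD E (pot A lam v Uc y) (pot A lam v Uc x0).
  by rewrite (distrC E) => h1 h2; move: big e0; rewrite mulrDr mulr1; lra.
have [ys ysL ysmax] := seq_argmax (fun x => `|phi x| * expR (m * (d x x0)%:R)) Lex.
exists x0 => //.
have dys : d ys x0 = 0%N.
  apply/eqP; apply: contraT; rewrite -lt0n => dpos.
  set Mx := `|phi ys| * expR (m * (d ys x0)%:R) in ysmax.
  have Mpos : 0 < Mx by apply: lt_le_trans (ysmax _ x0L); rewrite mulr_gt0 // expR_gt0.
  have pys : 0 < `|phi ys| by move: Mpos; rewrite /Mx pmulr_lgt0 // expR_gt0.
  have : `|hop A phi ys| <= (2 * N)%:R * (Mx * expR (m - m * (d ys x0)%:R)).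
    apply: (@hop_le Lam) => //; first by rewrite mulr_ge0 ?expR_ge0 ?(ltW Mpos).
    move=> y yL nz; have := ysmax _ yL; rewrite -ler_pdivlMr ?expR_gt0 // -expRN => /le_trans; apply.
    rewrite ler_wpM2l ?(ltW Mpos) // ler_expR.
    have h : (d ys x0 <= 1 + d y x0)%N.
      by rewrite (leq_trans (dst_tri A y ys x0)) // leq_add2r (adj_dst nz).
    move: h; rewrite -(ler_nat R) natrD => h.
    have : m * (d ys x0)%:R <= m * (1 + (d y x0)%:R) by rewrite ler_wpM2l.
    by rewrite mulrDr mulr1; lra.
  rewrite -ham // normrM expRD expRN /Mx.
  have ex0 : expR (m * (d ys x0)%:R) != 0 by rewrite gt_eqF // expR_gt0.
  rewrite [leRHS](_ : _ = (2 * N)%:R * expR m * `|phi ys|); last by field.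
  by rewrite ler_pM2r // leNgt far.
move=> y yL _; have := ysmax _ yL; rewrite dys mulr0 expR0 mulr1 => h.
rewrite mulNr expRN -[leRHS]mul1r ler_pdivlMr ?expR_gt0 //.
by apply: le_trans h _; exact: le_trans (x0max _ ysL) px01.
Qed.

End LargeDisorder.

(** * Non-interacting clusters *)

Lemma big_flat_map (T U : Type) (R : nmodType) (g : T -> seq U) (s : seq T) (F : U -> R) :
  \sum_(p <- List.flat_map g s) F p = \sum_(x <- s) \sum_(p <- g x) F p.
Proof. by elim: s => [|x s IH] /=; rewrite ?big_nil // big_cat big_cons IH. Qed.

Lemma size_flat_map_le (T U : Type) (g : T -> seq U) (s : seq T) (k : nat) :
  (forall x, List.In x s -> (size (g x) <= k)%N) -> (size (List.flat_map g s) <= size s * k)%N.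
Proof.
elim: s => [|x s IH] //= h; rewrite size_cat mulSn leq_add ?h //; first by left.
by apply: IH => y ys; apply: h; right.
Qed.

Section Splitting.
Variables (N : nat).
Implicit Types (A : {set 'I_N}) (x y b : pt N).

Lemma cnt_split A A1 u x : A1 \subset A -> cnt A u x = (cnt A1 u x + cnt (A :\: A1) u x)%N.
Proof.
move=> sA; rewrite /cnt -(cardsID A1 [set j in A | u <= x j]); congr (_ + _)%N.
  apply: eq_card => j; rewrite !inE; case: (boolP (j \in A1)) => jA; rewrite ?andbF //.
  by rewrite (fintype.subsetP sA _ jA) andbT.
by apply: eq_card => j; rewrite !inE andbA.
Qed.

Lemma eq_in_cnt A u x y : {in A, x =1 y} -> cnt A u x = cnt A u y.
Proof. by move=> h; apply: eq_card => j; rewrite !inE; case: (boolP (j \in A)) => //= /h ->. Qed.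

Lemma dst_split_le A A1 x y : A1 \subset A ->
  (dst A x y <= maxn (dst A1 x y) (dst (A :\: A1) x y))%N.
Proof.
move=> sA; apply/dstP => u; rewrite !(cnt_split _ _ sA).
set M := maxn _ _.
have /dstP h1 : (dst A1 x y <= M)%N by rewrite leq_maxl.
have /dstP h2 : (dst (A :\: A1) x y <= M)%N by rewrite leq_maxr.
by split; apply: leq_add; have [] := h1 u; have [] := h2 u.
Qed.

Lemma dst_split_ge A A1 x y (th : int) r : A1 \subset A -> (dst A x y <= r)%N ->
  {in A1, forall j, x j <= th /\ y j <= th} ->
  {in A :\: A1, forall j, th < x j /\ th < y j} ->
  (dst A1 x y <= r)%N /\ (dst (A :\: A1) x y <= r)%N.
Proof.
move=> sA /dstP h hL hR.
have full z u : (z = x \/ z = y) -> u <= th + 1 -> cnt (A :\: A1) u z = #|A :\: A1|.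
  by move=> hz hu; apply: cnt_full => j /hR; case: hz => ->; lia.
have none z u : (z = x \/ z = y) -> th < u -> cnt A1 u z = 0%N.
  by move=> hz hu; apply: cnt_none => j /hL; case: hz => ->; lia.
have xl : x = x \/ x = y by left. have yr : y = x \/ y = y by right.
have maxR u z := cnt_max (A :\: A1) u z.
split; apply/dstP => u; have [h1 h2] := h u; rewrite !(cnt_split _ _ sA) in h1 h2.
  have [hu|hu] := leP u th; last by rewrite (none x u xl hu) (none y u yr hu).
  have hu1 : u <= th + 1 by lia.
  have hu2 : u - r%:Z <= th + 1 by lia.
  rewrite (full x _ xl hu1) (full y _ yr hu2) leq_add2r in h1.
  by rewrite (full y _ yr hu1) (full x _ xl hu2) leq_add2r in h2.
have [hu|hu] := leP (u - r%:Z) th.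
  have hu2 : u - r%:Z <= th + 1 by lia.
  by rewrite (full x _ xl hu2) (full y _ yr hu2) !maxR.
have hu' : th < u by lia.
rewrite (none x _ xl hu') (none y _ yr hu) in h1.
by rewrite (none y _ yr hu') (none x _ xl hu) in h2.
Qed.

Lemma transport_exists A0 A1 : #|A0| = #|A1| ->
  exists g : 'I_N -> 'I_N, [seq g j | j <- enum A1] = enum A0.
Proof.
move=> e; pose g j := nth j (enum A0) (index j (enum A1)); exists g.
have se : size (enum A0) = size (enum A1) by rewrite -!cardE.
case E1 : (enum A1) => [|j0 s]; first by rewrite E1 /= in se; case: (enum A0) se.
rewrite -E1; apply: (@eq_from_nth _ j0); rewrite size_map // => i hi.
rewrite (nth_map j0) // /g index_uniq ?enum_uniq //.
by apply: set_nth_default; rewrite se.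
Qed.

Lemma cnt_count A u x : cnt A u x = count (fun j => u <= x j) (enum A).
Proof.
by rewrite /cnt -sum1_card -sum1_count big_enum_cond /=; apply: eq_bigl => j; rewrite inE.
Qed.

Lemma cnt_transport A0 A1 (g : 'I_N -> 'I_N) u x y : [seq g j | j <- enum A1] = enum A0 ->
  {in A1, forall j, y j = x (g j)} -> cnt A1 u y = cnt A0 u x.
Proof.
move=> eg hy; rewrite (@eq_in_cnt A1 u y [ffun j => x (g j)]); last by move=> j /hy; rewrite ffunE.
rewrite !cnt_count -eg count_map; apply: eq_count => j /=; by rewrite ffunE.
Qed.

(** A ball for the symmetrized distance contains points whose left cluster carries any label set of
    the right size. For each such set a permuted copy of the centre is needed with these labels on
    the left. *)
Lemma relabel_exists A A0 A1 b : A0 \subset A -> A1 \subset A -> #|A0| = #|A1| ->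
  exists b', [/\ supported A b', dst A b' b = 0%N,
    {in A1, forall j, exists2 i, i \in A0 & b' j = b i} &
    {in A :\: A1, forall j, exists2 i, i \in A :\: A0 & b' j = b i}].
Proof.
move=> s0 s1 e; have e' : #|A :\: A0| = #|A :\: A1|.
  by rewrite !cardsD; congr (_ - _)%N; rewrite (finset.setIidPr s0) (finset.setIidPr s1).
have [g hg] := transport_exists e; have [g' hg'] := transport_exists e'.
pose b' : pt N := [ffun j => if j \in A1 then b (g j) else if j \in A then b (g' j) else 0].
have b1 : {in A1, forall j, b' j = b (g j)} by move=> j jA; rewrite ffunE jA.
have b2 : {in A :\: A1, forall j, b' j = b (g' j)}.
  by move=> j; rewrite inE ffunE => /andP[/negbTE -> ->].
exists b'; split.
- apply/supportedP => j jA; rewrite ffunE (negbTE jA).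
  by case: (boolP (j \in A1)) => // /(fintype.subsetP s1); rewrite (negbTE jA).
- rewrite (@eq_cnt_dst _ _ _ b) ?dstxx // => u.
  by rewrite (cnt_split _ _ s1) (cnt_split _ _ s0) (cnt_transport _ hg b1) (cnt_transport _ hg' b2).
- move=> j jA; exists (g j); last exact: b1.
  by rewrite -mem_enum -hg map_f // mem_enum.
- move=> j jA; exists (g' j); last exact: b2.
  by rewrite -mem_enum -hg' map_f // mem_enum.
Qed.

End Splitting.

Lemma In_mem (T : eqType) (s : seq T) x : List.In x s -> x \in s.
Proof. by elim: s => //= y s IH [->|/IH]; rewrite inE ?eqxx // => ->; rewrite orbT. Qed.

Section Tensor.
Variables (R : realType) (N : nat) (A A1 : {set 'I_N}) (lam : R) (v Uc : int -> R) (K : nat).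
Hypotheses (sA : A1 \subset A) (hU : forall z : int, (K < `|z|)%N -> Uc z = 0).
Implicit Types (x y : pt N).
Let A2 := A :\: A1.

Definition tensor (f1 f2 : pt N -> R) x : R :=
  (supported A x)%:R * (f1 (res A1 x) * f2 (res A2 x)).

Lemma sum_labels_split (P : pred 'I_N) (F : 'I_N -> R) :
  \sum_(j in A | P j) F j = \sum_(j in A1 | P j) F j + \sum_(j in A2 | P j) F j.
Proof. by rewrite (big_setIDcond _ _ A1) (finset.setIidPr sA). Qed.

Lemma sum_labels_split0 (F : 'I_N -> R) :
  \sum_(j in A) F j = \sum_(j in A1) F j + \sum_(j in A2) F j.
Proof. by rewrite (big_setID A1) (finset.setIidPr sA). Qed.

Lemma pot_split x : (forall i j, i \in A1 -> j \in A2 -> (K < `|(x i - x j)%R|)%N) ->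
  pot A lam v Uc x = pot A1 lam v Uc (res A1 x) + pot A2 lam v Uc (res A2 x).
Proof.
move=> sep; rewrite /pot sum_labels_split0 [X in _ + X = _]sum_labels_split0.
under [X in _ + (X + _) = _]eq_bigr => i iA.
  rewrite sum_labels_split [X in _ + X](_ : _ = 0); last first.
    by apply: big1 => j /andP[jA _]; apply: hU; exact: sep.
  rewrite addr0; over.
under [X in _ + (_ + X) = _]eq_bigr => i iA.
  rewrite sum_labels_split [X in X + _](_ : _ = 0); last first.
    by apply: big1 => j /andP[jA _]; apply: hU; rewrite distnC; exact: sep.
  rewrite add0r; over.
have e1 : forall j, j \in A1 -> res A1 x j = x j by move=> j jA; rewrite resE jA.
have e2 : forall j, j \in A2 -> res A2 x j = x j by move=> j jA; rewrite resE jA.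
have -> : \sum_(j in A1) v (res A1 x j) = \sum_(j in A1) v (x j).
  by apply: eq_bigr => j jA; rewrite e1.
have -> : \sum_(j in A2) v (res A2 x j) = \sum_(j in A2) v (x j).
  by apply: eq_bigr => j jA; rewrite e2.
have -> : \sum_(i in A1) \sum_(j in A1 | (i < j)%N) Uc (res A1 x i - res A1 x j) =
    \sum_(i in A1) \sum_(j in A1 | (i < j)%N) Uc (x i - x j).
  by apply: eq_bigr => i iA; apply: eq_bigr => j /andP[jA _]; rewrite !e1.
have -> : \sum_(i in A2) \sum_(j in A2 | (i < j)%N) Uc (res A2 x i - res A2 x j) =
    \sum_(i in A2) \sum_(j in A2 | (i < j)%N) Uc (x i - x j).
  by apply: eq_bigr => i iA; apply: eq_bigr => j /andP[jA _]; rewrite !e2.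
by rewrite mulrDr; ring.
Qed.

Lemma res_shift_in (B : {set 'I_N}) x j k : j \in B ->
  res B (Defs.shift x j k) = Defs.shift (res B x) j k.
Proof. by move=> jB; apply/ffunP => i; rewrite !ffunE; case: eqP => [->|]//; rewrite jB. Qed.

Lemma res_shift_out (B : {set 'I_N}) x j k : j \notin B ->
  res B (Defs.shift x j k) = res B x.
Proof.
move=> jB; apply/ffunP => i; rewrite !ffunE; case: eqP => [->|]//.
by rewrite (negbTE jB).
Qed.

Lemma hop_tensor f1 f2 x : supported A x -> hop A (tensor f1 f2) x =
  hop A1 f1 (res A1 x) * f2 (res A2 x) + f1 (res A1 x) * hop A2 f2 (res A2 x).
Proof.
move=> sx; rewrite /hop sum_labels_split0 mulr_suml mulr_sumr; congr (_ + _).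
  apply: eq_bigr => j jA1; have jA : j \in A by exact: (fintype.subsetP sA).
  have jA2 : j \notin A2 by rewrite inE jA1.
  by rewrite /tensor -/A2 !supported_shift // !mul1r !(@res_shift_in A1) // !(@res_shift_out A2) //; ring.
apply: eq_bigr => j jA2; move: (jA2); rewrite inE => /andP[jA1 jA].
by rewrite /tensor -/A2 !supported_shift // !mul1r !(@res_shift_out A1) // !(@res_shift_in A2) //; ring.
Qed.

End Tensor.

(** * Tensor-product frames on a ball whose centre has a gap *)

Section PartiallyInteracting.
Variables (R : realType) (N : nat) (A : {set 'I_N}) (lam : R) (v Uc : int -> R) (K : nat).
Hypotheses (K0 : (0 < K)%N) (hU : forall z : int, (K < `|z|)%N -> Uc z = 0).
Variables (b : pt N) (r : nat) (t : int).
Hypothesis gap : forall j, j \in A -> b j <= t - r%:Z \/ t + r%:Z + K%:Z < b j.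
Implicit Types (x y : pt N).

Definition leftpart x : {set 'I_N} := [set j in A | x j <= t].

Let sL x : leftpart x \subset A. Proof. by apply/fintype.subsetP => j; rewrite inE => /andP[]. Qed.

Let cntL x : cnt A (t + 1) x = (#|A| - #|leftpart x|)%N.
Proof.
rewrite -(cardsID (leftpart x) A) (finset.setIidPr (sL x)) addKn /cnt.
by apply: eq_card => j; rewrite !inE negb_and -ltNge; case: (j \in A) => //=; lia.
Qed.

(** Particles move by at most [r], so the gap of the centre leaves a window of width [K] empty
    throughout the ball. The count of [b] is constant across its gap, which fixes the number of
    particles on the left. *)
Let cube_sep x : x \in cube A b r ->
  (forall j, j \in A -> x j <= t \/ t + K%:Z < x j) /\ #|leftpart x| = #|leftpart b|.
Proof.
rewrite mem_cube => /andP[_ xb].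
have near j : j \in A -> x j <= t \/ t + K%:Z < x j.
  by move=> jA; have [i iA] := dst_near xb jA; have := gap iA; lia.
split=> //; move/dstP: xb => hd.
have [h1 _] := hd (t + 1); have [_ h2] := hd (t + 1 + r%:Z).
have gb : cnt A (t + 1 - r%:Z) b = cnt A (t + 1) b.
  by apply: eq_card => j; rewrite !inE; case: (boolP (j \in A)) => //= /gap; lia.
have gb' : cnt A (t + 1 + r%:Z) b = cnt A (t + 1) b.
  by apply: eq_card => j; rewrite !inE; case: (boolP (j \in A)) => //= /gap; lia.
rewrite gb in h1; rewrite gb' addrK in h2.
have := subset_leq_card (sL x); have := subset_leq_card (sL b).
by move: h1 h2; rewrite !cntL; lia.
Qed.

(** The ball is the disjoint union, over label sets [A1], of products of two smaller balls; this
    identifies the piece with left labels [A1]. *)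
Lemma cube_leftP (A1 : {set 'I_N}) (b' x : pt N) : A1 \subset A -> supported A x -> dst A b' b = 0%N ->
  {in A1, forall j, exists2 i, i \in leftpart b & b' j = b i} ->
  {in A :\: A1, forall j, exists2 i, i \in A :\: leftpart b & b' j = b i} ->
  (res A1 x \in cube A1 (res A1 b') r) && (res (A :\: A1) x \in cube (A :\: A1) (res (A :\: A1) b') r)
  = (x \in cube A b r) && (leftpart x == A1).
Proof.
move=> sA sx bb hL hR.
have bL : {in A1, forall j, b' j <= t - r%:Z}.
  by move=> j /hL[i]; rewrite inE => /andP[iA it] ->; have := gap iA; lia.
have bR : {in A :\: A1, forall j, t + r%:Z + K%:Z < b' j}.
  by move=> j /hR[i]; rewrite !inE => /andP[+ iA] ->; rewrite iA /= -ltNge => it; have := gap iA; lia.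
have dE (B : {set 'I_N}) : dst B (res B x) (res B b') = dst B x b'.
  by rewrite dst_resl dst_sym dst_resl dst_sym.
have xbE : dst A x b = dst A x b'.
  apply/eqP; rewrite eqn_leq; have := dst_tri A b' x b; have := dst_tri A b x b'.
  by rewrite (dst_sym A b b') bb !addn0 => -> ->.
rewrite !mem_cube !res_supported sx !dE /=.
apply/andP/andP => [[h1 h2]|[h /eqP eL]].
  split.
    by rewrite xbE (leq_trans (dst_split_le _ _ sA)) // geq_max h1.
  apply/eqP/setP => j; rewrite inE; case: (boolP (j \in A1)) => jA1.
    rewrite (fintype.subsetP sA _ jA1) /=; have [i iA] := dst_near h1 jA1.
    by have := bL _ iA; lia.
  case: (boolP (j \in A)) => //= jA; have jA2 : j \in A :\: A1 by rewrite inE jA1.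
  by have [i iA] := dst_near h2 jA2; have := bR _ iA; lia.
apply: (@dst_split_ge N A A1 x b' t r sA); first by rewrite -xbE.
  move=> j jA1; split; last by have := bL _ jA1; lia.
  by move: jA1; rewrite -eL inE => /andP[].
move=> j jA2; split; last by have := bR _ jA2; lia.
by move: jA2; rewrite -eL !inE => /andP[+ jA]; rewrite jA /= -ltNge.
Qed.

Lemma tensor_eigpair (A1 : {set 'I_N}) (b' : pt N) f1 f2 E1 E2 :
  A1 \subset A -> dst A b' b = 0%N ->
  {in A1, forall j, exists2 i, i \in leftpart b & b' j = b i} ->
  {in A :\: A1, forall j, exists2 i, i \in A :\: leftpart b & b' j = b i} ->
  eigpair A1 lam v Uc (cube A1 (res A1 b') r) f1 E1 ->
  eigpair (A :\: A1) lam v Uc (cube (A :\: A1) (res (A :\: A1) b') r) f2 E2 ->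
  eigpair A lam v Uc (cube A b r) (tensor A A1 f1 f2) (E1 + E2).
Proof.
move=> sA bb hL hR [z1 e1] [z2 e2].
have nz x : tensor A A1 f1 f2 x != 0 -> (x \in cube A b r) && (leftpart x == A1).
  rewrite /tensor; case: (boolP (supported A x)) => sx; last by rewrite mul0r eqxx.
  rewrite mul1r mulf_eq0 negb_or => /andP[n1 n2].
  rewrite -(@cube_leftP A1 b' x sA sx bb hL hR); apply/andP; split.
    by apply: contraNT n1 => /z1 ->.
  by apply: contraNT n2 => /z2 ->.
split=> x xD.
  by apply/eqP; apply: contraNT xD => /nz /andP[].
have sx : supported A x by move: xD; rewrite mem_cube => /andP[].
have [sep _] := cube_sep xD.
rewrite /Ham; have [eL|nL] := eqVneq (leftpart x) A1.
  have := @cube_leftP A1 b' x sA sx bb hL hR; rewrite xD eL eqxx => /andP[x1 x2].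
  rewrite (hop_tensor sA _ _ sx) (pot_split lam v sA hU); last first.
    move=> i j; rewrite -eL !inE => /andP[iA it] /andP[+ jA]; rewrite jA /= -ltNge => jt.
    by have := sep _ jA; lia.
  have := e1 _ x1; have := e2 _ x2; rewrite /Ham /tensor sx mul1r.
  move=> h2 h1; transitivity ((- hop A1 f1 (res A1 x) + pot A1 lam v Uc (res A1 x) * f1 (res A1 x)) * f2 (res (A :\: A1) x)
     + f1 (res A1 x) * (- hop (A :\: A1) f2 (res (A :\: A1) x) + pot (A :\: A1) lam v Uc (res (A :\: A1) x) * f2 (res (A :\: A1) x))).
    by ring.
  by rewrite h1 h2; ring.
have t0 : tensor A A1 f1 f2 x = 0.
  by apply/eqP; apply: contraNT nL => /nz /andP[].
rewrite t0 !mulr0 addr0 /hop big1 ?oppr0 // => j jA.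
(* A hop of one site cannot cross an empty window of positive width [K], so distinct pieces of the
   ball are not connected by the hopping term. *)
have hk (k : int) : (`|k| = 1)%N -> tensor A A1 f1 f2 (Defs.shift x j k) = 0.
  move=> k1; apply/eqP; apply: contraNT nL => /nz /andP[yD /eqP eL]; rewrite -eL; apply/eqP/setP => i.
  rewrite !inE; case: (boolP (i \in A)) => //= iA.
  have := sep _ iA; have [sepy _] := cube_sep yD; have := sepy _ iA; rewrite /Defs.shift ffunE.
  by case: eqP => [e|_]; lia.
by rewrite !hk ?addr0.
Qed.

(** The frame collects the tensor products over all label sets of the right cardinality, at most
    [2 ^ N] of them. Since the distance is at most the larger of the two cluster distances, one
    factor supplies the whole decay and the other is bounded by one. *)
Lemma partially_interacting_loc (th m : R) nb : 0 <= m ->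
  leftpart b != finset.set0 -> leftpart b != A ->
  (forall (A1 : {set 'I_N}) b', A1 \subset A -> A1 != finset.set0 -> A1 != A ->
     supported A b' -> dst A b' b = 0%N -> weak_loc A1 lam v Uc (res A1 b') r th m nb) ->
  weak_loc A lam v Uc b r th m (2 ^ N * (nb * nb)).
Proof.
move=> m0 L0 LA hsub.
have pick (A1 : {set 'I_N}) : exists q : pt N * (seq ((pt N -> R) * R) * seq ((pt N -> R) * R)),
   (A1 \subset A) && (#|A1| == #|leftpart b|) ->
  let b' := q.1 in let A2 := A :\: A1 in
  [/\ [/\ dst A b' b = 0%N, {in A1, forall j, exists2 i, i \in leftpart b & b' j = b i} &
    {in A2, forall j, exists2 i, i \in A :\: leftpart b & b' j = b i}],
    [/\ (size q.2.1 <= nb)%N, forall p, List.In p q.2.1 -> eigpair A1 lam v Uc (cube A1 (res A1 b') r) p.1 p.2,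
        complete (cube A1 (res A1 b') r) q.2.1 &
        forall p, List.In p q.2.1 -> exists x0, loc_at A1 (cube A1 (res A1 b') r) th m p.1 x0] &
    [/\ (size q.2.2 <= nb)%N, forall p, List.In p q.2.2 -> eigpair A2 lam v Uc (cube A2 (res A2 b') r) p.1 p.2,
        complete (cube A2 (res A2 b') r) q.2.2 &
        forall p, List.In p q.2.2 -> exists x0, loc_at A2 (cube A2 (res A2 b') r) th m p.1 x0]].
  case: (boolP ((A1 \subset A) && _)) => [/andP[sA /eqP cA]|_]; last by exists (b, ([::], [::])).
  have [b' [sb bb hL hR]] := relabel_exists b (sL b) sA (esym cA).
  have A10 : A1 != finset.set0 by rewrite -cards_eq0 cA cards_eq0.
  have A1A : A1 != A.
    by apply: contra LA => /eqP e; rewrite eqEcard sL -cA e /=.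
  have A20 : A :\: A1 != finset.set0.
    by rewrite finset.setD_eq0; apply: contra A1A => h; rewrite finset.eqEsubset sA.
  have A2A : A :\: A1 != A.
    apply: contra A10 => /eqP e; rewrite -finset.subset0; apply/fintype.subsetP => j jA.
    by have := fintype.subsetP sA _ jA; rewrite -e inE jA.
  have [B1 h1] := hsub A1 b' sA A10 A1A sb bb.
  have [B2 h2] := hsub (A :\: A1) b' (finset.subsetDl _ _) A20 A2A sb bb.
  by exists (b', (B1, B2)).
have [q hq] := choice pick; clear pick.
pose P := [seq A1 : {set 'I_N} <- enum {set 'I_N} | (A1 \subset A) && (#|A1| == #|leftpart b|)].
have PE (A1 : {set 'I_N}) : (A1 \in P) = (A1 \subset A) && (#|A1| == #|leftpart b|).
  by rewrite mem_filter mem_enum andbT.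
have PIn (A1 : {set 'I_N}) : List.In A1 P -> (A1 \subset A) && (#|A1| == #|leftpart b|).
  by move/In_mem; rewrite PE.
pose prods (A1 : {set 'I_N}) := List.flat_map (fun p1 : (pt N -> R) * R =>
  [seq (tensor A A1 p1.1 p2.1, p1.2 + p2.2) | p2 <- (q A1).2.2]) (q A1).2.1.
pose B := List.flat_map prods P.
have BIn p : List.In p B -> exists (A1 : {set 'I_N}) p1 p2, [/\ (A1 \subset A) && (#|A1| == #|leftpart b|),
    List.In p1 (q A1).2.1, List.In p2 (q A1).2.2 & p = (tensor A A1 p1.1 p2.1, p1.2 + p2.2)].
  move/List.in_flat_map => [A1 [/PIn hA1 /List.in_flat_map[p1 [h1 /List.in_map_iff[p2 [<- h2]]]]]].
  by exists A1, p1, p2.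
exists B; split.
- have sP : (size P <= 2 ^ N)%N.
    by rewrite size_filter (leq_trans (count_size _ _)) // -cardE -cardsT -powersetT card_powerset cardsT card_ord.
  apply: (@leq_trans (size P * (nb * nb))); last by rewrite leq_mul2r sP orbT.
  apply: size_flat_map_le => A1 /PIn hA1; have [_ [s1 _ _ _] [s2 _ _ _]] := hq A1 hA1.
  apply: (@leq_trans (size (q A1).2.1 * nb)); last by rewrite leq_mul2r s1 orbT.
  by apply: size_flat_map_le => p1 _; rewrite size_map.
- move=> p /BIn[A1 [p1 [p2 [hA1 h1 h2 ->]]]] /=.
  have [[bb hL hR] [_ e1 _ _] [_ e2 _ _]] := hq A1 hA1; case/andP: hA1 => sA _.
  exact: tensor_eigpair sA bb hL hR (e1 _ h1) (e2 _ h2).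
- move=> x y xD yD.
  have sx : supported A x by move: xD; rewrite mem_cube => /andP[].
  have sy : supported A y by move: yD; rewrite mem_cube => /andP[].
  have LP : leftpart x \in P by rewrite PE sL (proj2 (cube_sep xD)) eqxx.
  (* Only the tensor products whose labels are [leftpart x] can be non-zero at [x]. *)
  rewrite big_flat_map (eq_big_seq (fun A1 => (A1 == leftpart x)%:R * (x == y)%:R)).
    by rewrite sum_seq_pick ?LP // filter_uniq // enum_uniq.
  move=> A1; rewrite PE => hA1; have [[bb hL hR] [_ e1 c1 _] [_ e2 c2 _]] := hq A1 hA1.
  case/andP: hA1 => sA _.
  rewrite big_flat_map; under eq_bigr do (rewrite big_map; under eq_bigr do rewrite /= /tensor sx sy !mul1r).
  transitivity ((\sum_(p1 <- (q A1).2.1) p1.1 (res A1 x) * p1.1 (res A1 y)) *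
      (\sum_(p2 <- (q A1).2.2) p2.1 (res (A :\: A1) x) * p2.1 (res (A :\: A1) y))).
    rewrite mulr_suml; apply: eq_bigr => p1 _; rewrite mulr_sumr.
    by apply: eq_bigr => p2 _; ring.
  have cx := @cube_leftP A1 (q A1).1 x sA sx bb hL hR.
  have cy := @cube_leftP A1 (q A1).1 y sA sy bb hL hR.
  have vanish1 z : res A1 z \notin cube A1 (res A1 (q A1).1) r ->
      forall p, List.In p (q A1).2.1 -> p.1 (res A1 z) = 0.
    by move=> zD p /e1[h _]; exact: h.
  have vanish2 z : res (A :\: A1) z \notin cube (A :\: A1) (res (A :\: A1) (q A1).1) r ->
      forall p, List.In p (q A1).2.2 -> p.1 (res (A :\: A1) z) = 0.
    by move=> zD p /e2[h _]; exact: h.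
  have sum0 (s : seq ((pt N -> R) * R)) (h : (pt N -> R) * R -> R) (w : pt N) :
      (forall p, List.In p s -> p.1 w = 0 \/ h p = 0) -> \sum_(p <- s) p.1 w * h p = 0.
    elim: s => [|p s IH] hs; first by rewrite big_nil.
    rewrite big_cons IH; last by move=> p' hp'; apply: hs; right.
    by rewrite addr0; have [->|->] := hs p (or_introl erefl); rewrite ?mul0r ?mulr0.
  rewrite xD /= in cx; rewrite yD /= in cy.
  have [eA|nA] := eqVneq A1 (leftpart x); last first.
    rewrite mul0r; move: cx; rewrite eq_sym (negbTE nA) => /negbT; rewrite negb_and => /orP[h|h].
      by rewrite sum0 ?mul0r // => p hp; left; exact: vanish1 h p hp.
    by rewrite mulrC sum0 ?mul0r // => p hp; left; exact: vanish2 h p hp.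
  rewrite mul1r; move: cx; rewrite -eA eqxx => /andP[x1 x2].
  have [ey|ny] := eqVneq (leftpart y) A1.
    move: cy; rewrite ey eqxx => /andP[y1 y2].
    rewrite (c1 _ _ x1 y1) (c2 _ _ x2 y2) -natrM mulnb; congr (nat_of_bool _)%:R.
    apply/andP/eqP => [[/eqP/ffunP h1 /eqP/ffunP h2]|->]; last by rewrite !eqxx.
    apply/ffunP => j; case: (boolP (j \in A1)) => jA1.
      by have := h1 j; rewrite !resE jA1.
    case: (boolP (j \in A)) => jA; first by have := h2 j; rewrite !resE inE jA1 jA.
    by rewrite (supportedP _ _ sx) // (supportedP _ _ sy).
  have -> : (x == y) = false.
    by apply/eqP => exy; rewrite -exy -eA eqxx in ny.
  move: cy; rewrite (negbTE ny) => /negbT; rewrite negb_and => /orP[h|h].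
    by rewrite sum0 ?mul0r // => p hp; right; exact: vanish1 h p hp.
  by rewrite mulrC sum0 ?mul0r // => p hp; right; exact: vanish2 h p hp.
move=> p /BIn[A1 [p1 [p2 [hA1 h1 h2 ->]]]] /=.
have [[bb hL hR] [_ e1 c1 l1] [_ e2 c2 l2]] := hq A1 hA1; case/andP: hA1 => sA _.
have [x1 hx1] := l1 _ h1; have [x2 hx2] := l2 _ h2.
pose x0 : pt N := [ffun j => if j \in A1 then x1 j else x2 j].
have d1 y : dst A1 y x0 = dst A1 (res A1 y) x1.
  rewrite dst_resl dst_sym [RHS]dst_sym; apply: eq_cnt_dst => u; apply: eq_in_cnt => j jA.
  by rewrite ffunE jA.
have d2 y : dst (A :\: A1) y x0 = dst (A :\: A1) (res (A :\: A1) y) x2.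
  rewrite dst_resl dst_sym [RHS]dst_sym; apply: eq_cnt_dst => u; apply: eq_in_cnt => j.
  by rewrite inE => /andP[/negbTE jA _]; rewrite ffunE jA.
have le1 y : `|p1.1 (res A1 y)| <= 1.
  case: (boolP (res A1 y \in cube A1 (res A1 (q A1).1) r)) => hy; first exact: complete_le1 c1 h1 hy.
  by rewrite (proj1 (e1 _ h1) _ hy) normr0.
have le2 y : `|p2.1 (res (A :\: A1) y)| <= 1.
  case: (boolP (res (A :\: A1) y \in cube (A :\: A1) (res (A :\: A1) (q A1).1) r)) => hy.
    exact: complete_le1 c2 h2 hy.
  by rewrite (proj1 (e2 _ h2) _ hy) normr0.
exists x0 => y yD thd.
rewrite /tensor normrM [X in X * _ <= _](_ : _ = 1); last first.
  by move: yD; rewrite mem_cube => /andP[-> _]; rewrite normr1.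
rewrite mul1r normrM.
have dsp := dst_split_le y x0 sA; rewrite leq_max in dsp.
have fin (g : pt N -> R) (A' : {set 'I_N}) (D : seq (pt N)) w z :
    (forall x, x \notin D -> g x = 0) -> loc_at A' D th m g z -> (dst A y x0 <= dst A' w z)%N ->
    `|g w| <= expR (- m * (dst A y x0)%:R).
  move=> g0 lg hd; case: (boolP (w \in D)) => wD; last by rewrite g0 // normr0 expR_ge0.
  apply: le_trans (lg w wD _) _; first by rewrite (le_trans thd) // ler_nat.
  by rewrite ler_expR !mulNr lerN2 ler_wpM2l // ler_nat.
case/orP: dsp => hd.
  rewrite d1 in hd; apply: le_trans (_ : `|p1.1 (res A1 y)| * 1 <= _).
    by rewrite ler_wpM2l.
  by rewrite mulr1; apply: (fin _ _ _ _ _ (proj1 (e1 _ h1)) hx1 hd).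
rewrite d2 in hd; apply: le_trans (_ : 1 * `|p2.1 (res (A :\: A1) y)| <= _).
  by rewrite ler_wpM2r.
by rewrite mul1r; apply: (fin _ _ _ _ _ (proj1 (e2 _ h2)) hx2 hd).
Qed.

End PartiallyInteracting.

(** * The law of the potential *)

Definition potential (R : realType) := int -> R.
HB.instance Definition _ (R : realType) := gen_eqMixin (potential R).
HB.instance Definition _ (R : realType) := gen_choiceMixin (potential R).
HB.instance Definition _ (R : realType) := isPointed.Build (potential R) (fun=> 0).

Definition rect (R : realType) (s : seq int) (A : int -> set R) : set (potential R) :=
  [set v | forall u, u \in s -> A u (v u)].
Definition rectangles (R : realType) : set (set (potential R)) :=
  [set W | exists s A, (forall u, measurable (A u)) /\ W = rect s A].
(** The product sigma-algebra on real functions of the integers. Probabilities are estimated here,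
    where the law is determined by [rho] through its values on rectangles. *)
Definition env (R : realType) := g_sigma_algebraType (@rectangles R).
HB.instance Definition _ (R : realType) := Measurable.on (env R).

Section Environment.
Variable R : realType.
Implicit Types (s : seq int) (A : int -> set R) (S : pred int) (W : set (env R)).

Lemma rect_measurable s A : (forall u, measurable (A u)) -> measurable (rect s A : set (env R)).
Proof. by move=> mA; apply: sub_sigma_algebra; exists s, A. Qed.

Lemma rectangles_setI : setI_closed (@rectangles R).
Proof.
move=> _ _ [s [A [mA ->]]] [t [B [mB ->]]].
exists (s ++ t), (fun u => (if u \in s then A u else setT) `&` (if u \in t then B u else setT)).
split; first by move=> u; apply: measurableI; case: ifP.
apply/seteqP; split => v /=.
  by move=> [h1 h2] u _; split; case: ifP => // hu; [exact: h1|exact: h2].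
move=> h; split=> u hu; have := h u; rewrite mem_cat hu ?orbT => /(_ isT) [] //.
Qed.

Lemma rect_undup s A : rect (undup s) A = rect s A.
Proof. by apply/seteqP; split => v h u hu; apply: h; move: hu; rewrite mem_undup. Qed.

Lemma coord_measurable u : measurable_fun [set: env R] (fun v : env R => v u).
Proof.
move=> _ B mB; rewrite setTI (_ : _ @^-1` _ = rect [:: u] (fun=> B)).
  exact: rect_measurable.
by apply/seteqP; split => v /= h; [move=> w; rewrite inE => /eqP ->|apply: h; rewrite inE].
Qed.

Lemma measurable_to_env d (T : measurableType d) (f : T -> env R) :
  (forall u, measurable_fun [set: T] (fun x => f x u)) -> measurable_fun [set: T] f.
Proof.
move=> mf; refine (@measurability _ _ T (env R) setT f (@rectangles R) _ _) => //.
move=> _ [_ [s [A [mA ->]]] <-]; rewrite setTI.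
elim: s => [|u s IH].
  by rewrite [X in measurable X](_ : _ = setT) //; apply/seteqP; split=> // x _ u; rewrite in_nil.
rewrite [X in measurable X](_ : _ = ((fun x => f x u) @^-1` A u) `&` (f @^-1` rect s A)).
  by apply: measurableI => //; rewrite -[X in measurable X]setTI; exact: mf.
apply/seteqP; split=> x /=.
  by move=> h; split; [apply: h; rewrite mem_head|move=> w ws; apply: h; rewrite inE ws orbT].
by move=> [h1 h2] w; rewrite inE => /predU1P[->|/h2].
Qed.

Definition merge S (v w : env R) : env R := fun u => if S u then v u else w u.

Lemma merge_measurable S : measurable_fun setT (fun p : env R * env R => merge S p.1 p.2).
Proof.
apply: measurable_to_env => u; rewrite /merge; case: (S u).
  exact: (measurableT_comp (coord_measurable u) measurable_fst).
exact: (measurableT_comp (coord_measurable u) measurable_snd).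
Qed.

Definition depends S (W : set (env R)) : Prop :=
  forall v w : env R, (forall u, S u -> v u = w u) -> W v -> W w.

Lemma depends_sub S (S' : pred int) W : (forall u, S u -> S' u) -> depends S W -> depends S' W.
Proof. by move=> h dW v w e; apply: dW => u /h; exact: e. Qed.

Variables (mu : set R -> \bar R) (Q : probability (env R) R).
Hypothesis iidQ : forall s A, uniq s -> (forall u, measurable (A u)) ->
  Q (rect s A) = (\prod_(u <- s) mu (A u))%E.

(* Resampling the sites outside [S] independently does not change the law. *)
Lemma merge_law S W : measurable W ->
  (Q \x Q)%E ((fun p : env R * env R => merge S p.1 p.2) @^-1` W) = Q W.
Proof.
move=> mW; apply/esym.
pose m2 := measure_function_pushforward__canonical__measure_function_Measure
  (Q \x Q : {measure set (env R * env R) -> \bar R})%E (merge_measurable S).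
refine (@measure_unique _ R (env R) (@rectangles R) (fun=> setT) _ _ _ _ Q m2 _ _ W mW) => //.
- exact: rectangles_setI.
- by move=> _; exists [::], (fun=> setT); split=> //; apply/seteqP; split.
- by rewrite bigcup_const //; exists 0%N.
- move=> _ [s [A [mA ->]]]; rewrite /m2 /= /pushforward -rect_undup.
  set t := undup s; have ut : uniq t by exact: undup_uniq.
  rewrite [X in (Q \x Q)%E X](_ : _ = rect [seq u <- t | S u] A `*` rect [seq u <- t | ~~ S u] A).
    rewrite product_measure1E; [|exact: rect_measurable|exact: rect_measurable].
    rewrite iidQ //.
    transitivity ((\prod_(u <- [seq u <- t | S u]) mu (A u)) * (\prod_(u <- [seq u <- t | ~~ S u]) mu (A u)))%E.
      by rewrite !big_filter (bigID S).
    by congr (_ * _)%E; apply/esym/iidQ => //; exact: filter_uniq.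
  apply/seteqP; split => -[v w] /=.
    move=> h; split => u; rewrite mem_filter => /andP[Su us]; have := h _ us; rewrite /merge ?Su //.
    by rewrite (negbTE Su).
  by move=> [h1 h2] u us; rewrite /merge; case: ifP => Su; [apply: h1|apply: h2]; rewrite mem_filter Su.
- by move=> k; rewrite (le_lt_trans (probability_le1 _ _)) // ltry.
Qed.

(** Merging two independent copies along [S] preserves the law and turns the intersection into a
    product set. *)
Lemma independent_events S W1 W2 : measurable W1 -> measurable W2 ->
  depends S W1 -> depends (predC S) W2 -> Q (W1 `&` W2) = (Q W1 * Q W2)%E.
Proof.
move=> m1 m2 d1 d2; rewrite -(merge_law S); last exact: measurableI.
rewrite [X in (Q \x Q)%E X](_ : _ = W1 `*` W2); first exact: product_measure1E.
apply/seteqP; split => -[v w] /= [h1 h2]; split.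
- by apply: d1 h1 => u Su; rewrite /merge Su.
- by apply: d2 h2 => u /= Su; rewrite /merge (negbTE Su).
- by apply: d1 h1 => u Su; rewrite /merge Su.
- by apply: d2 h2 => u /= Su; rewrite /merge (negbTE Su).
Qed.

Definition shift_env (l : seq int) (c : R) (v : env R) : env R :=
  fun u => if u \in l then v u + c else v u.

Lemma shift_env_measurable l c : measurable_fun setT (shift_env l c).
Proof.
apply: measurable_to_env => u; rewrite /shift_env; case: (u \in l); last exact: coord_measurable.
exact: measurable_funD (coord_measurable u) (measurable_cst _).
Qed.



Section Shift.
Variables (c eps : R).
Hypothesis tv : forall B : set R, measurable B ->
  (mu B <= mu [set r : R | B (r + c)%R] + eps%:E)%E.
Hypothesis eps0 : 0 <= eps.

Let upd (s : int) (v : env R) (r : R) : env R := fun u => if u == s then r else v u.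

Let upd_measurable (s : int) v : measurable_fun setT (upd s v).
Proof.
apply: measurable_to_env => u; rewrite /upd; case: eqP => _; first exact: measurable_id.
exact: measurable_cst.
Qed.

Let slice (s : int) W v : measurable W ->
  Q (xsection ((fun p : env R * env R => merge (predC1 s) p.1 p.2) @^-1` W) v) = mu (upd s v @^-1` W).
Proof.
move=> mW; have mB : measurable (upd s v @^-1` W).
  by rewrite -[X in measurable X]setTI; exact: upd_measurable.
rewrite [X in Q X](_ : _ = rect [:: s] (fun=> upd s v @^-1` W)).
  by rewrite iidQ // big_seq1.
have e w : merge (predC1 s) v w = upd s v (w s).
  by apply/funext => u; rewrite /merge /upd /=; case: eqP => // ->.
apply/seteqP; split => w /=; rewrite xsectionE /= ?e.
  by move=> h u; rewrite inE => /eqP ->.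
by move=> h; apply: h; rewrite mem_head.
Qed.

(** Resampling the single site [s] writes both probabilities as averages of one-dimensional slices,
    and [tv] compares the slices. [shift_le] repeats this site by site. *)
Lemma shift1_le (s : int) W : measurable W -> (Q W <= Q (shift_env [:: s] c @^-1` W) + eps%:E)%E.
Proof.
move=> mW; have mW' : measurable (shift_env [:: s] c @^-1` W).
  by rewrite -[X in measurable X]setTI; exact: shift_env_measurable.
have mM : forall W, measurable W -> measurable ((fun p : env R * env R => merge (predC1 s) p.1 p.2) @^-1` W).
  by move=> V mV; rewrite -[X in measurable X]setTI; exact: merge_measurable.
rewrite -(merge_law (predC1 s) mW) -(merge_law (predC1 s) mW') /product_measure1.
have -> : eps%:E = (\int[Q]_x (eps%:E))%E.
  by rewrite integral_cst // -[LHS]mule1; congr (_ * _)%E; apply/esym; exact: (probability_setT Q).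
rewrite -ge0_integralD //; last first.
  by apply: measurable_fun_xsection; exact: mM.
apply: ge0_le_integral => //.
- by apply: measurable_fun_xsection; exact: mM.
- apply: emeasurable_funD; last exact: measurable_cst.
  by apply: measurable_fun_xsection; exact: mM.
move=> v _ /=; rewrite !slice //.
have mB : measurable (upd s v @^-1` W).
  by rewrite -[X in measurable X]setTI; exact: upd_measurable.
apply: le_trans (tv mB) _; rewrite leeD2r // le_eqVlt; apply/orP; left; apply/eqP; congr mu.
apply/seteqP; split => r /=; rewrite (_ : shift_env _ _ _ = upd s v (r + c)) //;
  by apply/funext => u; rewrite /shift_env /upd inE; case: eqP.
Qed.

Lemma shift_le l W : uniq l -> measurable W ->
  (Q W <= Q (shift_env l c @^-1` W) + ((size l)%:R * eps)%:E)%E.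
Proof.
elim: l W => [|s l IH] W /=.
  move=> _ mW; have -> : shift_env [::] c @^-1` W = W.
    by apply/seteqP; split => v /=; rewrite (_ : shift_env _ _ _ = v) //; apply/funext => u.
  by rewrite mul0r adde0.
move=> /andP[sl ul] mW; apply: le_trans (shift1_le s mW) _.
set W' := shift_env [:: s] c @^-1` W.
have mW' : measurable W' by rewrite -[X in measurable X]setTI; exact: shift_env_measurable.
have -> : shift_env (s :: l) c @^-1` W = shift_env l c @^-1` W'.
  apply/seteqP; split => v /=; rewrite (_ : shift_env (s :: l) c v = shift_env [:: s] c (shift_env l c v)) //;
  apply/funext => u; rewrite /shift_env !inE; case: (eqVneq u s) => [->|] //=; by rewrite (negbTE sl).
rewrite -addn1 natrD mulrDl mul1r EFinD addeA leeD2r // IH //.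
Qed.

End Shift.
End Environment.

(** * Translation estimate for the single-site density *)

Section Density.
Variables (R : realType) (rho : R -> R) (vmax : R).
Hypothesis hrho : admissible_density rho vmax.

Definition density_law (B : set R) : \bar R := (\int[lebesgue_measure]_(v in B) (rho v)%:E)%E.

Lemma density_ge0 v : 0 <= rho v.
Proof.
have [_ [out [[rmin [rmax [r0 [_ h]]]] _]]] := hrho.
have [v0|v0] := ltP v 0; first by rewrite out //; left.
have [v1|v1] := ltP vmax v; first by rewrite out //; right.
by have /andP[h1 _] := h v (introT andP (conj v0 v1)); exact: le_trans (ltW r0) h1.
Qed.

Lemma density_measurable : measurable_fun setT rho.
Proof.
have [vpos [out [_ [der _]]]] := hrho.
have -> : [set: R] = `]0, vmax[%classic `|` ([set 0] `|` ([set vmax] `|` ~` `[0, vmax]%classic)).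
  apply/esym/seteqP; split => // v _.
  case: (pselect (`[0, vmax]%classic v)) => [/=|h]; last by right; right; right.
  rewrite in_itv /= => /andP[h1 h2].
  have [e|n0] := eqVneq v 0; first by right; left.
  have [e|n1] := eqVneq v vmax; first by right; right; left.
  by left; rewrite /= in_itv /= !lt_neqAle h1 h2 eq_sym n0 n1.
have mC : measurable (~` `[0, vmax]%classic : set R) by apply: measurableC; exact: measurable_itv.
apply/measurable_funU; [exact: measurable_itv|by do !apply: measurableU|split].
  apply: open_continuous_measurable_fun; first exact: interval_open.
  move=> v; rewrite inE /= in_itv /= => hv; apply: differentiable_continuous.
  by apply/derivable1_diffP; exact: (proj1 (der v hv)).
apply/measurable_funU; [exact: measurable_set1|by apply: measurableU|split].
  exact: measurable_fun_set1.
apply/measurable_funU; [exact: measurable_set1|done|split].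
  exact: measurable_fun_set1.
have h0 : {in ~` `[0, vmax]%classic, (cst 0 : R -> R) =1 rho}.
  move=> v; rewrite inE /= in_itv /= => /negP; rewrite negb_and -!ltNge => /orP[h|h].
    by rewrite out //; left.
  by rewrite out //; right.
exact: eq_measurable_fun h0 (measurable_cst _).
Qed.

Lemma addr_measurable (c : R) : measurable_fun [set: R] (fun r : R => r + c).
Proof. by apply: measurable_funD; [exact: measurable_id|exact: measurable_cst]. Qed.

Lemma lebesgue_translation (c : R) (B : set R) : measurable B ->
  pushforward lebesgue_measure ((fun r => r + c) : R -> measurableTypeR R) B = lebesgue_measure B.
Proof.
move=> mB; apply/esym/lebesgue_measure_unique => //=.
  exact: addr_measurable.
move=> mf _ [[a b]] _ <-.
rewrite /pushforward (_ : _ @^-1` _ = `]a - c, b - c]%classic); last first.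
  by apply/seteqP; split => r /=; rewrite !in_itv /= ltrBlDr lerBrDr.
by rewrite !lebesgue_measure_itv /= !lte_fin ltrD2r; case: ifP => // _; congr (_%:E); ring.
Qed.

Lemma density_translation (c : R) (B : set R) : measurable B ->
  density_law [set r | B (r + c)%R] = (\int[lebesgue_measure]_(v in B) (rho (v - c))%:E)%E.
Proof.
move=> mB.
pose phi : R -> measurableTypeR R := fun r => r + c.
have mphi : measurable_fun setT phi.
  exact: addr_measurable.
transitivity (\int[pushforward lebesgue_measure phi]_(v in B) (rho (v - c))%:E)%E.
  rewrite ge0_integral_pushforward //.
  - by rewrite /density_law; apply: eq_integral => r _ /=; rewrite addrK.
  - apply/measurable_EFinP; apply: measurable_funTS.
    apply: (measurableT_comp density_measurable).
    exact: addr_measurable.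
  - by move=> y _; rewrite lee_fin density_ge0.
by apply: eq_measure_integral => A mA _; exact: lebesgue_translation.
Qed.

(** Translating the set amounts to translating the density. The pointwise excess of [rho] over its
    translate is linear in [c] inside the support, by the bound on the derivative, and bounded by
    [rmax] on a layer of length [c] at the left end. *)
Lemma density_shift : exists2 C, 0 <= C & forall c, 0 <= c -> forall B : set R, measurable B ->
  (density_law B <= density_law [set r | B (r + c)%R] + (C * c)%:E)%E.
Proof.
have [vpos [out [[rmin [rmax [r0 [rM hr]]]] [der [B0 hB0]]]]] := hrho.
pose D := Num.max B0 0.
have D0 : 0 <= D by rewrite le_max lexx orbT.
exists (D * vmax + rmax); first by rewrite addr_ge0 ?mulr_ge0 ?(ltW vpos) ?(ltW rM).
move=> c c0 B mB; rewrite density_translation //.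
(* The right endpoint is separated because differentiability is given only on the open interval;
   being a null set it costs nothing. *)
pose g r : R := D * c * \1_(`[0, vmax] : set R) r + rmax * \1_(`[0, c] : set R) r + rmax * \1_([set vmax] : set R) r.
have ind0 (E : set R) r : 0 <= \1_E r :> R by rewrite indicE; case: (_ \in _).
have Dc0 : 0 <= D * c by rewrite mulr_ge0.
have pw r : rho r <= rho (r - c) + g r.
  rewrite /g; have rc := density_ge0 (r - c).
  have z1 : 0 <= D * c * \1_(`[0, vmax] : set R) r by rewrite mulr_ge0.
  have z2 : 0 <= rmax * \1_(`[0, c] : set R) r by rewrite mulr_ge0 ?(ltW rM).
  have z3 : 0 <= rmax * \1_([set vmax] : set R) r by rewrite mulr_ge0 ?(ltW rM).
  have [v0|v0] := ltP r 0; first by rewrite out; [lra|left].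
  have [v1|v1] := ltP vmax r; first by rewrite out; [lra|right].
  have /andP[_ hle] := hr r (introT andP (conj v0 v1)).
  have [rlec|cltr] := leP r c.
    have e : \1_(`[0, c] : set R) r = 1 :> R by rewrite indicE mem_set //= in_itv /= v0.
    by move: z2; rewrite e mulr1; lra.
  have [e|n] := eqVneq r vmax.
    have e' : \1_([set vmax] : set R) r = 1 :> R by rewrite indicE mem_set.
    by move: z3; rewrite e' mulr1; lra.
  have e : \1_(`[0, vmax] : set R) r = 1 :> R by rewrite indicE mem_set //= in_itv /= v0.
  rewrite e mulr1.
  have [c00|cn] := eqVneq c 0; first by rewrite c00 subr0 mulr0; move: z2 z3; rewrite c00; lra.
  have cpos : 0 < c by rewrite lt_neqAle eq_sym cn.
  have rlt : r < vmax by rewrite lt_neqAle n.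
  have inside x : x \in `[r - c, r] -> 0 < x < vmax.
    by rewrite in_itv /= => /andP[h1 h2]; apply/andP; split; lra.
  have [|||x xI] := @MVT R rho (derive1 rho) (r - c) r.
  - by rewrite gtrBl.
  - move=> x xI; have /inside hx : x \in `[r - c, r] by apply: subset_itv_oo_cc.
    by rewrite derive1E; apply: derivableP; exact: (proj1 (der x hx)).
  - apply: derivable_within_continuous => x /inside hx; exact: (proj1 (der x hx)).
  rewrite opprB addrCA subrr addr0 => hx.
  have /inside hx' : x \in `[r - c, r] by apply: subset_itv_oo_cc.
  have := hB0 x hx'; have : B0 <= D by rewrite le_max lexx.
  move=> h1 h2; have h3 : derive1 rho x * c <= D * c.
    by rewrite ler_wpM2r //; apply: le_trans (ler_norm _) (le_trans h2 h1).
  by move: hx h3 z2 z3; lra.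
have mrc : measurable_fun [set: R] (fun r : R => rho (r - c)).
  apply: (measurableT_comp density_measurable).
  exact: addr_measurable.
have mI (k : R) (E : set R) : measurable E -> measurable_fun [set: R] (fun r : R => k * \1_E r).
  move=> mE; apply: measurable_funM; first exact: measurable_cst.
  exact: measurable_indic.
have g0 r : 0 <= g r by rewrite /g !addr_ge0 ?mulr_ge0 ?(ltW rM).
have m1 := mI (D * c) `[0, vmax]%classic (measurable_itv _).
have m2 := mI rmax `[0, c]%classic (measurable_itv _).
have m3 := mI rmax [set vmax] (measurable_set1 _).
have m12 := measurable_funD m1 m2.
have mg : measurable_fun setT g by exact: (measurable_funD m12 m3).
apply: (@le_trans _ _ (\int[lebesgue_measure]_(v in B) ((rho (v - c))%:E + (g v)%:E))%E).
  apply: ge0_le_integral => //.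
  - by move=> r _; rewrite lee_fin density_ge0.
  - by apply/measurable_EFinP; exact: measurable_funTS density_measurable.
  - by apply/measurable_EFinP; apply: measurable_funTS; exact: measurable_funD.
  - by move=> r _; rewrite -EFinD lee_fin.
rewrite ge0_integralD //; last 4 first.
- by move=> r _; rewrite lee_fin density_ge0.
- by apply/measurable_EFinP; exact: measurable_funTS.
- by move=> r _; rewrite lee_fin.
- by apply/measurable_EFinP; exact: measurable_funTS.
rewrite leeD2l //.
have piece (k : R) (E : set R) : 0 <= k -> measurable E ->
    (\int[lebesgue_measure]_(v in B) (k * \1_E v)%:E <= k%:E * lebesgue_measure E)%E.
  move=> k0 mE.
  have f0 r : B r -> (0 <= (\1_E r : R)%:E)%E by rewrite lee_fin.
  have fm : measurable_fun B (fun r : R => (\1_E r : R)%:E).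
    by apply/measurable_EFinP; apply: measurable_funTS; exact: measurable_indic.
  have -> : (\int[lebesgue_measure]_(v in B) (k * \1_E v)%:E = k%:E * \int[lebesgue_measure]_(v in B) (\1_E v)%:E)%E.
    exact: (ge0_integralZl_EFin lebesgue_measure mB f0 fm k0).
  rewrite integral_indic // lee_wpmul2l ?lee_fin //.
  by rewrite le_measure // inE //; exact: measurableI.
rewrite /g; under eq_integral do rewrite !EFinD.
have mT f : measurable_fun setT f -> measurable_fun B (EFin \o f : R -> \bar R).
  by move=> mf; apply/measurable_EFinP; exact: measurable_funTS.
rewrite ge0_integralD //; last 4 first.
- by move=> r _; rewrite -EFinD lee_fin addr_ge0 ?mulr_ge0 ?(ltW rM).
- exact: (mT _ m12).
- by move=> r _; rewrite lee_fin mulr_ge0 ?(ltW rM).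
- exact: (mT _ m3).
rewrite ge0_integralD //; last 4 first.
- by move=> r _; rewrite lee_fin mulr_ge0 ?(ltW rM).
- exact: (mT _ m1).
- by move=> r _; rewrite lee_fin mulr_ge0 ?(ltW rM).
- exact: (mT _ m2).
have p1 := piece (D * c) `[0, vmax]%classic Dc0 (measurable_itv _).
have p2 := piece rmax `[0, c]%classic (ltW rM) (measurable_itv _).
have p3 := piece rmax [set vmax] (ltW rM) (measurable_set1 _).
have q1 : lebesgue_measure ([set` `[0%R, vmax]%R] : set R) = vmax%:E.
  by rewrite lebesgue_measure_itv /= lte_fin vpos oppr0 addr0.
have q2 : (lebesgue_measure ([set` `[0%R, c]%R] : set R) <= c%:E)%E.
  by rewrite lebesgue_measure_itv /= lte_fin; case: ifP => _; rewrite ?oppr0 ?addr0 ?lee_fin.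
rewrite lebesgue_measure_set1 mule0 in p3; rewrite q1 in p1.
have p2' := le_trans p2 (lee_wpmul2l (ltac:(by rewrite lee_fin (ltW rM)) : (0 <= rmax%:E)%E) q2).
apply: le_trans (leeD (leeD p1 p2') p3) _.
by rewrite adde0 -!EFinM -EFinD lee_fin; lra.
Qed.

End Density.

(** The pushforward along the potential. Estimates valid for every [Q] with the product formula hold
    for all probability spaces with the same constants. *)
Lemma iid_law (R : realType) (rho : R -> R) (d : measure_display) (Omega : measurableType d)
  (P : probability Omega R) (Vr : int -> Omega -> R) : iid_potential P Vr rho ->
  exists Q : probability (env R) R,
    (forall s A, uniq s -> (forall u, measurable (A u)) ->
       Q (rect s A) = (\prod_(u <- s) density_law rho (A u))%E) /\
    (forall W : set (env R), measurable W ->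
       measurable [set w | W (fun u => Vr u w)] /\ P [set w | W (fun u => Vr u w)] = Q W).
Proof.
move=> [mV [dV iV]].
have mX : measurable_fun setT ((fun w u => Vr u w) : Omega -> env R).
  by apply: measurable_to_env => u; exact: mV.
pose X : {mfun Omega >-> env R} := HB.pack ((fun w u => Vr u w) : Omega -> env R)
  (isMeasurableFun.Build _ _ _ _ _ mX).
exists (distribution P X); split.
  move=> s A us mA; transitivity (\prod_(u <- s) P (Vr u @^-1` A u))%E.
    rewrite -(iV s A us mA); apply: (congr1 P).
    by apply/seteqP; split.
  by apply: eq_bigr => u _; rewrite dV.
move=> W mW; split=> //; rewrite -[X in measurable X]setTI; exact (mX measurableT _ mW).
Qed.

(** * Wegner estimate for separated pairs *)

Section NearKernel.
Variables (R : realType) (T : finType).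

Lemma sum_sqr_le_l1 (a : T -> R) : \sum_p a p ^+ 2 <= (\sum_p `|a p|) ^+ 2.
Proof.
rewrite [leRHS]expr2 mulr_suml; apply: ler_sum => p _.
rewrite -real_normK ?num_real // expr2 ler_wpM2l // (bigD1 p) //= lerDl.
by apply: sumr_ge0.
Qed.

Lemma l1_sqr_le (a : T -> R) : (\sum_p `|a p|) ^+ 2 <= #|T|%:R * \sum_p a p ^+ 2.
Proof.
have e : (\sum_p `|a p|) ^+ 2 = \sum_p \sum_q `|a p| * `|a q|.
  by rewrite expr2 mulr_suml; apply: eq_bigr => p _; rewrite mulr_sumr.
have e2 : #|T|%:R * \sum_p a p ^+ 2 = \sum_p \sum_q (a p ^+ 2 + a q ^+ 2) / 2.
  under [RHS]eq_bigr do rewrite -mulr_suml big_split /= sumr_const -[_ *+ #|_|]mulr_natl.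
  rewrite -mulr_suml big_split /= -mulr_sumr sumr_const -[(\sum_(i in T) _) *+ _]mulr_natl.
  by field.
rewrite e e2; apply: ler_sum => p _; apply: ler_sum => q _.
rewrite -[a p ^+ 2]real_normK ?num_real // -[a q ^+ 2]real_normK ?num_real //.
by have := sqr_ge0 (`|a p| - `|a q|); lra.
Qed.

Lemma spectral_lower_bound (K : T -> T -> R) (xi : R) (e : T -> T -> R) (nu : T -> R) (t : R) :
  0 <= xi -> (forall x y, \sum_k e k x * e k y = (x == y)%:R) ->
  (forall k x, \sum_y K x y * e k y = nu k * e k x) -> (forall x y, K x y = K y x) ->
  (forall k, xi <= `|nu k + t|) ->
  forall w : T -> R, xi ^+ 2 * \sum_p w p ^+ 2 <= \sum_p (\sum_q K p q * w q + t * w p) ^+ 2.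
Proof.
move=> xi0 comp eig symK far w.
have parseval (z : T -> R) : \sum_p z p ^+ 2 = \sum_k (\sum_p e k p * z p) ^+ 2.
  transitivity (\sum_p \sum_q (p == q)%:R * (z p * z q)).
    apply: eq_bigr => p _; rewrite (bigD1 p) //= eqxx mul1r big1 ?addr0 ?expr2 // => q /negbTE.
    by rewrite eq_sym => ->; rewrite mul0r.
  transitivity (\sum_p \sum_q \sum_k (e k p * z p) * (e k q * z q)).
    apply: eq_bigr => p _; apply: eq_bigr => q _; rewrite -comp mulr_suml.
    by apply: eq_bigr => k _; ring.
  under eq_bigr do rewrite exchange_big /=.
  rewrite exchange_big /=; apply: eq_bigr => k _; rewrite expr2 mulr_suml.
  by apply: eq_bigr => p _; rewrite mulr_sumr.
rewrite (parseval w) [leRHS]parseval mulr_sumr; apply: ler_sum => k _.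
have -> : \sum_p e k p * (\sum_q K p q * w q + t * w p) = (nu k + t) * \sum_p e k p * w p.
  under eq_bigr do rewrite mulrDr mulr_sumr.
  rewrite big_split /= exchange_big /= mulrDl !mulr_sumr; congr (_ + _).
    apply: eq_bigr => q _; rewrite mulrA -eig mulr_suml; apply: eq_bigr => p _.
    by rewrite (symK p q); ring.
  by apply: eq_bigr => p _; ring.
rewrite exprMn ler_wpM2r ?sqr_ge0 // -[leRHS]real_normK ?num_real //.
by rewrite ler_pXn2r ?nnegrE // far.
Qed.

(* Every eigenvalue of M + t lam D increases at rate at least lam in t, hence
   crosses the window (-eta, eta) at most once per step of length h. *)
Lemma near_kernel_count (M : T -> T -> R) (D : T -> R) (eta lam h : R) (J : nat) :
  (forall p q, M p q = M q p) -> (forall p, 1 <= D p) -> 0 < lam -> 0 < eta ->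
  2 * #|T|%:R * eta <= lam * h ->
  (#|finset (fun j : 'I_J => `[< exists g : T -> R,
     (\sum_p `| \sum_q M p q * g q + lam * (j%:R * h) * D p * g p| < eta * \sum_p `|g p|)%R >])|
    <= #|T|)%N.
Proof.
move=> symM D1 lam0 eta0 hh; set S := finset _.
have D0 p : 0 < D p by exact: lt_le_trans (D1 p).
(* Conjugation by the inverse square root of [D] turns the pencil into [K] plus a multiple of the
   identity, with one eigenbasis for all [t]. As [D] is at least one, this conjugation does not
   enlarge residuals. *)
pose s p := Num.sqrt (D p).
have s0 p : 0 < s p by rewrite sqrtr_gt0.
have ss p : s p * s p = D p by rewrite -expr2 sqr_sqrtr // ltW.
have s1 p : 1 <= s p.
  by rewrite -[leLHS]sqrtr1 ler_sqrt ?D1 // ltW.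
pose K p q := M p q / (s p * s q).
have symK p q : K p q = K q p by rewrite /K symM (mulrC (s p)).
have [e [nu [_ comp eig]]] := spectral_finType symK.
(* The factor [#|T|] covers the passage from the summed absolute values of the hypothesis to the
   Euclidean norm of the spectral bound. *)
pose xi := #|T|%:R * eta.
have xi0 : 0 <= xi by rewrite mulr_ge0 ?ler0n ?ltW.
have hit (j : 'I_J) : j \in S -> exists k, `|nu k + lam * (j%:R * h)| < xi.
  rewrite inE => /asboolP[g hg]; apply: contrapT => hno.
  have far k : xi <= `|nu k + lam * (j%:R * h)|.
    by rewrite leNgt; apply/negP => lt; apply: hno; exists k.
  set t := lam * (j%:R * h) in hg far.
  pose w p := s p * g p.
  have hK p : \sum_q K p q * w q + t * w p = (s p)^-1 * (\sum_q M p q * g q + t * D p * g p).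
    rewrite mulrDr mulr_sumr; congr (_ + _).
      by apply: eq_bigr => q _; rewrite /K /w; field; rewrite !gt_eqF.
    by rewrite /w -ss; field; rewrite gt_eqF.
  have low := spectral_lower_bound xi0 comp eig symK far w.
  have upper : \sum_p (\sum_q K p q * w q + t * w p) ^+ 2 <=
      \sum_p (\sum_q M p q * g q + t * D p * g p) ^+ 2.
    apply: ler_sum => p _; rewrite hK exprMn ler_piMl ?sqr_ge0 //.
    by rewrite exprVn invf_le1 ?exprn_gt0 // -[leLHS](expr1n _ 2) ler_pXn2r ?nnegrE ?(ltW (s0 p)).
  have gw : \sum_p g p ^+ 2 <= \sum_p w p ^+ 2.
    apply: ler_sum => p _; rewrite /w exprMn ler_peMl ?sqr_ge0 //.
    by rewrite -[leLHS](expr1n _ 2) ler_pXn2r ?nnegrE ?(ltW (s0 p)).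
  have l1 := sum_sqr_le_l1 (fun p => \sum_q M p q * g q + t * D p * g p).
  have lt2 : (\sum_p `| \sum_q M p q * g q + t * D p * g p|) ^+ 2 < (eta * \sum_p `|g p|) ^+ 2.
    by rewrite ltr_pXn2r ?nnegrE ?sumr_ge0 // mulr_ge0 ?(ltW eta0) ?sumr_ge0.
  have cs := l1_sqr_le g.
  have g2 : 0 <= \sum_p g p ^+ 2 by apply: sumr_ge0 => p _; exact: sqr_ge0.
  have T1 : 1 <= #|T|%:R :> R.
    rewrite ler1n lt0n; apply/eqP => T0; move: hg.
    have noT p : p \in T -> False by move=> pT; have := card0_eq T0 p; rewrite pT.
    by rewrite !big1 ?mulr0 ?ltxx // => p pT; case: (noT p).
  have c1 : (eta * \sum_p `|g p|) ^+ 2 <= xi ^+ 2 * \sum_p g p ^+ 2.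
    rewrite exprMn; apply: le_trans (ler_wpM2l (sqr_ge0 eta) cs) _.
    rewrite /xi exprMn [leRHS](_ : _ = eta ^+ 2 * (#|T|%:R ^+ 2 * \sum_p g p ^+ 2)); last by ring.
    by rewrite ler_wpM2l ?sqr_ge0 // ler_wpM2r // expr2 ler_peMl // (le_trans ler01).
  have c2 : xi ^+ 2 * \sum_p g p ^+ 2 <= xi ^+ 2 * \sum_p w p ^+ 2 by rewrite ler_wpM2l ?sqr_ge0.
  by have := le_trans c2 (le_trans low (le_trans upper l1)); move: (lt_le_trans lt2 c1); lra.
have [T0|[k0 _]] : T =i pred0 \/ exists k0 : T, true.
  have [[k0 _]|no] := pselect (exists k0 : T, true); first by right; exists k0.
  by left => k; case: no; exists k.
  suff -> : S = finset.set0 by rewrite cards0.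
  by apply/setP => j; rewrite [RHS]inE; apply/negP => /hit[k _]; have := T0 k; rewrite inE.
have [f hf] : {f : 'I_J -> T & forall j, j \in S -> `|nu (f j) + lam * (j%:R * h)| < xi}.
  apply: (@choice _ _ (fun (j : 'I_J) k => j \in S -> `|nu k + lam * (j%:R * h)| < xi)) => j.
  by case: (boolP (j \in S)) => [/hit[k hk]|_]; [exists k|exists k0].
rewrite -(card_in_imset (f := f)) ?max_card // => i j iS jS fij.
have hi := hf i iS; have hj := hf j jS; rewrite fij in hi.
(* One step moves an eigenvalue by at least the width of the window, so two hits by the same
   eigenvalue must be the same step. *)
have lh : 2 * xi <= lam * h by rewrite /xi mulrA.
have : lam * h * `|i%:R - j%:R| < lam * h.
  rewrite [ltLHS](_ : _ = `|(nu (f j) + lam * (i%:R * h)) - (nu (f j) + lam * (j%:R * h))|); last first.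
    rewrite [X in _ = `|X|](_ : _ = lam * h * (i%:R - j%:R)); last by ring.
    by rewrite normrM [X in _ = X * _]ger0_norm // (le_trans _ lh) // mulr_ge0.
  apply: le_lt_trans (ler_normB _ _) _; apply: lt_le_trans lh; lra.
move=> lt; have lhpos : 0 < lam * h.
  have lh0 : 0 <= lam * h by apply: le_trans lh; rewrite mulr_ge0.
  rewrite lt0r lh0 andbT; apply/eqP => e0.
  by rewrite e0 mul0r ltxx in lt.
move: lt; rewrite -[ltRHS]mulr1 ltr_pM2l // => lt.
apply/val_inj/eqP; rewrite eqn_leq; apply/andP; split; rewrite leqNgt; apply/negP => lt'.
  have : 1 <= `|i%:R - j%:R| :> R.
    by rewrite ger0_norm ?subr_ge0 ?ler_nat ?(ltnW lt') // lerBrDr addrC natr1 ler_nat.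
  by rewrite leNgt lt.
have : 1 <= `|i%:R - j%:R| :> R.
  rewrite distrC ger0_norm ?subr_ge0 ?ler_nat ?(ltnW lt') // lerBrDr addrC natr1 ler_nat //.
by rewrite leNgt lt.
Qed.

(* Restricting to rational vectors makes the resonance event a countable union. *)
Lemma rational_near_kernel (M : T -> T -> R) (eta : R) (g : T -> R) : 0 < eta ->
  \sum_p `|\sum_q M p q * g q| < eta * \sum_p `|g p| ->
  exists g' : {ffun T -> rat},
    \sum_p `|\sum_q M p q * ratr (g' q)| < eta * \sum_p `|ratr (g' p)|.
Proof.
move=> eta0 hg; set gap := eta * \sum_p `|g p| - \sum_p `|\sum_q M p q * g q|.
have gap0 : 0 < gap by rewrite subr_gt0.
pose K := \sum_p \sum_q `|M p q| + eta * #|T|%:R + 1.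
have K0 : 0 < K.
  by rewrite ltr_pwDr // addr_ge0 ?mulr_ge0 ?(ltW eta0) ?sumr_ge0 // => p _; apply: sumr_ge0.
pose eps := gap / K.
have eps0 : 0 < eps by rewrite divr_gt0.
have approx (p : T) : exists a : rat, `|ratr a - g p| < eps.
  have [a] := @rat_in_itvoo R (g p - eps) (g p + eps) ltac:(lra).
  by rewrite in_itv /= => /andP[h1 h2]; exists a; rewrite ltr_norml; apply/andP; split; lra.
have [a ha] := choice approx; exists [ffun p => a p].
under eq_bigr do under eq_bigr do rewrite ffunE.
under [X in _ < _ * X]eq_bigr do rewrite ffunE.
have l1 : \sum_p `|\sum_q M p q * ratr (a q)| <=
    \sum_p `|\sum_q M p q * g q| + (\sum_p \sum_q `|M p q|) * eps.
  rewrite mulr_suml -big_split /=; apply: ler_sum => p _.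
  rewrite [X in `|X|](_ : _ = \sum_q M p q * g q + \sum_q M p q * (ratr (a q) - g q)).
    apply: le_trans (ler_normD _ _) _; rewrite lerD2l (le_trans (ler_norm_sum _ _ _)) //.
    by rewrite mulr_suml; apply: ler_sum => q _; rewrite normrM ler_wpM2l // ltW.
  by rewrite -big_split /=; apply: eq_bigr => q _; ring.
have l2 : \sum_p `|g p| <= \sum_p `|ratr (a p) : R| + #|T|%:R * eps.
  rewrite mulr_natl -sumr_const -big_split /=; apply: ler_sum => p _.
  have := ha p; have := ler_normD (ratr (a p)) (g p - ratr (a p)).
  by rewrite addrCA subrr addr0 (distrC (g p)); lra.
have l3 : eta * \sum_p `|g p| <= eta * (\sum_p `|ratr (a p) : R| + #|T|%:R * eps).
  by rewrite ler_wpM2l // ltW.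
have Keps : K * eps = gap by rewrite /eps mulrC divfK // gt_eqF.
move: Keps; rewrite /K /gap !mulrDl mul1r mulrDr mulrA in l3 *.
by move: l1 l3 eps0; lra.
Qed.

End NearKernel.

Definition sites N (A : {set 'I_N}) (X : seq (pt N)) : pred int :=
  fun u => has (fun x : pt N => [exists j, (j \in A) && (x j == u)]) X.

Lemma sitesP N (A : {set 'I_N}) (X : seq (pt N)) x j : x \in X -> j \in A -> sites A X (x j).
Proof. by move=> xX jA; apply/hasP; exists x => //; apply/existsP; exists j; rewrite jA eqxx. Qed.

(** * The probability that two domains separated by a cut resonate *)

Section Wegner.
Variables (R : realType) (mu : set R -> \bar R) (Q : probability (env R) R).
Hypothesis iidQ : forall s A, uniq s -> (forall u, measurable (A u)) ->
  Q (rect s A) = (\prod_(u <- s) mu (A u))%E.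
Variable (C : R).
Hypothesis C0 : 0 <= C.
Hypothesis tv : forall c : R, 0 <= c -> forall B : set R, measurable B ->
  (mu B <= mu [set r : R | B (r + c)%R] + (C * c)%:E)%E.

(** The sum is the expected number of events that occur. *)
Lemma multiplicity_bound (W : nat -> set (env R)) (J n : nat) :
  (forall j, measurable (W j)) ->
  (forall v, (#|finset (fun j : 'I_J => `[< W j v >])| <= n)%N) ->
  (\sum_(j < J) Q (W j) <= n%:R%:E)%E.
Proof.
move=> mW hW.
have -> : (\sum_(j < J) Q (W j) = \int[Q]_v (\sum_(j < J) (\1_(W j) v)%:E))%E.
  rewrite ge0_integral_sum //; last by move=> j; apply/measurable_EFinP; exact: measurable_indic.
  by apply: eq_bigr => j _; rewrite integral_indic // setIT.
apply: (@le_trans _ _ (\int[Q]_v (n%:R%:E))%E).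
  apply: ge0_le_integral => //.
  - by move=> v _; apply: sume_ge0 => j _; rewrite lee_fin.
  - by apply: emeasurable_sum => j; apply/measurable_EFinP; exact: measurable_indic.
  - move=> v _; rewrite sumEFin lee_fin; apply: le_trans (_ : (#|finset (fun j : 'I_J => `[< W j v >])|)%:R <= _).
      rewrite -sum1_card natr_sum [leRHS]big_mkcond /=; apply: ler_sum => j _.
      rewrite indicE inE; have [h|h] := asboolP (W j v); first by rewrite mem_set.
      by rewrite memNset.
    by rewrite ler_nat.
rewrite integral_cst // -[leRHS]mule1 lee_wpmul2l ?lee_fin //.
by rewrite le_eqVlt; apply/orP; left; apply/eqP; exact: (probability_setT Q).
Qed.

Section Pair.
Variables (N : nat) (A : {set 'I_N}) (lam : R) (Uc : int -> R) (X1 X2 : seq (pt N)) (u0 : int).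
Variable (eta : R).
Hypotheses (lam0 : 0 < lam) (eta0 : 0 < eta) (uX1 : uniq X1) (uX2 : uniq X2).
Hypothesis cut : forall x y, x \in X1 -> y \in X2 -> (cnt A u0 y < cnt A u0 x)%N.

Let T := ('I_(size X1) * 'I_(size X2))%type.
Let x1 i := tnth (in_tuple X1) i.
Let x2 j := tnth (in_tuple X2) j.
(** The difference of the Hamiltonian of [X1] tensored with the identity and the identity tensored
    with that of [X2]: its eigenvalues are the differences [E1 - E2], so a resonance is an
    approximate kernel vector. The cut makes it increase at speed at least [lam] under the shift. *)
Let M (v : env R) (p q : T) : R :=
  (q.2 == p.2)%:R * Hker A lam v Uc (x1 p.1) (x1 q.1)
  - (q.1 == p.1)%:R * Hker A lam v Uc (x2 p.2) (x2 q.2).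
Let W : set (env R) := [set v | exists g : {ffun T -> rat},
  \sum_p `|\sum_q M v p q * ratr (g q)| < eta * \sum_p `|ratr (g p)|].
Let ev (p : pt N * 'I_N) : int := p.1 p.2.
Let l := undup [seq ev p | p <- [seq (x, j) | x <- X1 ++ X2, j <- enum A] & u0 <= ev p].

Let M_sym v p q : M v p q = M v q p.
Proof. by rewrite /M !(eq_sym q.2) !(eq_sym q.1) (Hker_sym _ _ _ _ (x1 p.1)) (Hker_sym _ _ _ _ (x2 p.2)). Qed.

Let pot_measurable x : measurable_fun [set: env R] (fun v : env R => pot A lam v Uc x).
Proof.
apply: measurable_funD; last exact: measurable_cst.
apply: measurable_funM; first exact: measurable_cst.
rewrite (_ : (fun v : env R => _) = (fun v : env R => \sum_(j <- enum A) v (x j))).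
  by apply: measurable_sum => j; exact: coord_measurable.
by apply/funext => v; rewrite big_enum.
Qed.

Let M_measurable p q : measurable_fun [set: env R] (fun v => M v p q).
Proof.
have mH x y : measurable_fun [set: env R] (fun v : env R => Hker A lam v Uc x y).
  apply: measurable_funD; first exact: measurable_cst.
  by apply: measurable_funM; [exact: measurable_cst|exact: pot_measurable].
apply: measurable_funB.
  by apply: measurable_funM; [exact: measurable_cst|exact: mH].
by apply: measurable_funM; [exact: measurable_cst|exact: mH].
Qed.

Let W_measurable : measurable W.
Proof.
rewrite (_ : W = \bigcup_(g : {ffun T -> rat})
  [set v | (\sum_p `|\sum_q M v p q * ratr (g q)| < eta * \sum_p `|ratr (g p)|) = true]); last first.
  by apply/seteqP; split => v /=; [move=> [g hg]; exists g|move=> [g _ hg]; exists g].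
apply: countable_bigcupT_measurable; first exact: countableP.
move=> g; rewrite -[X in measurable X]setTI.
have mf : measurable_fun [set: env R] (fun v => \sum_p `|\sum_q M v p q * ratr (g q)|).
  apply: measurable_sum => p; apply: measurableT_comp => //.
  apply: measurable_sum => q; apply: measurable_funM; last exact: measurable_cst.
  exact: M_measurable.
have mc : measurable_fun [set: env R] (fun=> eta * \sum_p `|ratr (g p) : R|) by exact: measurable_cst.
have mt : measurable [set true] by [].
exact: (measurable_fun_ltr mf mc measurableT mt).
Qed.

Let pot_eq (v w : env R) x : x \in X1 ++ X2 -> (forall u, sites A (X1 ++ X2) u -> v u = w u) ->
  pot A lam v Uc x = pot A lam w Uc x.
Proof.
by move=> xX e; rewrite /pot; congr (_ * _ + _); apply: eq_bigr => j jA; apply: e; exact: sitesP.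
Qed.

Let x1X i : x1 i \in X1 ++ X2. Proof. by rewrite mem_cat mem_tnth. Qed.
Let x2X j : x2 j \in X1 ++ X2. Proof. by rewrite mem_cat mem_tnth orbT. Qed.

Let W_depends : depends (sites A (X1 ++ X2)) W.
Proof.
move=> v w e [g hg]; exists g; move: hg.
have eM p q : M v p q = M w p q.
  by rewrite /M /Hker (pot_eq (x1X p.1) e) (pot_eq (x2X p.2) e).
by under eq_bigr do under eq_bigr do rewrite eM.
Qed.

Let tensor_eig v f1 f2 E1 E2 p : eigpair A lam v Uc X1 f1 E1 -> eigpair A lam v Uc X2 f2 E2 ->
  \sum_q M v p q * (f1 (x1 q.1) * f2 (x2 q.2)) = (E1 - E2) * (f1 (x1 p.1) * f2 (x2 p.2)).
Proof.
move=> [z1 e1] [z2 e2]; case: p => i j /=.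
rewrite -(pair_bigA _ (fun i' j' => M v (i, j) (i', j') * (f1 (x1 i') * f2 (x2 j')))) /=.
under eq_bigr do under eq_bigr do rewrite /M /= mulrBl.
under eq_bigr do rewrite sumrB.
rewrite sumrB mulrBl; congr (_ - _).
  transitivity (\sum_i' Hker A lam v Uc (x1 i) (x1 i') * f1 (x1 i') * f2 (x2 j)).
    apply: eq_bigr => i' _; rewrite (bigD1 j) //= eqxx mul1r big1 ?addr0 ?mulrA // => j' /negbTE ->.
    by rewrite !mul0r.
  by rewrite -mulr_suml mulrA -(e1 (x1 i)) ?mem_tnth // (HamE _ _ _ _ _ uX1 z1) [in RHS]big_tnth.
rewrite exchange_big /=.
transitivity (\sum_j' Hker A lam v Uc (x2 j) (x2 j') * f2 (x2 j') * f1 (x1 i)).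
  apply: eq_bigr => j' _; rewrite (bigD1 i) //= eqxx mul1r big1 ?addr0 // => [|i' /negbTE ->].
    by ring.
  by rewrite !mul0r.
by rewrite -mulr_suml [in RHS]mulrCA [in RHS]mulrC -(e2 (x2 j)) ?mem_tnth // (HamE _ _ _ _ _ uX2 z2) [in RHS]big_tnth.
Qed.

Let W_nonresonant v : ~ W v -> nonresonant A lam v Uc X1 X2 eta.
Proof.
move=> nW f1 E1 f2 E2 e1 [x xX fx] e2 [y yX fy]; rewrite leNgt; apply/negP => lt; apply: nW.
apply: (@rational_near_kernel R T (M v) eta (fun p => f1 (x1 p.1) * f2 (x2 p.2))) => //.
under eq_bigr do rewrite (tensor_eig _ e1 e2) normrM.
rewrite -mulr_sumr ltr_pM2r //.
have [i ei] : exists i, x = x1 i by apply/(@tnthP _ _ (in_tuple X1)).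
have [j ej] : exists j, y = x2 j by apply/(@tnthP _ _ (in_tuple X2)).
rewrite (bigD1 (i, j)) //= ltr_pwDl ?sumr_ge0 // normr_gt0 mulf_neq0 //.
  by rewrite -ei.
by rewrite -ej.
Qed.

Let pot_shift v t x : x \in X1 ++ X2 ->
  pot A lam (shift_env l t v) Uc x = pot A lam v Uc x + lam * t * (cnt A u0 x)%:R.
Proof.
move=> xX; rewrite /pot.
have -> : \sum_(j in A) shift_env l t v (x j) = \sum_(j in A) v (x j) + t * (cnt A u0 x)%:R.
  have -> : t * (cnt A u0 x)%:R = \sum_(j in A) (if u0 <= x j then t else 0).
    rewrite /cnt -sum1_card natr_sum mulr_sumr big_mkcond [RHS]big_mkcond /=.
    apply: eq_bigr => j _; rewrite !inE.
    by case: (j \in A) => //=; case: ifP => _; rewrite ?mulr1.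
  rewrite -big_split /=; apply: eq_bigr => j jA; rewrite /shift_env.
  have -> : (x j \in l) = (u0 <= x j).
    rewrite mem_undup; apply/mapP/idP => [[[y i]]|hx].
      by rewrite mem_filter => /andP[+ _] ->.
    exists (x, j) => //; rewrite mem_filter /ev /= hx; apply/allpairsP; exists (x, j); split=> //=.
    by rewrite mem_enum.
  by case: ifP => _; rewrite ?addr0.
by ring.
Qed.

Let size_l : (size l <= (size X1 + size X2) * N)%N.
Proof.
rewrite (leq_trans (size_undup _)) // size_map size_filter (leq_trans (count_size _ _)) //.
rewrite size_allpairs size_cat leq_mul2l; apply/orP; right.
by rewrite -cardE (leq_trans (max_card _)) // card_ord.
Qed.

Let n := #|{: T}|.

Let W_count (h : R) (J : nat) v : 2 * n%:R * eta <= lam * h ->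
  (#|finset (fun j : 'I_J => `[< W (shift_env l (j%:R * h) v) >])| <= n)%N.
Proof.
move=> hh; pose D (p : T) : R := (cnt A u0 (x1 p.1))%:R - (cnt A u0 (x2 p.2))%:R.
have D1 p : 1 <= D p.
  by rewrite /D lerBrDr addrC natr1 ler_nat cut // mem_tnth.
apply: leq_trans (near_kernel_count J (M_sym v) D1 lam0 eta0 hh).
apply/subset_leq_card/fintype.subsetP => j; rewrite !inE => -[g hg].
exists (fun p => ratr (g p)); move: hg; set t := j%:R * h.
have eM p q : M (shift_env l t v) p q = M v p q + (q == p)%:R * (lam * t * D p).
  rewrite /M /Hker !pot_shift // /D.
  have -> : (q == p) = (q.1 == p.1) && (q.2 == p.2) by case: p q => [? ?] [? ?].
  have inj1 : (x1 q.1 == x1 p.1) = (q.1 == p.1) by apply: inj_eq; apply/tuple_uniqP.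
  have inj2 : (x2 q.2 == x2 p.2) = (q.2 == p.2) by apply: inj_eq; apply/tuple_uniqP.
  by rewrite inj1 inj2; case: (q.1 == p.1); case: (q.2 == p.2); rewrite /= ?mul0r ?mul1r ?mulr0; ring.
under eq_bigr => p _.
  under eq_bigr do rewrite eM mulrDl.
  rewrite big_split /= [X in _ + X](_ : _ = lam * t * D p * ratr (g p)).
    over.
  rewrite (bigD1 p) //= eqxx mul1r big1 ?addr0 // => q /negbTE ->; by rewrite !mul0r.
by [].
Qed.

(** Apply [J] shifts of the potential by multiples of [h]. At most [n] of them hit resonance for
    each potential, and each changes the probability by at most [s * C * J * h], so that [Q W] is at
    most [n / J + s * C * J * h]. *)
Lemma wegner_pair : exists W0 : set (env R), [/\ measurable W0, depends (sites A (X1 ++ X2)) W0,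
  forall v, ~ W0 v -> nonresonant A lam v Uc X1 X2 eta &
  (Q W0 <= (((size X1 * size X2)%:R + 2 * C * ((size X1 + size X2) * N)%:R) *
     Num.sqrt (2 * (size X1 * size X2)%:R * (eta / lam)))%:E)%E].
Proof.
exists W; split; [exact: W_measurable|exact: W_depends|exact: W_nonresonant|].
have nE : n = (size X1 * size X2)%N by rewrite /n card_prod !card_ord.
rewrite -nE; set h := 2 * n%:R * (eta / lam); set s := ((size X1 + size X2) * N)%:R.
have kap : 0 < eta / lam by rewrite divr_gt0.
have [n0|n_gt0] := posnP n.
  have -> : W = set0.
    apply/seteqP; split=> // v [g]; have noT (p : T) : False by have := card0_eq n0 p; rewrite inE.
    by rewrite !big1 ?mulr0 ?ltxx // => p; case: (noT p).
  by rewrite measure0 lee_fin mulr_ge0 ?sqrtr_ge0 // addr_ge0 ?mulr_ge0 ?ler0n.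
have h0 : 0 < h by rewrite /h mulr_gt0 // mulr_gt0 ?ltr0n.
set r := Num.sqrt h; have r0 : 0 < r by rewrite sqrtr_gt0.
have rr : r * r = h by rewrite -expr2 sqr_sqrtr // ltW.
have n1 : 1 <= n%:R :> R by rewrite ler1n.
have s0 : 0 <= s by rewrite ler0n.
have [r1|r1] := ltP 1 r.
  apply: le_trans (probability_le1 Q W_measurable) _; rewrite lee_fin.
  rewrite -[leLHS]mulr1 ler_pM //; last exact: ltW.
  by rewrite (le_trans n1) // lerDl !mulr_ge0.
(* Balances the two terms: [J] is between [1 / r] and [2 / r] with [r * r = h], which produces the
   square root and the factor [2 * C]. *)
pose J := (Num.trunc (r^-1)).+1.
have J1 : r^-1 < J%:R by rewrite /J truncnS_gt.
have J2 : J%:R <= 2 * r^-1.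
  rewrite /J -natr1; have : (Num.trunc r^-1)%:R <= r^-1 by rewrite truncn_le // invr_ge0 ltW.
  have : 1 <= r^-1 by rewrite invf_ge1.
  by lra.
have lamh : 2 * n%:R * eta <= lam * h.
  by rewrite /h le_eqVlt; apply/orP; left; apply/eqP; field; rewrite gt_eqF.
pose Wj (j : nat) := shift_env l (j%:R * h) @^-1` W.
have mWj j : measurable (Wj j).
  by rewrite -[X in measurable X]setTI; exact: shift_env_measurable.
have mb := multiplicity_bound mWj (fun v => W_count J v lamh).
have finQ V : measurable V -> Q V = (fine (Q V))%:E.
  by move=> mV; rewrite fineK // fin_num_measure.
have each j : (j < J)%N -> fine (Q W) <= fine (Q (Wj j)) + s * (C * (J%:R * h)).
  move=> jJ; have jh : 0 <= j%:R * h by rewrite mulr_ge0 ?(ltW h0).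
  have Cjh : 0 <= C * (j%:R * h) by rewrite mulr_ge0.
  have := shift_le iidQ (tv jh) Cjh (l := l) (undup_uniq _) W_measurable.
  rewrite -/(Wj j) (finQ _ W_measurable) (finQ _ (mWj j)) -EFinD lee_fin => /le_trans; apply.
  rewrite lerD2l; apply: ler_pM => //; first by rewrite /s ler_nat.
  by rewrite ler_wpM2l // ler_wpM2r ?(ltW h0) // ler_nat ltnW.
have sumJ : J%:R * fine (Q W) <= n%:R + J%:R * (s * (C * (J%:R * h))).
  have : (\sum_(j < J) (fine (Q (Wj j)))%:E <= n%:R%:E)%E.
    by apply: le_trans mb; apply: lee_sum => j _; rewrite -finQ.
  rewrite sumEFin lee_fin => hs.
  apply: (@le_trans _ _ (\sum_(j < J) (fine (Q (Wj j)) + s * (C * (J%:R * h))))).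
    rewrite -[X in X%:R * _](card_ord J) mulr_natl -sumr_const; apply: ler_sum => j _; exact: each.
  by rewrite big_split /= sumr_const card_ord -[X in _ + X]mulr_natl lerD2r.
have J0 : 0 < J%:R :> R by rewrite ltr0n.
rewrite (finQ _ W_measurable) lee_fin.
have q1 : fine (Q W) <= n%:R / J%:R + s * (C * (J%:R * h)).
  by rewrite -(ler_pM2l J0) mulrDr [J%:R * (n%:R / _)]mulrCA mulfV ?mulr1 // gt_eqF.
have a1 : n%:R / J%:R <= n%:R * r.
  rewrite ler_wpM2l ?ler0n // -[leRHS]invrK lef_pV2 ?posrE ?invr_gt0 //; exact: ltW.
have a2 : s * (C * (J%:R * h)) <= s * (C * (2 * r)).
  rewrite ler_wpM2l // ler_wpM2l // -rr mulrA ler_wpM2r ?(ltW r0) //.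
  by rewrite -ler_pdivlMr.
by move: q1 a1 a2; rewrite mulrDl; lra.
Qed.

End Pair.
End Wegner.

(** * The probabilistic multiscale step *)

Lemma distn_far (a b : int) (F : nat) : (F < `|(a - b)%R|)%N -> a <= b -> a + F%:Z < b.
Proof. lia. Qed.

Lemma cluster_radius_le (N r K : nat) : (0 < N)%N -> (K < r)%N ->
  (2 * (r + r + N * (r + r + K).+1 + N * (r + r + K).+1) + 17 * r <= 60 * N * r)%N.
Proof.
move=> N0 Kr; have h : ((r + r + K).+1 <= 3 * r)%N by lia.
by have := leq_mul (leqnn N) h; nia.
Qed.

(** * Gaps, clustered centres and the sites a ball depends on *)

Section Geometry.
Variables (N : nat) (A : {set 'I_N}).
Implicit Types (a b : pt N).

Definition near a r : pred int := fun u => [exists i, (i \in A) && (`|(u - a i)%R| <= r)%N].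

Lemma near_sub a b r R : (r <= R)%N -> (dst A b a <= R - r)%N -> forall u, near b r u -> near a R u.
Proof.
move=> rR ba u /existsP[i /andP[iA hi]]; have [j jA hj] := dst_near ba iA.
by apply/existsP; exists j; rewrite jA /=; lia.
Qed.

Lemma sites_near a r X : {subset X <= cube A a r} -> forall u, sites A X u -> near a r u.
Proof.
move=> sX u /hasP[x /sX]; rewrite mem_cube => /andP[_ xa] /existsP[j /andP[jA /eqP <-]].
by have [i iA hi] := dst_near xa jA; apply/existsP; exists i; rewrite iA.
Qed.

(* Pigeonhole: N disjoint windows of length 2r+K+1 and at most N-1 particles to the
   right of the leftmost one leave one window empty. *)
Lemma cluster_gap b (r K : nat) i j : i \in A -> j \in A ->
  b i + (N * (r + r + K).+1)%N%:Z < b j ->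
  exists t : int, [/\ forall l, l \in A -> b l <= t - r%:Z \/ t + r%:Z + K%:Z < b l,
    b i <= t & t < b j].
Proof.
move=> iA jA big; set s := (r + r + K).+1 in big.
pose t (k : 'I_N) : int := b i + (k * s)%N%:Z + r%:Z.
have [[k hk]|no] := pselect (exists k : 'I_N, forall l, l \in A -> b l <= t k - r%:Z \/ t k + r%:Z + K%:Z < b l).
  exists (t k); split=> //; first by rewrite /t; lia.
  have : ((k.+1) * s <= N * s)%N by rewrite leq_mul2r ltn_ord orbT.
  by rewrite mulSn /t; lia.
have occ (k : 'I_N) : exists l : 'I_N, t k - r%:Z < b l <= t k + r%:Z + K%:Z.
  apply: contrapT => hno; apply: no; exists k => l lA.
  have [h|h] := leP (b l) (t k - r%:Z); first by left.
  have [h'|h'] := ltP (t k + r%:Z + K%:Z) (b l); first by right.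
  by case: hno; exists l; rewrite h h'.
have [f hf] := choice occ.
have finj : injective f.
  move=> k k' e; have h := hf k; have h' := hf k'; rewrite e in h; rewrite /t in h h'.
  apply/val_inj/eqP; rewrite eqn_leq; apply/andP; split; rewrite leqNgt; apply/negP => lt.
    have : (k'.+1 * s <= k * s)%N by rewrite leq_mul2r lt orbT.
    by rewrite mulSn; lia.
  have : (k.+1 * s <= k' * s)%N by rewrite leq_mul2r lt orbT.
  by rewrite mulSn; lia.
(* If all [N] windows are occupied the assignment exhausts the labels, including [i]; but every
   window starts strictly to the right of [b i]. *)
have [k hk] : exists k, f k = i by have := injF_onto finj i => /codomP[k ->]; exists k.
by have := hf k; rewrite hk /t; lia.
Qed.

Definition clustered b (D : nat) := forall i j, i \in A -> j \in A -> (`|(b i - b j)%R| <= D)%N.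

Lemma clustered_disjoint b b' r D : clustered b D -> clustered b' D ->
  (r + r + D + D < dst A b b')%N -> forall u, near b r u -> ~ near b' r u.
Proof.
move=> cb cb' far u /existsP[i /andP[iA hi]] /existsP[j /andP[jA hj]].
move: far; rewrite ltnNge => /negP; apply; apply: dst_pointwise => k kA.
by have := cb i k iA kA; have := cb' j k jA kA; lia.
Qed.

End Geometry.

(** * A calculus of high-probability events with local dependence *)

Section Events.
Variables (R : realType) (mu : set R -> \bar R) (Q : probability (env R) R).
Hypothesis iidQ : forall s A, uniq s -> (forall u, measurable (A u)) ->
  Q (rect s A) = (\prod_(u <- s) mu (A u))%E.
Implicit Types (S : pred int) (G : env R -> Prop) (x y : R).

(** The measurable local set [W] covers the failures of [G], so [G] itself, which quantifies over
    all eigenfunctions, needs neither measurability nor an explicit dependence on the sites. *)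
Definition likely S G x : Prop := exists W : set (env R),
  [/\ measurable W, depends S W, forall v, ~ W v -> G v & (Q W <= x%:E)%E].

Lemma likely_weaken S (S' : pred int) G (G' : env R -> Prop) x y :
  (forall u, S u -> S' u) -> (forall v, G v -> G' v) -> x <= y -> likely S G x -> likely S' G' y.
Proof.
move=> sS hG xy [W [mW dW gW qW]]; exists W; split=> //.
- exact: depends_sub dW.
- by move=> v /gW /hG.
- by apply: le_trans qW _; rewrite lee_fin.
Qed.

Lemma likely_impl S G (G' : env R -> Prop) x :
  (forall v, G v -> G' v) -> likely S G x -> likely S G' x.
Proof. by move=> h; apply: likely_weaken. Qed.

Lemma likely_true S G x : 0 <= x -> (forall v, G v) -> likely S G x.
Proof.
move=> x0 hG; exists set0.
by split; [exact: measurable0|move=> v w _ []|move=> v _; exact: hG|rewrite measure0 lee_fin].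
Qed.

Lemma likely_and S G (G' : env R -> Prop) x y : likely S G x -> likely S G' y ->
  likely S (fun v => G v /\ G' v) (x + y).
Proof.
move=> [W [mW dW gW qW]] [W' [mW' dW' gW' qW']]; exists (W `|` W'); split.
- exact: measurableU.
- by move=> v w e [h|h]; [left; exact: dW e h|right; exact: dW' e h].
- by move=> v h; split; [apply: gW => hW; apply: h; left|apply: gW' => hW; apply: h; right].
- by apply: le_trans (measureU2 _ mW mW') _; rewrite EFinD; exact: leeD.
Qed.

Lemma likely_all (I : eqType) (s : seq I) S (G : I -> env R -> Prop) x :
  (forall i, i \in s -> likely S (G i) x) ->
  likely S (fun v => forall i, i \in s -> G i v) ((size s)%:R * x).
Proof.
elim: s => [|i s IH] h; first by rewrite mul0r; apply: likely_true.
have h1 : likely S (G i) x by apply: h; rewrite mem_head.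
have h2 : likely S (fun v => forall j, j \in s -> G j v) ((size s)%:R * x).
  by apply: IH => j js; apply: h; rewrite inE js orbT.
apply: likely_weaken (likely_and h1 h2) => //.
  by move=> v [g1 g2] j; rewrite inE => /predU1P[->|/g2].
by rewrite /= -natr1; lra.
Qed.

Lemma likely_or S (S' : pred int) G (G' : env R -> Prop) x y : 0 <= x ->
  (forall u, S u -> ~ S' u) -> likely S G x -> likely S' G' y ->
  likely (fun u => S u || S' u) (fun v => G v \/ G' v) (x * y).
Proof.
move=> x0 dis [W [mW dW gW qW]] [W' [mW' dW' gW' qW']]; exists (W `&` W'); split.
- exact: measurableI.
- move=> v w e [h h']; split; [apply: dW h|apply: dW' h'] => u hu; apply: e; rewrite hu ?orbT //.
- move=> v h; have [hW|hW] := pselect (W v); last by left; exact: gW.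
  by right; apply: gW' => hW'; exact: h.
- rewrite (independent_events iidQ mW mW' dW).
    by rewrite EFinM; apply: lee_pmul.
  by apply: depends_sub dW' => u hu /=; apply/negP => hS; exact: dis hS hu.
Qed.

End Events.

Lemma strong_loc_mono (R : realType) N (A : {set 'I_N}) lam v Uc a r (th m m' : R) :
  m' <= m -> strong_loc A lam v Uc a r th m -> strong_loc A lam v Uc a r th m'.
Proof.
move=> mm sl f E ef f1; have [x0 x0D lx0] := sl f E ef f1; exists x0 => // y yD thd.
apply: le_trans (lx0 y yD thd) _; rewrite ler_expR !mulNr lerN2 ler_wpM2r //.
Qed.

Lemma nonresonant_sym (R : realType) N (A : {set 'I_N}) lam v Uc D1 D2 (eta : R) :
  nonresonant A lam v Uc D1 D2 eta -> nonresonant A lam v Uc D2 D1 eta.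
Proof. by move=> h f1 E1 f2 E2 h1 n1 h2 n2; rewrite distrC; exact: (h _ _ _ _ h2 n2 h1 n1). Qed.

Lemma weak_loc_nb (R : realType) N (A : {set 'I_N}) lam v Uc a r (th m : R) nb nb' :
  (nb <= nb')%N -> weak_loc A lam v Uc a r th m nb -> weak_loc A lam v Uc a r th m nb'.
Proof. by move=> le [B [h1 h2 h3 h4]]; exists B; split=> //; exact: leq_trans h1 le. Qed.

Section InductionStep.
Variables (R : realType) (mu : set R -> \bar R) (Q : probability (env R) R).
Hypothesis iidQ : forall s A, uniq s -> (forall u, measurable (A u)) ->
  Q (rect s A) = (\prod_(u <- s) mu (A u))%E.
Variable (C : R).
Hypothesis C0 : 0 <= C.
Hypothesis tv : forall c : R, 0 <= c -> forall B : set R, measurable B ->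
  (mu B <= mu [set r : R | B (r + c)%R] + (C * c)%:E)%E.
Variables (N : nat) (A : {set 'I_N}) (Uc : int -> R) (K : nat) (lam : R).
Hypotheses (K0 : (0 < K)%N) (hU : forall z : int, (K < `|z|)%N -> Uc z = 0) (lam0 : 0 < lam).

Definition wegner_bound (n : nat) (kap : R) : R :=
  ((n * n)%:R + 2 * C * ((n + n) * N)%:R) * Num.sqrt (2 * (n * n)%:R * kap).

Lemma wegner_bound_ge0 n kap : 0 <= wegner_bound n kap.
Proof. by rewrite mulr_ge0 ?sqrtr_ge0 // addr_ge0 ?mulr_ge0 ?ler0n. Qed.

Lemma wegner_likely (a b b' : pt N) (Rr r s n : nat) X1 X2 (eta : R) : 0 < eta ->
  uniq X1 -> uniq X2 ->
  {subset X1 <= cube A a Rr} -> {subset X2 <= cube A a Rr} ->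
  (forall x, x \in X1 -> (dst A x b <= r)%N) -> (forall x, x \in X2 -> (dst A x b' <= s)%N) ->
  (r + s < dst A b b')%N -> (size (cube A a Rr) <= n)%N ->
  likely Q (near A a Rr) (fun v => nonresonant A lam v Uc X1 X2 eta) (wegner_bound n (eta / lam)).
Proof.
move=> eta0 u1 u2 s1 s2 h1 h2 far sn.
have z1 : (size X1 <= n)%N by apply: leq_trans sn; exact: uniq_leq_size.
have z2 : (size X2 <= n)%N by apply: leq_trans sn; exact: uniq_leq_size.
have kap0 : 0 <= eta / lam by rewrite divr_ge0 ?ltW.
have mono n1 n2 : (n1 <= n)%N -> (n2 <= n)%N ->
    ((n1 * n2)%:R + 2 * C * ((n1 + n2) * N)%:R) * Num.sqrt (2 * (n1 * n2)%:R * (eta / lam))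
    <= wegner_bound n (eta / lam).
  move=> l1 l2; apply: ler_pM.
  - by rewrite addr_ge0 ?mulr_ge0 ?ler0n.
  - exact: sqrtr_ge0.
  - apply: lerD; first by rewrite ler_nat leq_mul.
    by rewrite ler_wpM2l ?mulr_ge0 // ler_nat leq_mul // leq_add.
  - apply: ler_wsqrtr; rewrite ler_wpM2r // ler_wpM2l // ler_nat leq_mul //.
have [u [cut|cut]] := dst_cut far.
  have [W [mW dW nW qW]] := @wegner_pair R mu Q iidQ C C0 tv N A lam Uc X1 X2 u eta lam0 eta0 u1 u2
    (fun x y hx hy => cut x y (h1 _ hx) (h2 _ hy)).
  exists W; split=> //; last by apply: le_trans qW _; rewrite lee_fin; exact: mono.
  apply: depends_sub dW => w; apply: sites_near => x; rewrite mem_cat => /orP[/s1|/s2] //.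
have [W [mW dW nW qW]] := @wegner_pair R mu Q iidQ C C0 tv N A lam Uc X2 X1 u eta lam0 eta0 u2 u1
    (fun x y hx hy => cut y x (h1 _ hy) (h2 _ hx)).
exists W; split=> //; last by apply: le_trans qW _; rewrite lee_fin; exact: mono.
  by apply: depends_sub dW => w; apply: sites_near => x; rewrite mem_cat => /orP[/s2|/s1].
by move=> v /nW; exact: nonresonant_sym.
Qed.

Definition SL (B : {set 'I_N}) (b : pt N) (r : nat) (th m : R) (v : env R) : Prop :=
  strong_loc B lam v Uc b r th m.

Lemma base_step (a : pt N) (r n : nat) (th m eta : R) : 0 <= m -> (size (cube A a r) <= n)%N ->
  (2 * N)%:R * (1 + expR m) < eta ->
  likely Q (near A a r) (SL A a r th m) ((n * n)%:R * wegner_bound n (eta / lam)).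
Proof.
move=> m0 sn big; set D := cube A a r.
have eta0 : 0 < eta by apply: le_lt_trans big; rewrite mulr_ge0 // addr_ge0 ?expR_ge0.
have pairs : likely Q (near A a r) (fun v => forall p, p \in [seq (x, y) | x <- D, y <- D] ->
    (0 < dst A p.1 p.2)%N -> nonresonant A lam v Uc [:: p.1] [:: p.2] eta)
    ((size [seq (x, y) | x <- D, y <- D])%:R * wegner_bound n (eta / lam)).
  apply: likely_all => -[x y] /allpairsP[[x' y'] /= [hx hy [-> ->]]].
  have [d0|d0] := posnP (dst A x' y').
    by apply: likely_true; rewrite ?wegner_bound_ge0 // d0.
  apply: (@likely_impl R Q _ (fun v => nonresonant A lam v Uc [:: x'] [:: y'] eta)) => [v nr _ //|].
  apply: (@wegner_likely a x' y' r 0 0 n) => //.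
  - by move=> z; rewrite inE => /eqP ->.
  - by move=> z; rewrite inE => /eqP ->.
  - by move=> z; rewrite inE => /eqP ->; rewrite dstxx.
  - by move=> z; rewrite inE => /eqP ->; rewrite dstxx.
apply: likely_weaken pairs => //.
  move=> v hv; apply: large_disorder_loc m0 _ big => x y xD yD d0.
  apply: nonresonant_singletons; apply: (hv (x, y)) => //.
  by apply/allpairsP; exists (x, y).
by rewrite ler_wpM2r ?wegner_bound_ge0 // ler_nat size_allpairs leq_mul.
Qed.

(** The three failure terms are: some smaller cluster is not localized; two clustered balls with
    disjoint sites are both bad; some pair of balls, or a ball and a thickened bad region,
    resonates. Outside these events [step_decay] applies. *)
Lemma msa_step (a : pt N) (Rr r n c : nat) (th m m1 m'' mL thL del x x1 Cd : R) :
  supported A a -> (K < r)%N -> (r <= Rr)%N -> (0 < N)%N ->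
  0 <= th -> 0 <= m'' -> m'' <= m -> m <= m1 -> 0 < del -> 0 <= x -> 0 <= x1 ->
  (size (cube A a Rr) <= n)%N -> ((N * (r + r).+1) ^ N <= c)%N ->
  (forall (B : {set 'I_N}) b, B \subset A -> B != finset.set0 -> B != A -> supported B b ->
     likely Q (near B b r) (SL B b r th m1) x1) ->
  (forall b, supported A b -> likely Q (near A b r) (SL A b r th m) x) ->
  1 <= Cd -> (maxn (2 ^ N * (c * c)) n * n * (2 * N))%:R / del <= Cd ->
  Cd * Cd * expR m'' * expR (m * (1 + 2 * th) - (m - m'') * r.+1%:R) < 1 ->
  mL <= m'' -> m'' * (60 * N * r)%:R <= (m'' - mL) * thL ->
  likely Q (near A a Rr) (SL A a Rr thL mL)
    ((2 ^ N * n)%:R * x1 + (n * n)%:R * (x * x)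
     + 2 * ((n * n)%:R * wegner_bound n (2 * del / lam))).
Proof.
move=> sa Kr rR N0 th0 m''0 m''m mm1 del0 x0 x10 sn sc hsub hself Cd1 hCd hq mLm'' hth.
set cs := cube A a (Rr - r).
have m0 : 0 <= m by exact: le_trans m''m.
have eta0 : 0 < 2 * del by rewrite mulr_gt0.
have csP b : b \in cs -> supported A b /\ (dst A b a <= Rr - r)%N by rewrite mem_cube => /andP[].
have cs_sub b : b \in cs -> {subset cube A b r <= cube A a Rr}.
  move=> /csP[_ ba] y; rewrite !mem_cube => /andP[-> /= yb].
  by rewrite (leq_trans (dst_tri A b y a)) // -(subnKC rR) leq_add.
have size_cs : (size cs <= n)%N.
  apply: leq_trans sn; apply: uniq_leq_size; first exact: cube_uniq.
  by move=> y; rewrite !mem_cube => /andP[-> /= h]; rewrite (leq_trans h) // leq_subr.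
have nearA b : b \in cs -> forall u, near A b r u -> near A a Rr u.
  by move=> /csP[_ ba]; exact: near_sub.
have ev_sub : likely Q (near A a Rr) (fun v => forall p, p \in [seq (B, b) | B <- enum {set 'I_N}, b <- cs] ->
    p.1 \subset A -> p.1 != finset.set0 -> p.1 != A -> SL p.1 (res p.1 p.2) r th m1 v)
    ((size [seq (B, b) | B <- enum {set 'I_N}, b <- cs])%:R * x1).
  apply: likely_all => -[B b] /allpairsP[[B' b'] /= [_ hb [-> ->]]].
  have [BA|BA] := boolP ((B' \subset A) && (B' != finset.set0) && (B' != A)); last first.
    by apply: likely_true => // v h1 h2 h3; rewrite h1 h2 h3 in BA.
  move: BA => /andP[/andP[h1 h2] h3].
  apply: likely_weaken (hsub B' (res B' b') h1 h2 h3 (res_supported _ _)) => //.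
  move=> u /existsP[i /andP[iB hi]]; apply: (nearA b' hb); apply/existsP; exists i.
  by rewrite (fintype.subsetP h1 _ iB) /=; rewrite resE iB in hi.
have ev_self : likely Q (near A a Rr) (fun v => forall p, p \in [seq (b, b') | b <- cs, b' <- cs] ->
    (forall u, near A p.1 r u -> ~ near A p.2 r u) -> SL A p.1 r th m v \/ SL A p.2 r th m v)
    ((size [seq (b, b') | b <- cs, b' <- cs])%:R * (x * x)).
  apply: likely_all => -[b1 b2] /allpairsP[[b b'] /= [hb hb' [-> ->]]].
  have [dis|ndis] := pselect (forall u, near A b r u -> ~ near A b' r u); last first.
    by apply: likely_true => //; rewrite mulr_ge0.
  have l1 := hself b (proj1 (csP _ hb)); have l2 := hself b' (proj1 (csP _ hb')).
  apply: likely_weaken (likely_or iidQ x0 dis l1 l2) => //.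
  by move=> u /orP[]; exact: nearA.
have ev_weg : likely Q (near A a Rr) (fun v => forall p, p \in [seq (b, b') | b <- cs, b' <- cs] ->
    (2 * r < dst A p.1 p.2)%N -> nonresonant A lam v Uc (cube A p.1 r) (cube A p.2 r) (2 * del))
    ((size [seq (b, b') | b <- cs, b' <- cs])%:R * wegner_bound n (2 * del / lam)).
  apply: likely_all => -[b1 b2] /allpairsP[[b b'] /= [hb hb' [-> ->]]].
  have [far|nfar] := ltnP (2 * r) (dst A b b'); last first.
    by apply: likely_true; rewrite ?wegner_bound_ge0.
  apply: (@likely_impl R Q _ (fun v => nonresonant A lam v Uc (cube A b r) (cube A b' r) (2 * del))) => [v nr _ //|].
  apply: (@wegner_likely a b b' Rr r r n) => //; rewrite ?cube_uniq //.
  - exact: cs_sub.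
  - exact: cs_sub.
  - by move=> z; rewrite mem_cube => /andP[].
  - by move=> z; rewrite mem_cube => /andP[].
  - by move: far; rewrite mul2n addnn.
pose F := (N * (r + r + K).+1)%N.
(* The distance beyond which centres clustered within [F] have disjoint neighbourhoods, as in
   [clustered_disjoint]. *)
pose r0 := (r + r + F + F)%N.
pose Ups b0 := [seq y <- cube A a Rr | (dst A y b0 <= r0 + r)%N].
have ev_ups : likely Q (near A a Rr) (fun v => forall p, p \in [seq (b, b') | b <- cs, b' <- cs] ->
    (r0 + r + r < dst A p.2 p.1)%N -> nonresonant A lam v Uc (Ups p.1) (cube A p.2 r) (2 * del))
    ((size [seq (b, b') | b <- cs, b' <- cs])%:R * wegner_bound n (2 * del / lam)).
  apply: likely_all => -[b1 b2] /allpairsP[[b b'] /= [hb hb' [-> ->]]].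
  have [far|nfar] := ltnP (r0 + r + r) (dst A b' b); last first.
    by apply: likely_true; rewrite ?wegner_bound_ge0.
  apply: (@likely_impl R Q _ (fun v => nonresonant A lam v Uc (Ups b) (cube A b' r) (2 * del))) => [v nr _ //|].
  apply: (@wegner_likely a b b' Rr (r0 + r) r n) => //.
  - by apply: filter_uniq; exact: cube_uniq.
  - exact: cube_uniq.
  - by move=> z; rewrite mem_filter => /andP[].
  - exact: cs_sub.
  - by move=> z; rewrite mem_filter => /andP[].
  - by move=> z; rewrite mem_cube => /andP[].
  - by rewrite dst_sym.
apply: likely_weaken (likely_and (likely_and ev_sub ev_self) (likely_and ev_weg ev_ups)) => //; last first.
  have sq : (size [seq (b, b') | b <- cs, b' <- cs] <= n * n)%N by rewrite size_allpairs leq_mul.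
  have wb := wegner_bound_ge0 n (2 * del / lam).
  rewrite [X in _ <= _ + X]mulr_natl mulr2n; apply: lerD; first apply: lerD.
  - rewrite ler_wpM2r // ler_nat size_allpairs leq_mul //.
    by rewrite -cardE -cardsT -powersetT card_powerset cardsT card_ord.
  - by rewrite ler_wpM2r ?mulr_ge0 // ler_nat.
  - by apply: lerD; rewrite ler_wpM2r // ler_nat.
move=> v [[vsub vself] [vweg vups]].
have inpairs b b' : b \in cs -> b' \in cs -> (b, b') \in [seq (b, b') | b <- cs, b' <- cs].
  by move=> hb hb'; apply/allpairsP; exists (b, b').
have size_c (B : {set 'I_N}) b : (size (cube B b r) <= c)%N by exact: leq_trans (size_cube _ _ _) sc.
have cc : (c <= 2 ^ N * (c * c))%N.
  have [->|c0] := posnP c; first by [].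
  by rewrite -{1}[c]mul1n leq_mul ?expn_gt0 // leq_pmulr.
have weakSL b : SL A b r th m v -> weak_loc A lam v Uc b r th m (2 ^ N * (c * c)).
  by move=> /strong_weak_loc; apply: weak_loc_nb; exact: leq_trans (size_c _ _) cc.
have dichotomy b : b \in cs -> weak_loc A lam v Uc b r th m (2 ^ N * (c * c)) \/ clustered A b F.
  move=> hb; have [cl|ncl] := pselect (clustered A b F); first by right.
  left; have [i [j [iA jA far]]] : exists i j, [/\ i \in A, j \in A & b i + F%:Z < b j].
    apply: contrapT => hno; apply: ncl => i j iA jA; rewrite leqNgt; apply/negP => lt.
    have [le|le] := leP (b i) (b j).
      by apply: hno; exists i, j; split=> //; exact: distn_far.
    by apply: hno; exists j, i; split=> //; apply: distn_far (ltW le); rewrite distnC.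
  have [t [gap bi bj]] := cluster_gap iA jA far.
  apply: (partially_interacting_loc K0 hU gap) => //.
  - by apply/set0Pn; exists i; rewrite inE iA.
  - by apply/eqP => /setP/(_ j); rewrite inE jA /= leNgt bj.
  move=> B b' BA B0 BnA sb' db'.
  have hb' : b' \in cs.
    rewrite mem_cube sb' /= (leq_trans (dst_tri A b b' a)) // db' add0n.
    by have [_ ->] := csP _ hb.
  have := vsub (B, b'); rewrite /= => h; apply: (weak_loc_nb (size_c B (res B b'))).
  apply: strong_weak_loc; apply: strong_loc_mono mm1 _; apply: h => //.
  by apply/allpairsP; exists (B, b'); split=> //; rewrite mem_enum.
(* Any bad centre serves as [b0]: it must be clustered, and a second bad centre far away would be
   independent of it. If no centre is bad, [a] is a harmless choice. *)
have [b0 hb0 hgood] : exists2 b0, b0 \in cs & forall b, b \in cs -> (r0 < dst A b b0)%N ->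
    weak_loc A lam v Uc b r th m (2 ^ N * (c * c)).
  have [[b0 [hb0 bad0]]|allgood] := pselect (exists b0, b0 \in cs /\
      ~ weak_loc A lam v Uc b0 r th m (2 ^ N * (c * c))); last first.
    exists a; first by rewrite mem_cube sa dstxx.
    by move=> b hb _; apply: contrapT => nb; apply: allgood; exists b.
  exists b0 => // b hb far; have [//|clb] := dichotomy b hb.
  have [//|clb0] := dichotomy b0 hb0.
  have [||sl] := vself _ (inpairs _ _ hb hb0); last by case: bad0; exact: weakSL.
    by apply: clustered_disjoint clb clb0 _; move: far; rewrite /r0.
  exact: weakSL.
move=> phi E ephi phi1.
have [|||||y0 y0L dec] := @step_decay R N A lam v Uc a b0 Rr r r0 (2 ^ N * (c * c)) th m m'' del Cd
  _ rR th0 m''0 m''m del0 _ _ _ Cd1 _ hq phi E ephi phi1.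
- by apply: leq_trans Kr.
- by move=> b sb ba; apply: hgood; rewrite mem_cube sb.
- by move=> b b' sb ba sb' ba' far; apply: (vweg (b, b')) => //; apply: inpairs; rewrite mem_cube ?sb ?sb'.
- by move=> b sb ba far; apply: (vups (b0, b)) => //; apply: inpairs => //; rewrite mem_cube sb.
- apply: le_trans hCd; rewrite ler_wpM2r ?invr_ge0 ?(ltW del0) // ler_nat !leq_mul // geq_max leq_maxl.
  by rewrite (leq_trans sn) // leq_maxr.
exists y0 => // y yL thd; apply: le_trans (dec y yL) _; rewrite ler_expR !mulNr lerN2.
have rs : (2 * r0 + 17 * r <= 60 * N * r)%N.
  exact: cluster_radius_le.
have h1 : m'' * (2 * r0 + 17 * r)%:R <= (m'' - mL) * (dst A y y0)%:R.
  apply: le_trans (_ : m'' * (60 * N * r)%:R <= _); first by rewrite ler_wpM2l // ler_nat.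
  by apply: le_trans hth _; rewrite ler_wpM2l // subr_ge0.
by move: h1; rewrite mulrBr mulrBl; lra.
Qed.

End InductionStep.

(** * Choice of scales *)

Section Growth.
Variable R : realType.
Implicit Types (l a M : R).

Lemma powRD_pos (x r s : R) : 0 < x -> x `^ (r + s) = x `^ r * x `^ s.
Proof. by move=> x0; apply: powRD; rewrite (gt_eqF x0) implybT. Qed.

Lemma powR_ge1 (x r : R) : 1 <= x -> 0 <= r -> 1 <= x `^ r.
Proof. by move=> x1 r0; rewrite -(powRr0 x); exact: ler_powR. Qed.

Lemma le_powR_eventually a M : 0 < a -> exists l0, forall l, l0 <= l -> M <= l `^ a.
Proof.
move=> a0; pose B := `|M| + 1; have B0 : 0 < B by rewrite ltr_pwDr.
exists (B `^ a^-1) => l hl.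
apply: (@le_trans _ _ B); first by rewrite /B (le_trans (ler_norm _)) // lerDl.
have -> : B = (B `^ a^-1) `^ a by rewrite -powRrM mulVf ?gt_eqF // powRr1 // ltW.
by apply: ge0_ler_powR; rewrite ?nnegrE ?(ltW a0) ?powR_ge0 // (le_trans (powR_ge0 _ _) hl).
Qed.

Lemma ln_le_powR_eventually a M : 0 < a -> 0 <= M ->
  exists l0, forall l, l0 <= l -> M * ln l <= l `^ a.
Proof.
move=> a0 M0; have a2 : 0 < a / 2 by rewrite divr_gt0.
have [l0 hl0] := le_powR_eventually (M * (2 / a)) a2.
exists (Num.max l0 1) => l; rewrite ge_max => /andP[/hl0 hl l1].
have lpos : 0 < l by exact: lt_le_trans l1.
set s := l `^ (a / 2) in hl; have s1 : 1 <= s by apply: powR_ge1 => //; exact: ltW.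
have e : ln l = (2 / a) * ln s by rewrite ln_powR mulrA; field; rewrite gt_eqF.
have lns : ln s <= s by have := @le_ln1Dx R (s - 1); rewrite addrCA subrr addr0; lra.
have -> : l `^ a = s * s by rewrite /s -powRD_pos //; congr (_ `^ _); field.
rewrite e mulrA; apply: (@le_trans _ _ (M * (2 / a) * s)).
  by rewrite ler_wpM2l // mulr_ge0 // divr_ge0 // ltW.
by rewrite ler_wpM2r // (le_trans ler01).
Qed.

End Growth.

(** * Exponents of the multiscale scheme and their compatibility *)

Section Numerics.
Variables (R : realType) (gamma tau m p C : R) (N K : nat).
Hypotheses (g1 : 1 < gamma) (gt1 : gamma^-1 < tau) (t1 : tau < 1) (m0 : 0 < m)
  (N0 : (0 < N)%N) (C0 : 0 <= C) (hp : (2 * N + 1)%:R <= p * (2 / gamma - 1)) (p0 : 0 < p).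

(** Half of both margins, so that a loss of order [l ^ (tau - 1)] or [l ^ (1 - gamma * tau)] is
    smaller than [l ^ (- rate_exponent)] by a positive power. *)
Definition rate_exponent : R := Num.min (1 - tau) (gamma * tau - 1) / 2.
Definition rate (L : R) : R := m * (1 + L `^ (- rate_exponent)).
Definition volume (L : R) : nat := ((N * (Num.trunc L + Num.trunc L).+1) ^ N)%N.
Definition volume_const : R := (3 * N)%:R ^+ N.
(** The doubling undoes the square root of the pair estimate; [5 * N] pays for two volume factors
    from the pairs and three from [wegner_bound], and the extra one absorbs constants. *)
Definition resonance_exponent : R := 2 * (5 * N%:R + p + 1).
(** Over a radius [l] the loss yields [8 * m * l ^ tau] in the exponent. Half of it pays for
    [2 * th] at rate at most [2 * m], a quarter for the constants and a quarter for the logarithm of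
    [step_const]. *)
Definition inner_rate (l : R) : R := rate l - 8 * m * l `^ (tau - 1).
Definition separation (L : R) : R := L `^ (- resonance_exponent).
Definition step_const (l L : R) : R :=
  (maxn (2 ^ N * (volume l * volume l)) (volume L) * volume L * (2 * N))%:R / separation L.

Let kap := rate_exponent.
Let G := volume_const.
Let Qe := resonance_exponent.
Let g0 : 0 < gamma. Proof. exact: lt_trans g1. Qed.
Let t0 : 0 < tau. Proof. by apply: lt_trans gt1; rewrite invr_gt0. Qed.
Let gt2 : 1 < gamma * tau. Proof. by rewrite mulrC -ltr_pdivrMr // div1r. Qed.

Let kap_le : 2 * kap <= 1 - tau /\ 2 * kap <= gamma * tau - 1.
Proof.
rewrite /kap /rate_exponent mulrC divfK ?pnatr_eq0 //.
by split; rewrite ge_min lexx ?orbT.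
Qed.

Lemma rate_exponent_gt0 : 0 < kap.
Proof. by rewrite /kap /rate_exponent divr_gt0 // lt_min !subr_gt0 t1 gt2. Qed.

Lemma rate_le L : 1 <= L -> rate L <= 2 * m.
Proof.
move=> L1; rewrite /rate mulrC ler_pM2r // -[2]/(1 + 1) lerD2l.
by rewrite -(powRr0 L) ler_powR // oppr_le0 ltW // rate_exponent_gt0.
Qed.

Lemma rate_ge L : m <= rate L.
Proof. by rewrite /rate ler_peMr ?(ltW m0) // lerDl powR_ge0. Qed.

Let G1 : 1 <= G.
Proof. by rewrite /G /volume_const exprn_ege1 // ler1n muln_gt0. Qed.

Lemma volume_le L : 1 <= L -> (volume L)%:R <= G * L ^+ N.
Proof.
move=> L1; rewrite /volume /G /volume_const natrX -exprMn.
have tL : (Num.trunc L)%:R <= L by rewrite truncn_le (le_trans ler01).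
rewrite lerXn2r ?nnegrE ?mulr_ge0 ?ler0n ?(le_trans ler01 L1) //.
rewrite !natrM -natr1 natrD [leRHS]mulrAC [3%:R * L * _]mulrC ler_wpM2l ?ler0n //.
by move: tL L1; lra.
Qed.

Lemma volume_gt0 L : (0 < volume L)%N.
Proof. by rewrite expn_gt0 muln_gt0 N0. Qed.

Lemma volume_mono l L : l <= L -> (volume l <= volume L)%N.
Proof.
move=> lL; rewrite /volume leq_exp2r // leq_mul2l ltnS leq_add ?orbT //; exact: le_truncn.
Qed.

Lemma wegner_bound_le n kp : 0 <= kp ->
  wegner_bound C N n kp <= n%:R ^+ 3 * (1 + 4 * C * N%:R) * Num.sqrt (2 * kp).
Proof.
move=> kp0; rewrite /wegner_bound.
have n0 : 0 <= n%:R :> R by rewrite ler0n.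
have -> : Num.sqrt (2 * (n * n)%:R * kp) = n%:R * Num.sqrt (2 * kp).
  rewrite natrM [2 * _ * kp](_ : _ = n%:R ^+ 2 * (2 * kp)); last by ring.
  by rewrite sqrtrM ?sqr_ge0 // sqrtr_sqr ger0_norm.
rewrite mulrA ler_wpM2r ?sqrtr_ge0 // !natrM natrD.
have nn : n%:R <= n%:R ^+ 2 :> R by rewrite -natrX ler_nat; case: n {n0} => // k; rewrite expnS expn1 leq_pmulr.
have N0' : 0 <= N%:R :> R by rewrite ler0n.
have h : 4 * C * N%:R * n%:R <= 4 * C * N%:R * n%:R ^+ 2 by rewrite ler_wpM2l // !mulr_ge0.
rewrite [leLHS](_ : _ = n%:R * (n%:R ^+ 2 + 4 * C * N%:R * n%:R)); last by ring.
rewrite [leRHS](_ : _ = n%:R * (n%:R ^+ 2 + 4 * C * N%:R * n%:R ^+ 2)); last by ring.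
by rewrite ler_wpM2l // lerD2l.
Qed.

Lemma volume_wegner L kp : 1 <= L -> 0 <= kp ->
  (volume L * volume L)%:R * wegner_bound C N (volume L) kp
  <= G ^+ 5 * (1 + 4 * C * N%:R) * (L ^+ N) ^+ 5 * Num.sqrt (2 * kp).
Proof.
move=> L1 kp0; have V0 : 0 <= (volume L)%:R :> R by rewrite ler0n.
have c0 : 0 <= 1 + 4 * C * N%:R by rewrite addr_ge0 // !mulr_ge0.
apply: le_trans (ler_wpM2l (ler0n _ _) (wegner_bound_le _ kp0)) _.
rewrite natrM [leLHS](_ : _ = (volume L)%:R ^+ 5 * (1 + 4 * C * N%:R) * Num.sqrt (2 * kp)); last by ring.
rewrite ler_wpM2r ?sqrtr_ge0 // [leRHS]mulrAC ler_wpM2r // -exprMn.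
rewrite lerXn2r ?nnegrE ?mulr_ge0 ?exprn_ge0 ?(le_trans ler01 L1) ?(le_trans ler01 G1) //.
exact: volume_le.
Qed.

Definition failure_bound (l L lam : R) : R :=
  (2 ^ N * volume L)%:R * l `^ (- (gamma * (N%:R + p + 1)))
  + (volume L * volume L)%:R * (l `^ (- p) * l `^ (- p))
  + 2 * ((volume L * volume L)%:R * wegner_bound C N (volume L) (2 * separation L / lam)).

(** Each term is a constant times at most [L ^ (-1) * L ^ (- p)], and the spare factor makes it at
    most a quarter of the target. The pair of bad balls is where [hp] enters, through
    [2 * N - 2 * p / gamma <= - 1 - p]. *)
Lemma failure_bound_le : exists l0, forall l, l0 <= l -> forall lam, 1 <= lam ->
  failure_bound l (l `^ gamma) lam <= (l `^ gamma) `^ (- p).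
Proof.
pose B := 4 * (2 ^ N)%:R * G + 4 * G ^+ 2 + 16 * (G ^+ 5 * (1 + 4 * C * N%:R)).
have [l0 hl0] := le_powR_eventually B g0.
exists (Num.max l0 1) => l; rewrite ge_max => /andP[/hl0 hB l1] lam lam1.
set L := l `^ gamma in hB *.
have lpos : 0 < l by exact: lt_le_trans l1.
have L1 : 1 <= L by apply: powR_ge1 => //; exact: ltW.
have Lpos : 0 < L by exact: lt_le_trans L1.
have G0 : 0 <= G by exact: le_trans G1.
have c0 : 0 <= 1 + 4 * C * N%:R by rewrite addr_ge0 // !mulr_ge0.
have b1 : 4 * (2 ^ N)%:R * G <= L.
  by apply: le_trans hB; rewrite /B -addrA lerDl addr_ge0 ?mulr_ge0 ?exprn_ge0.
have b2 : 4 * G ^+ 2 <= L.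
  by apply: le_trans hB; rewrite /B addrAC lerDr addr_ge0 ?mulr_ge0 ?exprn_ge0 ?ler0n.
have b3 : 16 * (G ^+ 5 * (1 + 4 * C * N%:R)) <= L.
  by apply: le_trans hB; rewrite /B lerDr addr_ge0 ?mulr_ge0 ?exprn_ge0 ?ler0n.
have lL (a : R) : l `^ a = L `^ (a / gamma).
  by rewrite /L -powRrM mulrC divfK // gt_eqF.
have LN : L ^+ N = L `^ N%:R by rewrite powR_mulrn // ltW.
have Lp0 : 0 <= L `^ (- p) by exact: powR_ge0.
have Lm1 : L `^ (-1) = L^-1 by rewrite powRN powRr1 // ltW.
have scale (c : R) : 0 <= c -> 4 * c <= L -> c * (L `^ (-1) * L `^ (- p)) <= L `^ (- p) / 4.
  move=> c0' hc; rewrite Lm1 mulrA mulrC ler_wpM2l // ler_pdivrMr //; lra.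
have T1 : (2 ^ N * volume L)%:R * l `^ (- (gamma * (N%:R + p + 1))) <= L `^ (- p) / 4.
  apply: le_trans (scale ((2 ^ N)%:R * G) _ _); rewrite ?mulr_ge0 ?ler0n ?mulrA //.
  rewrite natrM -mulrA -[leRHS]mulrA -[leRHS]mulrA ler_wpM2l ?ler0n //.
  rewrite lL (_ : - (gamma * (N%:R + p + 1)) / gamma = - N%:R + (-1 + - p)); last by field; rewrite gt_eqF.
  rewrite powRD_pos // powRD_pos //.
  apply: le_trans (ler_wpM2r _ (volume_le L1)) _; first by rewrite !mulr_ge0 ?powR_ge0.
  have e : L ^+ N * L `^ (- N%:R) = 1 by rewrite LN -powRD_pos // subrr powRr0.
  rewrite [leLHS](_ : _ = G * (L ^+ N * L `^ (- N%:R)) * (L `^ (-1) * L `^ (- p))); last by ring.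
  by rewrite e mulr1.
have T2 : (volume L * volume L)%:R * (l `^ (- p) * l `^ (- p)) <= L `^ (- p) / 4.
  apply: le_trans (scale (G ^+ 2) _ _); rewrite ?exprn_ge0 //.
  rewrite -powRD_pos // lL natrM.
  apply: (@le_trans _ _ ((G * L ^+ N) ^+ 2 * L `^ ((- p - p) / gamma))).
    rewrite ler_wpM2r ?powR_ge0 // -expr2 lerXn2r ?nnegrE ?ler0n ?mulr_ge0 ?exprn_ge0 ?(ltW Lpos) //.
    exact: volume_le.
  rewrite exprMn -mulrA ler_wpM2l ?exprn_ge0 // LN expr2 -!powRD_pos //.
  apply: ler_powR => //.
  have : (2 * N + 1)%:R <= p * (2 / gamma - 1) by [].
  by rewrite natrD natrM mulrBr mulr1 mulrA; rewrite [(- p - p) / gamma](_ : _ = - (p * 2 / gamma)); [lra|ring].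
have T3 : 2 * ((volume L * volume L)%:R * wegner_bound C N (volume L) (2 * separation L / lam)) <= L `^ (- p) / 4.
  have s0 : 0 <= separation L by exact: powR_ge0.
  have kp0 : 0 <= 2 * separation L / lam by rewrite !mulr_ge0 // invr_ge0 (le_trans ler01).
  apply: le_trans (scale (4 * (G ^+ 5 * (1 + 4 * C * N%:R))) _ _); rewrite ?mulr_ge0 ?exprn_ge0 //; last lra.
  apply: le_trans (ler_wpM2l _ (volume_wegner L1 kp0)) _; first by [].
  have sq : Num.sqrt (2 * (2 * separation L / lam)) <= 2 * L `^ (- (5 * N%:R + p + 1)).
    have e : 2 * L `^ (- (5 * N%:R + p + 1)) = Num.sqrt ((2 * L `^ (- (5 * N%:R + p + 1))) ^+ 2).
      by rewrite sqrtr_sqr ger0_norm // mulr_ge0 // powR_ge0.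
    rewrite e; apply: ler_wsqrtr.
    have sE : L `^ (- (5 * N%:R + p + 1)) ^+ 2 = separation L.
      by rewrite expr2 -powRD_pos // /separation /resonance_exponent; congr (_ `^ _); ring.
    have h : separation L / lam <= separation L.
      by rewrite ler_pdivrMr ?(lt_le_trans ltr01) // ler_peMr.
    by rewrite exprMn sE expr2; lra.
  apply: (@le_trans _ _ (2 * (G ^+ 5 * (1 + 4 * C * N%:R) * (L ^+ N) ^+ 5 * (2 * L `^ (- (5 * N%:R + p + 1)))))).
    by rewrite ler_wpM2l // ler_wpM2l // !mulr_ge0 ?exprn_ge0 // ltW.
  have -> : (L ^+ N) ^+ 5 = L `^ (5 * N%:R).
    by rewrite -exprM -powR_mulrn ?(ltW Lpos) // natrM mulrC.
  rewrite [leLHS](_ : _ = 4 * (G ^+ 5 * (1 + 4 * C * N%:R)) * (L `^ (5 * N%:R) * L `^ (- (5 * N%:R + p + 1)))); last by ring.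
  rewrite -!powRD_pos // (_ : 5 * N%:R + - (5 * N%:R + p + 1) = -1 + - p) //; ring.
rewrite /failure_bound; move: T1 T2 T3 Lp0; lra.
Qed.

Lemma step_const_le l L : 1 <= l -> l <= L ->
  [/\ 1 <= step_const l L &
    ln (step_const l L) <= ln ((2 ^ N * (2 * N))%:R * G ^+ 3) + (3 * N%:R + Qe) * ln L].
Proof.
move=> l1 lL; have L1 : 1 <= L by exact: le_trans lL.
have Lpos : 0 < L by exact: lt_le_trans L1.
have sp : 0 < separation L by exact: powR_gt0.
have Qe0 : 0 <= Qe by rewrite /Qe /resonance_exponent mulr_ge0 // !addr_ge0 ?mulr_ge0 // ltW.
have s1 : (separation L)^-1 = L `^ Qe by rewrite /separation powRN invrK.
have num_nat : (maxn (2 ^ N * (volume l * volume l)) (volume L) * volume L * (2 * N) <=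
    2 ^ N * (2 * N) * (volume L ^ 3))%N.
  have vl := volume_mono lL; have v0 := volume_gt0 L.
  have h : (maxn (2 ^ N * (volume l * volume l)) (volume L) <= 2 ^ N * (volume L * volume L))%N.
    rewrite geq_max leq_mul ?leq_mul //= -{1}[volume L]mul1n leq_mul ?expn_gt0 //.
    by rewrite -{1}[volume L]mul1n leq_mul.
  apply: leq_trans (leq_mul (leq_mul h (leqnn _)) (leqnn _)) _.
  by rewrite !expnS expn0 muln1; apply/eq_leq; ring.
have pos_nat : (0 < maxn (2 ^ N * (volume l * volume l)) (volume L) * volume L * (2 * N))%N.
  by rewrite !muln_gt0 volume_gt0 N0 /= leq_max volume_gt0 orbT.
have c1 : 1 <= step_const l L.
  by rewrite /step_const s1 -[leLHS]mulr1 ler_pM // ?ler1n // powR_ge1.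
split=> //.
have up : step_const l L <= (2 ^ N * (2 * N))%:R * G ^+ 3 * L `^ (3 * N%:R + Qe).
  rewrite /step_const s1; apply: (@le_trans _ _ ((2 ^ N * (2 * N))%:R * (G * L ^+ N) ^+ 3 * L `^ Qe)).
    rewrite ler_wpM2r ?powR_ge0 //.
    apply: le_trans (_ : (2 ^ N * (2 * N) * (volume L ^ 3))%:R <= _); first by rewrite ler_nat.
    rewrite [(_ * volume L ^ 3)%:R]natrM ler_wpM2l ?ler0n // natrX.
    rewrite lerXn2r ?nnegrE ?ler0n ?mulr_ge0 ?exprn_ge0 ?(ltW Lpos) ?(le_trans ler01 G1) //.
    exact: volume_le.
  rewrite powRD_pos // exprMn -[(L ^+ N) ^+ 3]exprM -[L ^+ (N * 3)]powR_mulrn ?(ltW Lpos) // (natrM _ N 3) (mulrC N%:R).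
  by rewrite !mulrA.
have cpos : 0 < (2 ^ N * (2 * N))%:R * G ^+ 3.
  have h : (0 < 2 ^ N * (2 * N))%N by rewrite !muln_gt0 expn_gt0 N0.
  by apply: mulr_gt0; [rewrite ltr0n|rewrite exprn_gt0 // (lt_le_trans ltr01 G1)].
rewrite -ln_powR -lnM ?posrE ?powR_gt0 //.
by rewrite ler_ln ?posrE // ?(lt_le_trans ltr01 c1) // mulr_gt0 // powR_gt0.
Qed.

Lemma step_numerics : exists l0, forall l, l0 <= l ->
  [/\ (K < Num.trunc l)%N, rate (l `^ gamma) <= inner_rate l, inner_rate l <= rate l,
   step_const l (l `^ gamma) * step_const l (l `^ gamma) * expR (inner_rate l) *
     expR (rate l * (1 + 2 * l `^ tau) - (rate l - inner_rate l) * (Num.trunc l).+1%:R) < 1 &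
   inner_rate l * (60 * N * Num.trunc l)%:R <= (inner_rate l - rate (l `^ gamma)) * (l `^ gamma) `^ tau].
Proof.
have k0 := rate_exponent_gt0; have [k1 k2] := kap_le.
have Qe0 : 0 <= Qe by rewrite /Qe /resonance_exponent mulr_ge0 // !addr_ge0 ?mulr_ge0 // ltW.
pose c1 := ln ((2 ^ N * (2 * N))%:R * G ^+ 3).
have [la hla] := le_powR_eventually ((2 * c1 + 4 * m + 1) / (2 * m)) t0.
have M0 : 0 <= 2 * (3 * N%:R + Qe) * gamma / (2 * m).
  apply: divr_ge0; last by rewrite mulr_ge0 // ltW.
  by apply: mulr_ge0 (ltW g0); rewrite mulr_ge0 // addr_ge0 // mulr_ge0.
have [lb hlb] := ln_le_powR_eventually t0 M0.
have e1 : 0 < (gamma - 1) * kap by rewrite mulr_gt0 // subr_gt0.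
have [lc hlc] := le_powR_eventually 4 e1.
have e2 : 0 < 1 - tau - kap by move: k1 k0; lra.
have [ld hld] := le_powR_eventually 32 e2.
have e3 : 0 < gamma * tau - 1 - kap by move: k2 k0; lra.
have [le hle] := le_powR_eventually (480 * N%:R) e3.
exists (Num.max la (Num.max lb (Num.max lc (Num.max ld (Num.max le (Num.max 1 K.+1%:R)))))) => l.
rewrite !ge_max => /andP[/hla ha /andP[/hlb hb /andP[/hlc hc /andP[/hld hd /andP[/hle he /andP[l1 lK]]]]]].
have lpos : 0 < l by exact: lt_le_trans l1.
set L := l `^ gamma.
have lL : l <= L by rewrite /L -[leLHS](powRr1 (ltW lpos)) ler_powR // ltW.
have L1 : 1 <= L by exact: le_trans lL.
have r_le : (Num.trunc l)%:R <= l by rewrite truncn_le ltW.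
have r_gt : l <= (Num.trunc l).+1%:R by rewrite ltW // truncnS_gt.
have lk0 : 0 < l `^ (- kap) by exact: powR_gt0.
have inv4 (a c : R) : 0 < c -> c <= l `^ a -> l `^ (- a) <= c^-1.
  by move=> c0 h; rewrite powRN lef_pV2 ?posrE ?powR_gt0.
(* [f1], [f2] and [f3] bound the rate excess kept at the next scale, the loss of [inner_rate], and
   the cost of the uncontrolled region, each by a quarter of the excess at [l]. *)
have f1 : L `^ (- kap) <= l `^ (- kap) / 4.
  rewrite /L -powRrM (_ : gamma * - kap = - ((gamma - 1) * kap) + - kap); last by ring.
  by rewrite powRD_pos // mulrC ler_wpM2l ?powR_ge0 // inv4.
have f2 : 8 * l `^ (tau - 1) <= l `^ (- kap) / 4.
  rewrite (_ : tau - 1 = - (1 - tau - kap) + - kap); last by ring.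
  rewrite powRD_pos // mulrA mulrC ler_wpM2l ?powR_ge0 //.
  have := inv4 (1 - tau - kap) 32 ltac:(by []) hd; lra.
have f3 : 120 * N%:R * l `^ (1 - gamma * tau) <= l `^ (- kap) / 4.
  rewrite (_ : 1 - gamma * tau = - (gamma * tau - 1 - kap) + - kap); last by ring.
  have N1 : 0 < N%:R :> R by rewrite ltr0n.
  rewrite powRD_pos // mulrA mulrC ler_wpM2l ?powR_ge0 //.
  have cp : 0 < 480 * N%:R :> R by rewrite mulr_gt0 ?ltr0n.
  have := inv4 _ _ cp he => h.
  apply: le_trans (ler_wpM2l _ h) _; first by rewrite mulr_ge0 // ltW.
  by rewrite le_eqVlt; apply/orP; left; apply/eqP; field; rewrite gt_eqF.
have gap : m * (120 * N%:R * l `^ (1 - gamma * tau)) <= inner_rate l - rate L.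
  rewrite /inner_rate /rate -/kap.
  have -> : m * (1 + l `^ (- kap)) - 8 * m * l `^ (tau - 1) - m * (1 + L `^ (- kap)) =
     m * (l `^ (- kap) - 8 * l `^ (tau - 1) - L `^ (- kap)) by ring.
  by rewrite ler_pM2l //; move: f1 f2 f3 lk0; lra.
have gap0 : 0 <= m * (120 * N%:R * l `^ (1 - gamma * tau)).
  by rewrite !mulr_ge0 ?powR_ge0 ?(ltW m0).
have rl2 := rate_le l1.
have in_le : inner_rate l <= rate l.
  by rewrite /inner_rate gerBl !mulr_ge0 ?powR_ge0 ?(ltW m0).
have in_ge : rate L <= inner_rate l by move: gap gap0; lra.
have in0 : 0 <= inner_rate l by apply: le_trans in_ge; exact: le_trans (ltW m0) (rate_ge _).
split=> //.
- by rewrite truncn_gt_nat.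
- have [sc1 sc2] := step_const_le l1 lL.
  set S := step_const l L in sc1 sc2 *.
  have S0 : 0 < S by exact: lt_le_trans sc1.
  rewrite -[S in S * S * _](lnK (x := S)) ?posrE // -!expRD -[ltRHS]expR0 ltr_expR.
  have lnL : ln L = gamma * ln l by rewrite ln_powR.
  rewrite lnL -/c1 in sc2.
  have h1 : 2 * c1 + 4 * m + 1 <= 2 * m * l `^ tau.
    by move: ha; rewrite ler_pdivrMr ?mulr_gt0 // [l `^ tau * _]mulrC.
  have h2 : 2 * (3 * N%:R + Qe) * gamma * ln l <= 2 * m * l `^ tau.
    by move: hb; rewrite mulrAC ler_pdivrMr ?mulr_gt0 // [l `^ tau * _]mulrC.
  have lt0 : 0 <= l `^ tau by exact: powR_ge0.
  have h3 : 8 * m * l `^ tau <= (rate l - inner_rate l) * (Num.trunc l).+1%:R.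
    have -> : rate l - inner_rate l = 8 * m * l `^ (tau - 1) by rewrite /inner_rate; ring.
    have -> : l `^ tau = l `^ (tau - 1) * l.
      by rewrite -[X in _ = _ * X](powRr1 (ltW lpos)) -powRD_pos // subrK.
    by rewrite mulrA ler_wpM2l // !mulr_ge0 ?powR_ge0 ?(ltW m0).
  have h4 : rate l * (1 + 2 * l `^ tau) <= 2 * m * (1 + 2 * l `^ tau).
    by rewrite ler_wpM2r // addr_ge0 // mulr_ge0.
  have h5 : (3 * N%:R + Qe) * (gamma * ln l) = (2 * (3 * N%:R + Qe) * gamma * ln l) / 2 by field.
  by move: sc2 h1 h2 h3 h4 in_le rl2; rewrite h5; lra.
- apply: (@le_trans _ _ (2 * m * (60 * N%:R * l))).
    rewrite !natrM; apply: ler_pM => //; first exact: le_trans in_le rl2.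
    by rewrite ler_wpM2l // mulr_ge0.
  apply: le_trans (ler_wpM2r (powR_ge0 _ _) gap).
  rewrite /L -powRrM le_eqVlt; apply/orP; left; apply/eqP.
  have -> : m * (120 * N%:R * l `^ (1 - gamma * tau)) * l `^ (gamma * tau) =
    2 * m * (60 * N%:R * (l `^ (1 - gamma * tau) * l `^ (gamma * tau))) by ring.
  by rewrite -powRD_pos // subrK powRr1 // ltW.
Qed.

End Numerics.

Lemma expr_unbounded (R : realType) (g M : R) : 1 < g -> exists k : nat, M <= g ^+ k.
Proof.
move=> g1; have bern k : 1 + k%:R * (g - 1) <= g ^+ k.
  elim: k => [|k IH]; first by rewrite mul0r addr0 expr0.
  have kg : 0 <= k%:R * (g - 1) * (g - 1) by rewrite !mulr_ge0 // subr_ge0 ltW.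
  rewrite exprS -natr1; apply: (@le_trans _ _ (g * (1 + k%:R * (g - 1)))).
    by move: kg; lra.
  by rewrite ler_pM2l // (lt_trans ltr01).
exists (Num.trunc (M / (g - 1))).+1; apply: le_trans (bern _).
have : M / (g - 1) < (Num.trunc (M / (g - 1))).+1%:R by rewrite truncnS_gt.
by rewrite ltr_pdivrMr ?subr_gt0 //; lra.
Qed.

(** * Induction over scales and over the number of particles *)

Section Main.
Variables (R : realType) (gamma tau : R) (N K : nat) (rho : R -> R) (C : R) (Uc : int -> R).
Hypotheses (g12 : 1 < gamma < 2) (gt1 : gamma^-1 < tau) (t1 : tau < 1) (N0 : (0 < N)%N)
  (K0 : (0 < K)%N) (hU : forall z : int, (K < `|z|)%N -> Uc z = 0) (C0 : 0 <= C).
Hypothesis tv : forall c : R, 0 <= c -> forall B : set R, measurable B ->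
  (density_law rho B <= density_law rho [set r : R | B (r + c)%R] + (C * c)%:E)%E.

Let g1 : 1 < gamma. Proof. by case/andP: g12. Qed.
Let g0 : 0 < gamma. Proof. exact: lt_trans g1. Qed.

Definition iid_env (Q : probability (env R) R) : Prop :=
  forall s A, uniq s -> (forall u, measurable (A u)) ->
    Q (rect s A) = (\prod_(u <- s) density_law rho (A u))%E.

Definition scale_loc (Q : probability (env R) R) (A : {set 'I_N}) (lam L m p : R) : Prop :=
  forall a, supported A a ->
    likely Q (near A a (Num.trunc L)) (SL Uc lam A a (Num.trunc L) (L `^ tau) m) (L `^ (- p)).

(** One disorder threshold handles the whole interval of scales up to [L0 ^ gamma], since volumes
    and target probabilities are controlled by its right end. The window [eta = lam * kp] grows with
    [lam] while its failure probability does not. *)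
Lemma base_scales (m p L0 : R) (A : {set 'I_N}) : 0 < m -> 0 < p -> 1 <= L0 ->
  exists2 c2, 1 <= c2 & forall lam, c2 <= lam -> forall Q, iid_env Q ->
    forall L, L0 <= L -> L <= L0 `^ gamma -> scale_loc Q A lam L (rate gamma tau m L) p.
Proof.
move=> m0 p0 L01; set L1 := L0 `^ gamma.
have L11 : 1 <= L1 by apply: powR_ge1 => //; exact: ltW.
have L1p : 0 < L1 by exact: lt_le_trans L11.
pose D := volume_const R N ^+ 5 * (1 + 4 * C * N%:R) * (L1 ^+ N) ^+ 5.
have G1 : 1 <= volume_const R N by rewrite /volume_const exprn_ege1 // ler1n muln_gt0.
have D0 : 0 < D.
  have c0 : 0 < 1 + 4 * C * N%:R by rewrite ltr_pwDl // !mulr_ge0.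
  have LN0 : 0 < L1 ^+ N by exact: exprn_gt0.
  have G0 : 0 < volume_const R N by exact: lt_le_trans G1.
  by apply: mulr_gt0; [apply: mulr_gt0 => //|]; exact: exprn_gt0.
(* Chosen so that the failure bound [D * s] is the target at the largest base scale; [kp] is then
   determined by [Num.sqrt (2 * kp) = s]. *)
pose s := L1 `^ (- p) / D.
have s0 : 0 < s by rewrite divr_gt0 // powR_gt0.
pose kp := s ^+ 2 / 2.
have kp0 : 0 < kp by rewrite divr_gt0 // exprn_gt0.
pose E := (2 * N)%:R * (1 + expR (2 * m)) + 1.
have E0 : 0 <= E by rewrite addr_ge0 // mulr_ge0 // addr_ge0 // expR_ge0.
exists (Num.max 1 (E / kp)); first by rewrite le_max lexx.
move=> lam; rewrite ge_max => /andP[lam1 lamE] Q iQ L L0L LL1 a sa.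
have lam0 : 0 < lam by exact: lt_le_trans lam1.
have Lg1 : 1 <= L by exact: le_trans L0L.
have big : (2 * N)%:R * (1 + expR (2 * m)) < lam * kp.
  by move: lamE; rewrite ler_pdivrMr //; rewrite /E; lra.
have m20 : 0 <= 2 * m by rewrite mulr_ge0 // ltW.
have szn : (size (cube A a (Num.trunc L)) <= volume N L)%N by exact: size_cube.
have := base_step iQ C0 tv Uc lam0 (L `^ tau) m20 szn big.
apply: likely_weaken => //.
  by move=> v; apply: strong_loc_mono; exact: rate_le.
have -> : lam * kp / lam = kp by rewrite mulrAC mulfV ?mul1r // gt_eqF.
apply: le_trans (volume_wegner N C0 Lg1 (ltW kp0)) _ => //.
have -> : Num.sqrt (2 * kp) = s.
  by rewrite /kp mulrC divfK ?pnatr_eq0 // sqrtr_sqr ger0_norm // ltW.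
apply: (@le_trans _ _ (D * s)).
  rewrite ler_wpM2r ?(ltW s0) // /D ler_wpM2l //.
    rewrite mulr_ge0 ?exprn_ge0 ?(le_trans ler01 G1) //.
    by rewrite addr_ge0 // !mulr_ge0.
  have Lge0 : 0 <= L by exact: le_trans Lg1.
  by rewrite lerXn2r ?nnegrE ?exprn_ge0 ?(ltW L1p) // lerXn2r ?nnegrE ?(ltW L1p).
have Lpos : 0 < L by exact: lt_le_trans Lg1.
rewrite /s mulrC divfK ?gt_eqF // !powRN lef_pV2 ?posrE; [|exact: powR_gt0|exact: powR_gt0].
by apply: ge0_ler_powR; rewrite ?nnegrE ?(ltW p0) ?(ltW L1p) // (le_trans ler01).
Qed.

(** Real scales are treated directly: from any [L] beyond the base interval one steps back to
    [L ^ (1 / gamma)], and the induction is on the number of such steps. *)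
Lemma all_scales (m p L0 lam : R) (A : {set 'I_N}) (Q : probability (env R) R) :
  0 < m -> 0 < p -> 1 < L0 -> 1 <= lam -> iid_env Q ->
  (forall l, L0 <= l ->
  [/\ (K < Num.trunc l)%N, rate gamma tau m (l `^ gamma) <= inner_rate gamma tau m l,
    inner_rate gamma tau m l <= rate gamma tau m l,
   step_const p N l (l `^ gamma) * step_const p N l (l `^ gamma) * expR (inner_rate gamma tau m l) *
     expR (rate gamma tau m l * (1 + 2 * l `^ tau) - (rate gamma tau m l - inner_rate gamma tau m l) * (Num.trunc l).+1%:R) < 1 &
   inner_rate gamma tau m l * (60 * N * Num.trunc l)%:R <=
     (inner_rate gamma tau m l - rate gamma tau m (l `^ gamma)) * (l `^ gamma) `^ tau]) ->
  (forall l, L0 <= l -> forall lam, 1 <= lam ->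
     failure_bound gamma p C N l (l `^ gamma) lam <= (l `^ gamma) `^ (- p)) ->
  (forall L, L0 <= L -> L <= L0 `^ gamma -> scale_loc Q A lam L (rate gamma tau m L) p) ->
  (forall B : {set 'I_N}, B \subset A -> B != finset.set0 -> B != A -> forall l, L0 <= l ->
     scale_loc Q B lam l (2 * m) (gamma * (N%:R + p + 1))) ->
  forall L, L0 <= L -> scale_loc Q A lam L (rate gamma tau m L) p.
Proof.
move=> m0 p0 L01 lam1 iQ num fail base sub L L0L.
have L00 : 0 < L0 by exact: lt_trans L01.
have lam0 : 0 < lam by exact: lt_le_trans lam1.
have [k hk] := expr_unbounded (ln L / ln L0) g1.
have lnL0 : 0 < ln L0 by rewrite ln_gt0.
have {hk} : L <= L0 `^ (gamma ^+ k).
  have Lp : 0 < L by exact: lt_le_trans L0L.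
  rewrite -ler_ln ?posrE ?powR_gt0 // ln_powR -ler_pdivrMr //.
elim: k L L0L => [|k IH] L L0L hL.
  apply: base => //; apply: le_trans hL _; rewrite expr0 ler_powR ?(ltW L01) //; exact: ltW.
have [le|lt] := leP L (L0 `^ gamma); first exact: base.
have Lp : 0 < L by exact: lt_le_trans L0L.
pose l := L `^ gamma^-1.
have lL : l `^ gamma = L by rewrite /l -powRrM mulVf ?gt_eqF // powRr1 // ltW.
have root_le (x y : R) : 0 < x -> 0 < y -> x `^ gamma <= y -> x <= y `^ gamma^-1.
  move=> x0 y0 h; have -> : x = (x `^ gamma) `^ gamma^-1 by rewrite -powRrM mulfV ?gt_eqF // powRr1 // ltW.
  by apply: ge0_ler_powR; rewrite ?nnegrE ?invr_ge0 ?(ltW g0) ?powR_ge0 ?(ltW y0).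
have L0l : L0 <= l by apply: root_le => //; exact: ltW.
have hl : l <= L0 `^ (gamma ^+ k).
  have -> : L0 `^ (gamma ^+ k) = (L0 `^ (gamma ^+ k.+1)) `^ gamma^-1.
    by rewrite -powRrM exprS mulrAC mulfV ?gt_eqF // mul1r.
  by apply: ge0_ler_powR; rewrite ?nnegrE ?invr_ge0 ?(ltW g0) ?powR_ge0 ?(ltW Lp).
have l1 : 1 <= l by apply: le_trans L0l; exact: ltW.
have lleL : l <= L by rewrite -[leRHS]lL -[leLHS](powRr1 (ltW (lt_le_trans ltr01 l1))) ler_powR // ltW.
have [nK nin nle nq nth] := num l L0l; rewrite lL in nin nq nth.
have flr := fail l L0l lam lam1; rewrite lL in flr.
have [sc1 _] := step_const_le N0 p0 l1 lleL.
move=> a sa.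
have szn : (size (cube A a (Num.trunc L)) <= volume N L)%N by exact: size_cube.
have m''0 : 0 <= inner_rate gamma tau m l.
  by apply: le_trans nin; apply: le_trans (ltW m0) _; exact: rate_ge.
have step := @msa_step R _ Q iQ C C0 tv N A Uc K lam K0 hU lam0 a (Num.trunc L) (Num.trunc l)
  (volume N L) (volume N l) (l `^ tau) (rate gamma tau m l) (2 * m) (inner_rate gamma tau m l)
  (rate gamma tau m L) (L `^ tau) (separation p N L) (l `^ (- p))
  (l `^ (- (gamma * (N%:R + p + 1)))) (step_const p N l L) sa nK (le_truncn lleL) N0
  (powR_ge0 _ _) m''0 nle (rate_le g1 gt1 t1 m0 l1) (powR_gt0 _ Lp) (powR_ge0 _ _) (powR_ge0 _ _)
  szn (leqnn _) (fun B b sB B0 BA sb => sub B sB B0 BA l L0l b sb)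
  (fun b sb => IH l L0l hl b sb) sc1 (lexx _) nq nin nth.
by apply: likely_weaken step.
Qed.

(** The rate and the decay exponent are quantified inside the induction, since proper label sets are
    invoked with the stronger values [2 * m] and [p1]. *)
Lemma localization_by_labels n : forall A : {set 'I_N}, (#|A| <= n)%N -> A != finset.set0 ->
  forall m p : R, 0 < m -> 0 < p -> exists C1, forall L0, 1 <= L0 -> C1 <= L0 ->
  exists2 C2, 1 <= C2 & forall lam, C2 <= lam -> forall Q, iid_env Q ->
    forall L, L0 <= L -> scale_loc Q A lam L m p.
Proof.
elim: n => [A|n IH A An Ane m p m0 p0]; first by rewrite leqn0 cards_eq0 => ->.
have gfac : 0 < 2 / gamma - 1 by rewrite subr_gt0 ltr_pdivlMr // mul1r; case/andP: g12.
pose q := Num.max p ((2 * N + 1)%:R / (2 / gamma - 1)).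
have pq : p <= q by rewrite le_max lexx.
have q0 : 0 < q by exact: lt_le_trans pq.
have hq : (2 * N + 1)%:R <= q * (2 / gamma - 1) by rewrite -ler_pdivrMr // le_max lexx orbT.
(* A failure at scale [l] then has probability [L ^ (- (N + q + 1))], which survives the union over
   the centres in the large ball. *)
pose p1 := gamma * (N%:R + q + 1).
have p10 : 0 < p1 by rewrite mulr_gt0 // ltr_pwDr // addr_ge0 // ltW.
have m20 : 0 < 2 * m by rewrite mulr_gt0.
have subC1 (B : {set 'I_N}) : exists C1 : R, B \subset A -> B != finset.set0 -> B != A ->
    forall L0, 1 <= L0 -> C1 <= L0 -> exists2 C2, 1 <= C2 & forall lam, C2 <= lam -> forall Q, iid_env Q ->
      forall L, L0 <= L -> scale_loc Q B lam L (2 * m) p1.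
  have [/andP[/andP[sB B0] BA]|nB] := boolP ((B \subset A) && (B != finset.set0) && (B != A)); last first.
    by exists 0 => h1 h2 h3; rewrite h1 h2 h3 in nB.
  have Bn : (#|B| <= n)%N.
    rewrite -ltnS (leq_trans _ An) // proper_card // finset.properEneq BA sB //.
  by have [C1 h] := IH B Bn B0 (2 * m) p1 m20 p10; exists C1.
have [c1 hc1] := choice subC1.
have [la hla] := step_numerics K g1 gt1 t1 m0 N0 q0.
have [lb hlb] := failure_bound_le g1 N0 C0 hq.
pose M := \big[Num.max/0]_(B : {set 'I_N}) c1 B.
(* The [2] keeps [L0] strictly above one, so that the iterated powers of [L0] exhaust all scales. *)
exists (Num.max 2 (Num.max la (Num.max lb M))) => L0 L01; rewrite !ge_max => /andP[L02 /andP[aL0 /andP[bL0 ML0]]].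
have subC2 (B : {set 'I_N}) : exists C2 : R, B \subset A -> B != finset.set0 -> B != A ->
    forall lam, C2 <= lam -> forall Q, iid_env Q -> forall L, L0 <= L -> scale_loc Q B lam L (2 * m) p1.
  have [/andP[/andP[sB B0] BA]|nB] := boolP ((B \subset A) && (B != finset.set0) && (B != A)); last first.
    by exists 0 => h1 h2 h3; rewrite h1 h2 h3 in nB.
  have cB : c1 B <= L0 by apply: le_trans ML0; rewrite /M; exact: le_bigmax.
  by have [C2 _ h] := hc1 B sB B0 BA L0 L01 cB; exists C2.
have [c2 hc2] := choice subC2.
have [cb cb1 hcb] := base_scales A m0 q0 L01.
exists (Num.max cb (\big[Num.max/0]_(B : {set 'I_N}) c2 B)); first by rewrite le_max cb1.
move=> lam; rewrite ge_max => /andP[cblam c2lam] Q iQ L L0L a sa.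
have L0gt1 : 1 < L0 by apply: lt_le_trans L02; lra.
have lam1 : 1 <= lam by exact: le_trans cblam.
have := all_scales m0 q0 L0gt1 lam1 iQ (fun l hl => hla l (le_trans aL0 hl))
  (fun l hl => hlb l (le_trans bL0 hl)) (hcb lam cblam Q iQ) _ L0L sa.
move=> h; have {h} := h _.
have sub : forall B : {set 'I_N}, B \subset A -> B != finset.set0 -> B != A ->
   forall l, L0 <= l -> scale_loc Q B lam l (2 * m) p1.
  move=> B sB B0 BA l hl; apply: hc2 => //; apply: le_trans c2lam; exact: le_bigmax.
move=> /(_ sub); apply: likely_weaken => //.
  by move=> v; apply: strong_loc_mono; exact: rate_ge.
by apply: ler_powR; [exact: le_trans L0L|rewrite lerN2].
Qed.

End Main.

(** * The symmetric cubes of the model *)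

Section SymmetrizedDistance.
Variable N : nat.
Implicit Types (x y a : pt N).
Let T : {set 'I_N} := [set: 'I_N]%SET.

Lemma dS_le_supdist x y (s : {perm 'I_N}) : (dS x y <= supdist x (permpt s y))%N.
Proof.
rewrite /dS; have : s \in index_enum {perm 'I_N} by exact: mem_index_enum.
elim: (index_enum _) => // t e IH; rewrite big_cons inE geq_min => /predU1P[->|/IH ->].
  by rewrite leqnn.
by rewrite orbT.
Qed.

Lemma dS_attained x y : exists s : {perm 'I_N}, dS x y = supdist x (permpt s y).
Proof.
rewrite /dS; apply: (big_ind (fun n => exists s : {perm 'I_N}, n = supdist x (permpt s y))).
- by exists 1%g; congr supdist; apply/ffunP => j; rewrite ffunE perm1.
- move=> _ _ [s ->] [t ->]; rewrite /minn; case: ifP => _; [by exists s|by exists t].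
- by move=> s _; exists s.
Qed.

Lemma cnt_perm (s : {perm 'I_N}) u y : cnt T u (permpt s y) = cnt T u y.
Proof.
rewrite /cnt -[RHS](card_preimset (f := s)); last exact: perm_inj.
by apply: eq_card => j; rewrite !inE ffunE.
Qed.

Lemma sorting_perm x : exists s : {perm 'I_N},
  forall i j : 'I_N, (i <= j)%N -> x (s i) <= x (s j).
Proof.
pose t := [tuple x i | i < N].
have /tuple_permP[s hs] : perm_eq (sort_tuple <=%O t) t by rewrite perm_sort.
exists s => i j ij.
have e (k : 'I_N) : x (s k) = nth 0 (sort <=%O t) k.
  have := congr1 (fun z : seq int => nth 0 z k) hs => /= ->.
  by rewrite (nth_map k) ?size_enum_ord // nth_ord_enum tnth_mktuple.
rewrite !e; apply: sorted_leq_nth => //; rewrite ?inE ?size_sort ?size_tuple //.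
  exact: le_trans.
exact: sort_le_sorted.
Qed.

(** Counting at the order statistic of rank [j] of [z], all ranks from [j] on are seen in [z]; were
    the one of [w] too far left, only ranks strictly above [j] could be seen in [w]. *)
Lemma sorted_cnt_le (z w : pt N) (p q : {perm 'I_N}) (r : nat) (j : 'I_N) :
  (forall i k : 'I_N, (i <= k)%N -> z (p i) <= z (p k)) ->
  (forall i k : 'I_N, (i <= k)%N -> w (q i) <= w (q k)) ->
  (forall u, (cnt T u z <= cnt T (u - r%:Z) w)%N) -> z (p j) - r%:Z <= w (q j).
Proof.
move=> hp hq hc; rewrite leNgt; apply/negP => lt.
have := hc (z (p j)); rewrite -(cnt_perm p _ z) -(cnt_perm q _ w); rewrite /cnt; apply/negP; rewrite -ltnNge.
apply: (@leq_trans #|[set i : 'I_N | (j <= i)%N]%SET|).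
  apply/proper_card/fintype.properP; split.
    apply/fintype.subsetP => i; rewrite !inE ffunE /= => h; rewrite leqNgt; apply/negP => ij.
    by have := le_lt_trans (le_trans h (hq _ _ (ltnW ij))) lt; rewrite ltxx.
  by exists j; rewrite !inE ?leqnn //= ffunE -ltNge.
by apply/subset_leq_card/fintype.subsetP => i; rewrite !inE ffunE /=; exact: hp.
Qed.

(* Matching the order statistics of [x] with those of [y] is optimal. *)
Lemma dS_dst x y : dS x y = dst T x y.
Proof.
apply/eqP; rewrite eqn_leq; apply/andP; split.
  have [s hs] := sorting_perm x; have [t ht] := sorting_perm y; set r := dst T x y.
  have h : dle T r x y := dst_dle T x y.
  apply: leq_trans (dS_le_supdist x y (s^-1 * t)%g) _; apply/bigmax_leqP => j _.
  rewrite ffunE permM; set i := (s^-1)%g j; have -> : j = s i by rewrite /i permKV.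
  have h1 := sorted_cnt_le i hs ht (fun u => proj1 (h u)).
  have h2 := sorted_cnt_le i ht hs (fun u => proj2 (h u)).
  by move: h1 h2; clear; lia.
have [s ->] := dS_attained x y; rewrite dst_sym -(eq_cnt_dst x (fun u => cnt_perm s u y)).
rewrite dst_sym; apply: dst_pointwise => j _; exact: (leq_bigmax j).
Qed.

Lemma supported_full x : supported T x.
Proof. by apply/supportedP => j; rewrite finset.in_setT. Qed.

Variable R : realType.
Implicit Types L : R.

Lemma in_cubeE a L x : 0 <= L -> in_cube a L x = (x \in cube T a (Num.trunc L)).
Proof. by move=> L0; rewrite /in_cube mem_cube supported_full dS_dst truncn_ge_nat. Qed.

Lemma cube_seq_uniq a L : uniq (cube_seq a L).
Proof.
apply: filter_uniq; rewrite map_inj_uniq ?enum_uniq // => f g /ffunP e.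
by apply/ffunP => j; apply/val_inj; have := e j; rewrite !ffunE /=; clear; lia.
Qed.

Lemma cube_seq_perm a L : 0 <= L -> perm_eq (cube_seq a L) (cube T a (Num.trunc L)).
Proof.
move=> L0; apply: uniq_perm (cube_seq_uniq a L) (cube_uniq _ _ _) _.
suff h (x : pt N) : (x \in cube_seq a L) = (x \in cube T a (Num.trunc L)) by [].
rewrite mem_filter in_cubeE //; case: (boolP (x \in cube _ _ _)) => //=.
rewrite mem_cube => /andP[_]; rewrite truncn_floor L0 => xa.
have hx j : (`|x j| <= box_bound a L)%N.
  have [i _ xi] := dst_near xa (finset.in_setT j).
  apply: (@leq_trans (`|a i| + `|Num.floor L| + 1)); last first.
    by rewrite /box_bound !leq_add2r; exact: (leq_bigmax i).
  by move: xi; move: (absz (Num.floor L)) => k; clear; lia.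
set M := box_bound a L in hx *.
have lt j : (`|(x j + M%:Z)%R| < (M + M).+1)%N by have := hx j; clear; lia.
apply/mapP; exists [ffun j => Ordinal (lt j)]; first by rewrite mem_enum.
by apply/ffunP => j; rewrite !ffunE /=; have := hx j; clear; lia.
Qed.

Lemma Hact_Ham (lam : R) Vc Uc f x : Hact lam Vc Uc f x = Ham T lam Vc Uc f x.
Proof.
rewrite /Hact /Ham /hop /pot; congr (- _ + (_ * _ + _) * _); apply: eq_big => // j;
  rewrite ?finset.in_setT //.
by move=> _; apply: eq_big => // i; rewrite finset.in_setT.
Qed.

(** The Hamiltonian is real symmetric, so a real orthonormal eigenbasis with zero imaginary parts
    serves as the complex one. *)
Lemma strong_loc_cube_localizing (tau lam : R) Vc Uc a L m : 0 <= L ->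
  strong_loc T lam Vc Uc a (Num.trunc L) (L `^ tau) m -> cube_localizing tau lam Vc Uc a L m.
Proof.
move=> L0 sl; set D := cube T a (Num.trunc L) in sl *.
have pD := cube_seq_perm a L0.
have [f [nu [h1 h2 _]]] := spectral_domain T lam Vc Uc (cube_uniq T a (Num.trunc L)).
have H0 x : Hact lam Vc Uc (fun=> 0) x = 0.
  by rewrite /Hact mulr0 addr0 big1 ?oppr0 // => j _; rewrite addr0.
pose phis : seq (cfun N) := [seq (f k, fun=> 0) | k <- enum 'I_(size D)].
pose Es := [seq nu k | k <- enum 'I_(size D)].
have sz : size phis = size D by rewrite size_map size_enum_ord.
have nphi k (kD : (k < size D)%N) :
    nth (fun=> 0, fun=> 0) phis k = (f (Ordinal kD), fun=> 0) :> cfun N.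
  by rewrite (nth_map (Ordinal kD)) ?size_enum_ord // (nth_ord_enum _ (Ordinal kD)).
have nE k (kD : (k < size D)%N) : nth 0 Es k = nu (Ordinal kD).
  by rewrite (nth_map (Ordinal kD)) ?size_enum_ord // (nth_ord_enum _ (Ordinal kD)).
have ipr k l : ip_re a L (f k, fun=> 0) (f l, fun=> 0) = (k == l)%:R.
  rewrite /ip_re (perm_big _ pD) -h2 /=.
  by apply: eq_bigr => x _; rewrite mulr0 addr0.
exists phis, Es; rewrite sz; split; first exact: esym (perm_size pD).
split; first by rewrite size_map size_enum_ord.
split; [|split].
- move=> k kD; rewrite nphi nE; have [e1 e2] := h1 (Ordinal kD).
  split=> x; rewrite in_cubeE //= => xD; first by split=> //; exact: e1.
  by rewrite Hact_Ham e2 // H0 mulr0.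
- move=> k l kD lD; rewrite !nphi ipr; split=> //.
  by rewrite /ip_im big1 // => x _ /=; rewrite mulr0 mul0r subr0.
move=> k kD; rewrite nphi; have [|x0 x0D loc] := sl _ _ (h1 (Ordinal kD)).
  by under eq_bigr do rewrite expr2; rewrite h2 eqxx.
exists x0; first by rewrite in_cubeE.
split=> [|y]; first by rewrite ipr eqxx.
rewrite in_cubeE // !dS_dst /cabs /= => yD; rewrite expr0n addr0 sqrtr_sqr.
exact: loc.
Qed.

End SymmetrizedDistance.

Theorem theorem1p3 (R : realType) (beta gamma tau : R)
  (hbeta : 0 < beta) (hgamma : 1 < gamma < 2) (hbg : beta < gamma^-1)
  (htau : Num.max (gamma * beta) gamma^-1 < tau < 1)
  (N : nat) (hN : (1 <= N)%N)
  (rho : R -> R) (vmax : R) (hrho : admissible_density rho vmax)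
  (Uc : int -> R) (hU : exists K : nat, forall z : int, (K < `|z|)%N -> Uc z = 0)
  (m p : R) (hm : 0 < m) (hp : 0 < p) :
  exists (C1 : R) (C2 : R -> R),
    forall L0 : R, 1 <= L0 -> C1 <= L0 ->
    forall lam : R, 0 < lam -> C2 L0 <= lam ->
    forall (d : measure_display) (Omega : measurableType d) (P : probability Omega R)
           (Vr : int -> Omega -> R),
      iid_potential P Vr rho ->
      forall (L : R), L0 <= L -> forall a : pt N,
        exists E : set Omega,
          [/\ measurable E,
              E `<=` [set w | cube_localizing tau lam (fun u => Vr u w) Uc a L m]
            & ((1 - L `^ (- p))%:E <= P E)%E].
Proof.
have [K hK] := hU; have [C C0 tv] := density_shift hrho.
(* The range is enlarged by one to make it positive, as the splitting into non-interacting clusters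
   requires. *)
have hK1 (z : int) : (K.+1 < `|z|)%N -> Uc z = 0 by move/ltnW; exact: hK.
case/andP: htau; rewrite gt_max => /andP[_ gt1] t1.
pose T : {set 'I_N} := [set: 'I_N]%SET.
have TN : (#|T| <= N)%N by rewrite cardsT card_ord.
have T0 : T != finset.set0 by rewrite -card_gt0 cardsT card_ord.
have [C1 hC1] := localization_by_labels hgamma gt1 t1 hN (ltn0Sn K) hK1 C0 tv TN T0 hm hp.
have /choice[C2 hC2] : forall L0 : R, exists c, 1 <= L0 -> C1 <= L0 ->
    forall lam, c <= lam -> forall Q, iid_env rho Q ->
    forall L, L0 <= L -> scale_loc tau Uc Q T lam L m p.
  move=> L0; case: (pselect (1 <= L0 /\ C1 <= L0)) => [[L01 L0C]|no].
    by have [c _ hc] := hC1 _ L01 L0C; exists c.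
  by exists 0 => L01 L0C; case: no.
exists C1, C2 => L0 L01 L0C lam _ lamC d Omega P Vr iid L L0L a.
have [Q [iQ PQ]] := iid_law iid.
have [W [mW _ hW QW]] := hC2 _ L01 L0C _ lamC _ iQ _ L0L a (supported_full a).
have [mE PE] := PQ _ mW; have L0' : 0 <= L by exact: le_trans (le_trans ler01 L01) L0L.
(* The witness is the complement of the pulled-back failure set: a measurable event inside the
   localization event. *)
exists (~` [set w | W (fun u => Vr u w)]); split; first exact: measurableC.
  by move=> w /hW; exact: strong_loc_cube_localizing.
rewrite probability_setC // PE EFinB leeB //.
Qed.
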